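(* Let $\mu$ be a probability measure on $\mathbb{R}^n$ with $C_P(\mu) \leq 1$, let $\epsilon \geq 0$, and assume that there exists an orthonormal family $e_1, \dots, e_k$ of $\mathbb{R}^n$ such that $\operatorname{Var}_\mu(x \cdot e_i) \geq (1+\epsilon)^{-1}$ for each $i \leq k$. Then there exists $p \in \mathcal{V} = \operatorname{Span}(e_1, \dots, e_k)$ such that $$W_1(\mu, \gamma_{p,\mathcal{V}} \otimes \bar{\mu}) \leq k \sqrt{\pi \epsilon},$$ where $\gamma_{p,\mathcal{V}}$ is the standard Gaussian measure on $\mathcal{V}$ with barycenter $p$, and $\bar{\mu}$ is the marginal distribution of $\mu$ on $\mathcal{V}^{\perp}$.
   Context: $C_P(\mu)$ denotes the Poincaré constant of $\mu$: the smallest $C$ such that $\operatorname{Var}_\mu(f) \leq C \int |\nabla f|^2 d\mu$ for all smooth test functions $f$. $W_1$ is the $L^1$ Kantorovich-Wasserstein distance (Euclidean cost). The standard Gaussian measure on $\mathcal{V}$ with barycenter $p$ has mean $p$ and identity covariance on $\mathcal V$. The product $\gamma_{p,\mathcal{V}} \otimes \bar{\mu}$ is viewed as a measure on $\mathbb{R}^n = \mathcal{V} \oplus \mathcal{V}^{\perp}$. *)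

(* Defs.v *)
From HB Require Import structures.
From mathcomp Require Import all_boot all_order all_algebra.
From mathcomp Require Import all_classical all_reals all_analysis measurable_realfun.

Set Implicit Arguments.
Unset Strict Implicit.
Unset Printing Implicit Defensive.

Import Order.TTheory GRing.Theory Num.Theory.
Import numFieldNormedType.Exports.

Local Open Scope classical_set_scope.
Local Open Scope ring_scope.

Section measurable_rV.
Context {R : realType} (n : nat).

Let coors (i : 'I_n) (x : 'rV[R]_n) : R := x ord0 i.

Let rV_set0 : g_sigma_preimage coors set0.
Proof. exact: sigma_algebra0. Qed.

Let rV_setC A : g_sigma_preimage coors A -> g_sigma_preimage coors (~` A).
Proof. exact: sigma_algebraC. Qed.

Let rV_bigcup (F : _^nat) : (forall i, g_sigma_preimage coors (F i)) ->
  g_sigma_preimage coors (\bigcup_i (F i)).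
Proof. exact: sigma_algebra_bigcup. Qed.

(* The product sigma-algebra on R^n, generated by the coordinates exactly as in
   the library's instance on [n.-tuple R]. It is the Borel sigma-algebra: see
   [measurable_rVE]. *)
HB.instance Definition _ := @isMeasurable.Build default_measure_display
  'rV[R]_n (g_sigma_preimage coors) rV_set0 rV_setC rV_bigcup.

Lemma measurable_coord (i : 'I_n) :
  measurable_fun [set: 'rV[R]_n] (fun x : 'rV[R]_n => x ord0 i).
Proof.
move=> _ Y mY; rewrite setTI; apply: sub_sigma_algebra => /=.
rewrite -bigcup_seq/=; exists i => /=; first by rewrite mem_index_enum.
by exists Y => //; rewrite setTI.
Qed.

Lemma measurable_fun_rVP d (T : measurableType d) (f : T -> 'rV[R]_n) :
  (forall i, measurable_fun [set: T] (fun t => f t ord0 i)) ->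
  measurable_fun [set: T] f.
Proof.
move=> mf _ A mA; rewrite setTI.
have : g_sigma_preimage (fun i => coors i \o f) (f @^-1` A).
  by rewrite g_sigma_preimage_comp; exists A => //; rewrite setTI.
apply: smallest_sub; first exact: sigma_algebra_measurable.
rewrite -bigcup_seq/= => B [i _ [C mC <-]].
exact: mf.
Qed.

Lemma measurable_rVE :
  @measurable _ 'rV[R]_n = <<s [set A : set 'rV[R]_n | open A] >>.
Proof.
apply/seteqP; split.
- apply: smallest_sub; first exact: smallest_sigma_algebra.
  rewrite -bigcup_seq/= => B [i _ [C mC <-]]; rewrite setTI.
  have : measurable_fun [set: g_sigma_algebraType (@open 'rV[R]_n)] (coors i).
    apply: (measurability _ (RGenOpens.measurableE R)).
    move=> _ [_ [a [b ->] <-]]; rewrite setTI; apply: sub_sigma_algebra.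
    apply: open_comp => //.
    by move=> x _; exact: coord_continuous.
  by move=> /(_ measurableT _ mC); rewrite setTI.
- apply: smallest_sub; first exact: sigma_algebra_measurable.
  move=> A /= oA.
  pose I := ('rV[rat]_n * nat)%type.
  pose B (q : I) : set 'rV[R]_n := ball (map_mx ratr q.1 : 'rV[R]_n) q.2.+1%:R^-1.
  have mB q : measurable (B q).
    have -> : B q = \bigcap_(i in [set: 'I_n])
        ((fun x : 'rV[R]_n => x ord0 i) @^-1`
          ball (ratr (q.1 ord0 i) : R) q.2.+1%:R^-1).
      apply/seteqP; split => [x [_ xB] i _|x xB].
        by have := xB ord0 i; rewrite mxE.
      by split => [|i j]; [rewrite invr_gt0|rewrite (ord1 i) mxE; exact: xB].
    apply: fin_bigcap_measurable; first exact: finite_finset.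
    move=> i _; rewrite -[X in measurable X]setTI; apply: measurable_coord => //.
    by apply: open_measurable; exact: ball_open.
  have -> : A = \bigcup_q (if `[< B q `<=` A >] then B q else set0).
    apply/seteqP; split => [x Ax|x [q _]]; last by case: asboolP => // qA /qA.
    have /nbhs_ballP[r /= r0 rA] : nbhs x A by exact: open_nbhs_nbhs.
    have [m mr] : exists m, m.+1%:R^-1 < r / 2 :> R.
      have r2 : 0 < (r / 2)^-1 by rewrite invr_gt0 divr_gt0.
      exists (Num.truncn (r / 2)^-1).
      rewrite invf_plt ?posrE ?divr_gt0// ?ltr0Sn//.
      by rewrite truncnS_gt.
    have /choice[q qx] : forall i, exists c : rat,
        ball (x ord0 i) m.+1%:R^-1 (ratr c : R).
      move=> i; suff [z [zB [c _ cE]]] :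
          ball (x ord0 i) m.+1%:R^-1 `&` range (@ratr R) !=set0.
        by exists c; rewrite cE.
      apply: dense_rat; last exact: ball_open.
      by exists (x ord0 i); apply: ballxx; rewrite invr_gt0.
    have qxB : ball x m.+1%:R^-1 (map_mx ratr (\row_i q i) : 'rV[R]_n).
      split => [|i j]; first by rewrite invr_gt0.
      by rewrite (ord1 i) !mxE; exact: qx.
    exists (\row_i q i, m) => //; case: asboolP => [_|]; first exact/ball_sym.
    case=> y yB; apply: rA; apply: (@le_ball _ _ _ (m.+1%:R^-1 + m.+1%:R^-1)).
      by rewrite [leRHS]splitr lerD// ltW.
    exact: ball_triangle qxB yB.
  apply: countable_bigcupT_measurable; first exact: countableP.
  by move=> q; case: ifP.
Qed.

End measurable_rV.

Section euclidean.
Context {R : realType} {n : nat}.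
Implicit Types x y : 'rV[R]_n.

Definition dotp x y : R := \sum_(i < n) x ord0 i * y ord0 i.

(* The norm `|x| on 'rV[R]_n provided by the library is the sup norm. *)
Definition enorm x : R := Num.sqrt (dotp x x).

Definition orthonormal_family {k : nat} (e : 'I_k -> 'rV[R]_n) : Prop :=
  forall i j, dotp (e i) (e j) = (i == j)%:R.

Definition family_span {k : nat} (e : 'I_k -> 'rV[R]_n) : {vspace 'rV[R]_n} :=
  <<[seq e i | i : 'I_k]>>%VS.

End euclidean.

Section poincare.
Context {R : realType} {n : nat}.
Implicit Types f : 'rV[R]_n -> R.

Definition partial (i : 'I_n) f : 'rV[R]_n -> R := 'D_(delta_mx ord0 i) f.

Definition grad f (x : 'rV[R]_n) : 'rV[R]_n := \row_i partial i f x.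

Definition smooth f : Prop := forall s : seq 'I_n,
  continuous (foldr partial f s) /\
  forall i x, derivable (foldr partial f s) x (delta_mx ord0 i).

Definition test_function f : Prop :=
  smooth f /\ compact (closure [set x | f x != 0]).

Local Open Scope ereal_scope.

Definition poincare_ineq (mu : probability 'rV[R]_n R) (C : R) : Prop :=
  forall f, test_function f ->
    'V_mu[f] <= C%:E * \int[mu]_x (enorm (grad f x) ^+ 2)%:E.

(* C_P(mu), equal to +oo when no finite constant is admissible. *)
Definition poincare_constant (mu : probability 'rV[R]_n R) : \bar R :=
  ereal_inf [set C%:E | C in [set C : R | (0 <= C)%R /\ poincare_ineq mu C]].

End poincare.

Section wasserstein.
Context {R : realType} {n : nat}.
Local Open Scope ereal_scope.

Definition coupling (mu nu : probability 'rV[R]_n R)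
    (P : probability ('rV[R]_n * 'rV[R]_n)%type R) : Prop :=
  (forall A, measurable A -> P (A `*` setT) = mu A) /\
  (forall B, measurable B -> P (setT `*` B) = nu B).

Definition wasserstein1 (mu nu : probability 'rV[R]_n R) : \bar R :=
  ereal_inf [set \int[P]_z (enorm (z.1 - z.2)%R)%:E | P in coupling mu nu].

End wasserstein.

Section gaussian.
Context {R : realType}.

Definition rV_cons (k : nat) (z : measurableTypeR R * 'rV[R]_k) :
    'rV[R]_k.+1 :=
  row_mx (const_mx z.1 : 'rV[R]_1) z.2.

Lemma measurable_rV_cons k : measurable_fun setT (@rV_cons k).
Proof.
apply: measurable_fun_rVP => i.
have [j ->|j ->] := @split_ordP 1 k i.
  rewrite (_ : (fun t => _) = fst)//.
  by apply/funext => t; rewrite /rV_cons [LHS]row_mxEl mxE.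
rewrite (_ : (fun t => _) = (fun x : 'rV[R]_k => x ord0 j) \o snd).
  by apply: measurableT_comp => //; exact: measurable_coord.
by apply/funext => t; rewrite /rV_cons [LHS]row_mxEr.
Qed.

HB.instance Definition _ k :=
  isMeasurableFun.Build _ _ _ _ (@rV_cons k) (@measurable_rV_cons k).

(* The standard Gaussian measure on R^k, the k-fold product of N(0, 1). *)
Fixpoint std_gaussian (k : nat) : probability 'rV[R]_k R :=
  if k is k'.+1 then
    distribution (normal_prob (0 : R) 1 \x std_gaussian k')%E (@rV_cons k')
  else dirac (0 : 'rV[R]_0).

Context {n k : nat}.
Implicit Types (e : 'I_k -> 'rV[R]_n) (p : 'rV[R]_n).

Definition affine_map e p (c : 'rV[R]_k) : 'rV[R]_n :=
  p + \sum_(i < k) c ord0 i *: e i.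

Lemma measurable_affine_map e p : measurable_fun setT (affine_map e p).
Proof.
apply: measurable_fun_rVP => j; rewrite /affine_map.
under eq_fun do rewrite mxE summxE.
apply: measurable_funD => //; apply: measurable_sum => i.
under eq_fun do rewrite mxE.
by apply: measurable_funM => //; exact: measurable_coord.
Qed.

HB.instance Definition _ e p :=
  isMeasurableFun.Build _ _ _ _ (affine_map e p) (measurable_affine_map e p).

(* For an orthonormal family e with span V and p in V: the standard Gaussian
   measure on V with barycenter p, as a measure on R^n carried by V, i.e. the
   law of p + G_1 e_1 + ... + G_k e_k with G_1, ..., G_k i.i.d. N(0, 1). *)
Definition gaussian_on e p : probability 'rV[R]_n R :=
  distribution (std_gaussian k) (affine_map e p).

(* For an orthonormal family e with span V: the orthogonal projection onto the
   orthogonal complement of V. *)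
Definition orth_proj e (x : 'rV[R]_n) : 'rV[R]_n :=
  x - \sum_(i < k) dotp x (e i) *: e i.

Lemma orth_projP e : orthonormal_family e -> forall x,
  (forall i, dotp (orth_proj e x) (e i) = 0) /\
  x - orth_proj e x \in family_span e.
Proof.
move=> oe x; split.
  move=> i; rewrite /orth_proj {1}/dotp.
  under eq_bigr do rewrite mxE mxE summxE mulrBl mulr_suml.
  rewrite sumrB -/(dotp x (e i)) exchange_big/=.
  rewrite (eq_bigr (fun j => dotp x (e j) * (j == i)%:R)) => [|j _]; last first.
    rewrite -oe [in RHS]/dotp mulr_sumr.
    by apply: eq_bigr => l _; rewrite mxE -mulrA.
  rewrite (bigD1 i)//= eqxx mulr1 big1 ?addr0 ?subrr// => j /negbTE ->.
  by rewrite mulr0.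
rewrite /orth_proj opprB addrC subrK; apply: memv_suml => i _.
by apply/memvZ/memv_span/map_f; rewrite mem_enum.
Qed.

Lemma measurable_orth_proj e : measurable_fun setT (orth_proj e).
Proof.
apply: measurable_fun_rVP => j; rewrite /orth_proj.
under eq_fun do rewrite mxE mxE summxE.
apply: measurable_funB => //; first exact: measurable_coord.
apply: measurable_sum => i.
under eq_fun do rewrite mxE.
apply: measurable_funM => //; apply: measurable_sum => l.
by apply: measurable_funM => //; exact: measurable_coord.
Qed.

HB.instance Definition _ e :=
  isMeasurableFun.Build _ _ _ _ (orth_proj e) (measurable_orth_proj e).

Definition orth_marginal e (mu : probability 'rV[R]_n R) :
    probability 'rV[R]_n R :=
  distribution mu (orth_proj e).

Definition rV_add (z : 'rV[R]_n * 'rV[R]_n) : 'rV[R]_n := z.1 + z.2.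

Lemma measurable_rV_add : measurable_fun setT rV_add.
Proof.
apply: measurable_fun_rVP => j; rewrite /rV_add.
under eq_fun do rewrite mxE.
by apply: measurable_funD;
  apply: (@measurableT_comp _ _ _ _ _ _ (fun x : 'rV[R]_n => x ord0 j)) => //;
  exact: measurable_coord.
Qed.

HB.instance Definition _ :=
  isMeasurableFun.Build _ _ _ _ rV_add measurable_rV_add.

(* For mu1 carried by V and mu2 carried by the orthogonal complement of V, the
   product measure on V x V^perp, read on R^n through (v, w) |-> v + w. *)
Definition direct_sum_product (mu1 mu2 : probability 'rV[R]_n R) :
    probability 'rV[R]_n R :=
  distribution (mu1 \x mu2)%E rV_add.

End gaussian.

(* Main.v *)
(** By duality it suffices to compare the integrals of a smooth 1-Lipschitz
    function [h].  Testing the Poincare inequality on [x.e_i + A f], with [A]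
    the quantity to be bounded, turns the almost maximal variance in the
    direction [e_i] into an approximate Stein identity
    [|\int (x.e_i - m_i) f - \int D_(e_i) f| <= sqrt eps] for [f] 1-Lipschitz.
    Let [T_t(g, x)] rotate the centered coordinates of [x] along [e_1, ..., e_k]
    into those of a standard Gaussian vector [g], [t] going from [0] to [pi / 2].
    Gaussian integration by parts in [g] and the Stein estimate in [x] bound the
    derivative of [t |-> E h(T_t(g, x))] by
    [k * sqrt eps * E|g_1| <= k * sqrt eps], and [pi / 2 <= sqrt pi].

    The duality used is the upper bound of [W_1] only: both measures are
    discretised to finitely many points, where an optimal relaxed transport plan
    yields dual potentials; the resulting Lipschitz minimum is replaced by a
    soft minimum, which is an explicit smooth function. *)

(* The hypothesis speaks only of compactly supported test functions, while [x.e_i + A f] grows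
   linearly and no moment of [mu] is assumed. A cutoff at radius rho has a gradient of order 1/rho
   against a growth of order rho, so truncations keep a bounded gradient; the Poincare inequality
   for them first yields second moments, then passes to the limit. The rotation is forced. Along a
   path a(t) X_i + b(t) g_i, with X_i the centered coordinate, the derivative of E h is the sum over
   i of a' E[X_i D_i h] + b' E[g_i D_i h]. Integration by parts in g gives E[g_i X_i h] = b
   E[X_i D_i h]; the Stein estimate at fixed g gives E[g_i X_i h] = a E[g_i D_i h] up to sqrt eps *
   E|g_i|. The main terms cancel exactly when a a' + b b' = 0, and for the rotation the factor a'/b
   left on the error is -1, with no singularity at t = 0 where b vanishes. No second derivative of h
   occurs, so only its Lipschitz constant enters the bound. *)
Require Import Defs.
From HB Require Import structures.
From mathcomp Require Import all_boot all_order all_algebra.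
From mathcomp Require Import all_classical all_reals all_analysis.
From mathcomp Require Import ring lra zify measurable_realfun.
Set Implicit Arguments.
Unset Strict Implicit.
Unset Printing Implicit Defensive.
Import Order.TTheory GRing.Theory Num.Theory.
Import numFieldNormedType.Exports.
Local Open Scope classical_set_scope.
Local Open Scope ring_scope.

(** * Euclidean norm *)

Section euclidean_norm.
Context {R : realType} {n : nat}.
Implicit Types (x y z : 'rV[R]_n) (a : R).

Lemma dotpC x y : dotp x y = dotp y x.
Proof. by apply: eq_bigr => i _; rewrite mulrC. Qed.

Lemma dotpDl x y z : dotp (x + y) z = dotp x z + dotp y z.
Proof.
by rewrite /dotp -big_split; apply: eq_bigr => i _; rewrite mxE mulrDl.
Qed.

Lemma dotpZl a x y : dotp (a *: x) y = a * dotp x y.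
Proof.
by rewrite /dotp mulr_sumr; apply: eq_bigr => i _; rewrite mxE mulrA.
Qed.

Lemma dotpDr x y z : dotp x (y + z) = dotp x y + dotp x z.
Proof. by rewrite dotpC dotpDl !(dotpC x). Qed.

Lemma dotpZr a x y : dotp x (a *: y) = a * dotp x y.
Proof. by rewrite dotpC dotpZl dotpC. Qed.

Lemma dotpNl x y : dotp (- x) y = - dotp x y.
Proof. by rewrite -scaleN1r dotpZl mulN1r. Qed.

Lemma dotpNr x y : dotp x (- y) = - dotp x y.
Proof. by rewrite dotpC dotpNl dotpC. Qed.

Lemma dotpBl x y z : dotp (x - y) z = dotp x z - dotp y z.
Proof. by rewrite dotpDl dotpNl. Qed.

Lemma dotpBr x y z : dotp x (y - z) = dotp x y - dotp x z.
Proof. by rewrite dotpDr dotpNr. Qed.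

Lemma dotp0l x : dotp 0 x = 0.
Proof. by rewrite -(scale0r 0) dotpZl mul0r. Qed.

Lemma dotp_suml (I : finType) (F : I -> 'rV[R]_n) y :
  dotp (\sum_i F i) y = \sum_i dotp (F i) y.
Proof.
by apply: (big_morph (dotp^~ y)) => [u v|]; rewrite ?dotpDl ?dotp0l.
Qed.

Lemma dotp_sumr (I : finType) (F : I -> 'rV[R]_n) y :
  dotp y (\sum_i F i) = \sum_i dotp y (F i).
Proof. by rewrite dotpC dotp_suml; apply: eq_bigr => i _; rewrite dotpC. Qed.

Lemma dotpp_ge0 x : 0 <= dotp x x.
Proof. by apply: sumr_ge0 => i _; rewrite -expr2 sqr_ge0. Qed.

Lemma dotpp_eq0 x : dotp x x = 0 -> x = 0.
Proof.
move=> /psumr_eq0P x0; apply/rowP => i; rewrite mxE.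
have /eqP := x0 (fun i _ => ltac:(by rewrite -expr2 sqr_ge0)) i isT.
by rewrite mulf_eq0 orbb => /eqP.
Qed.

Lemma enorm_ge0 x : 0 <= enorm x.
Proof. exact: sqrtr_ge0. Qed.

Lemma enorm_sqr x : enorm x ^+ 2 = dotp x x.
Proof. by rewrite sqr_sqrtr// dotpp_ge0. Qed.

Lemma enorm0 : enorm (0 : 'rV[R]_n) = 0.
Proof. by rewrite /enorm dotp0l sqrtr0. Qed.

(** The squared norm of [dotp y y *: x - dotp x y *: y] is [dotp y y] times the difference of the
    two sides, which settles every case but [y = 0]. *)
Lemma dotp_sqr_le x y : dotp x y ^+ 2 <= dotp x x * dotp y y.
Proof.
have := dotpp_ge0 (dotp y y *: x - dotp x y *: y).
rewrite dotpBl !dotpBr !dotpZl !dotpZr (dotpC y x).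
set a := dotp y y; set b := dotp x y; set c := dotp x x => H.
have [a0|a0] := ltP 0 a.
  by rewrite -(ler_pM2l a0); lra.
have y0 : y = 0.
  by apply: dotpp_eq0; apply/eqP; rewrite eq_le a0 dotpp_ge0.
by rewrite /a /b y0 (dotpC x) !dotp0l mulr0 expr0n.
Qed.

Lemma dotp_le x y : dotp x y <= enorm x * enorm y.
Proof.
apply: (le_trans (ler_norm _)).
rewrite -sqrtr_sqr /enorm -sqrtrM ?dotpp_ge0// ler_sqrt ?dotp_sqr_le//.
by rewrite mulr_ge0 ?dotpp_ge0.
Qed.

Lemma norm_dotp_le x y : `|dotp x y| <= enorm x * enorm y.
Proof.
rewrite -sqrtr_sqr /enorm -sqrtrM ?dotpp_ge0// ler_sqrt ?dotp_sqr_le//.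
by rewrite mulr_ge0 ?dotpp_ge0.
Qed.

Lemma enormZ a x : enorm (a *: x) = `|a| * enorm x.
Proof.
by rewrite /enorm dotpZl dotpZr mulrA -expr2 sqrtrM ?sqr_ge0// sqrtr_sqr.
Qed.

Lemma enormN x : enorm (- x) = enorm x.
Proof. by rewrite -scaleN1r enormZ normrN1 mul1r. Qed.

Lemma enormD x y : enorm (x + y) <= enorm x + enorm y.
Proof.
rewrite -[leRHS]ger0_norm ?addr_ge0 ?enorm_ge0//.
rewrite -[leRHS]sqrtr_sqr ler_sqrt ?sqr_ge0//.
rewrite sqrrD !enorm_sqr dotpDl !dotpDr (dotpC y x).
by have := dotp_le x y; lra.
Qed.

Lemma enormC x y : enorm (x - y) = enorm (y - x).
Proof. by rewrite -enormN opprB. Qed.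

Lemma enorm_triangle x y z : enorm (x - z) <= enorm (x - y) + enorm (y - z).
Proof. by rewrite -[x - z](subrKA y) enormD. Qed.

Lemma coord_le_enorm x i : `|x ord0 i| <= enorm x.
Proof.
rewrite -sqrtr_sqr ler_sqrt ?dotpp_ge0// /dotp (bigD1 i)//= -expr2 lerDl.
by apply: sumr_ge0 => j _; rewrite -expr2 sqr_ge0.
Qed.

Lemma enorm_sum (I : finType) (F : I -> 'rV[R]_n) :
  enorm (\sum_i F i) <= \sum_i enorm (F i).
Proof.
elim/big_ind2 : _ => [|x1 x2 y1 y2 h1 h2|i _]; rewrite ?enorm0//.
by apply: le_trans (enormD _ _) _; exact: lerD.
Qed.

Lemma enorm_le_sum_coord x : enorm x <= \sum_i `|x ord0 i|.
Proof.
rewrite {1}(row_sum_delta x); apply: le_trans (enorm_sum _) _.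
apply: ler_sum => i _; rewrite enormZ /enorm /dotp (bigD1 i)//= big1 => [|j ji].
  by rewrite mxE !eqxx mulr1 addr0 sqrtr1 mulr1.
by rewrite mxE (negbTE ji) andbF mul0r.
Qed.

Lemma continuous_enorm : continuous (@enorm R n).
Proof.
have cdotp : continuous (fun x : 'rV[R]_n => dotp x x).
  apply: continuous_big => [|i _ x]; first exact: add_continuous.
  by apply: (@cvgM _ _ (nbhs x)); exact: coord_continuous.
by move=> x; apply: continuous_comp (cdotp x) _; exact: sqrt_continuous.
Qed.

Lemma continuous_measurable_rV (f : 'rV[R]_n -> R) :
  continuous f -> measurable_fun setT f.
Proof.
move=> cf; apply: (measurability _ (RGenOpens.measurableE R)).
move=> _ [_ [a [b ->] <-]]; rewrite setTI measurable_rVE.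
apply: sub_sigma_algebra; exact: open_comp.
Qed.

End euclidean_norm.

(** * Smooth expressions *)

(* [flat p] is the function y |-> p(1/y) exp(-1/y) on the positive reals,
   extended by 0: this family is closed under differentiation. *)
Section flat.
Context {R : realType}.
Implicit Types (p : {poly R}) (y : R).

Definition flat p y : R := if 0 < y then p.[y^-1] * expR (- y^-1) else 0.

(** Chain rule through 1/y: the derivative of p(1/y) exp(-1/y) is y^(-2) (p(1/y) - p'(1/y))
    exp(-1/y). *)
Definition flat_deriv p : {poly R} := 'X^2 * (p - p^`()).

(** y^m / m! is a single term of the series of exp y. *)
Lemma pow_expRN_le (m : nat) y : 0 <= y -> y ^+ m * expR (- y) <= m`!%:R.
Proof.
move=> y0; rewrite expRN ler_pdivrMr ?expR_gt0// mulrC.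
rewrite -ler_pdivrMr ?ltr0n ?fact_gt0//.
case: m => [|m]; first by rewrite expr0 fact0 divr1 -expR0 ler_expR.
by apply: le_trans (expR_ge1Dxn m y0); rewrite lerDr.
Qed.

Lemma poly_expRN_bounded p : exists2 M, 0 <= M &
  forall y, 0 <= y -> `|p.[y] * expR (- y)| <= M.
Proof.
exists (\sum_(i < size p) `|p`_i| * i`!%:R).
  by apply: sumr_ge0 => i _; rewrite mulr_ge0.
move=> y y0; rewrite horner_coef mulr_suml; apply: le_trans (ler_norm_sum _ _ _) _.
apply: ler_sum => i _; rewrite -mulrA normrM ler_wpM2l//.
by rewrite ger0_norm ?mulr_ge0 ?exprn_ge0 ?expR_ge0// pow_expRN_le.
Qed.

(** The factor y^(-2) can be absorbed into the polynomial, and every polynomial times exp(-y) is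
    bounded. Quadratic decay at 0 makes the difference quotient at 0 tend to 0, the only delicate
    point of [is_derive_flat]. *)
Lemma flat_le_sqr p : exists2 M, 0 <= M & forall y, `|flat p y| <= M * y ^+ 2.
Proof.
have [M M0 pM] := poly_expRN_bounded ('X^2 * p).
exists M => // y; rewrite /flat; case: ifPn => y0; last first.
  by rewrite normr0 mulr_ge0 ?sqr_ge0.
have yi0 : 0 <= y^-1 by rewrite invr_ge0 ltW.
rewrite -ler_pdivrMr ?exprn_gt0//; apply: le_trans (pM _ yi0).
rewrite hornerM hornerXn -mulrA [leRHS]normrM mulrC -exprVn.
by rewrite [`|y^-1 ^+ 2|]ger0_norm// exprn_ge0.
Qed.

Lemma flat_bounded p : exists2 M, 0 <= M & forall y, `|flat p y| <= M.
Proof.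
have [M M0 pM] := poly_expRN_bounded p.
exists M => // y; rewrite /flat; case: ifPn => y0; last by rewrite normr0.
by apply: pM; rewrite invr_ge0 ltW.
Qed.

Lemma is_derive_flat p y : is_derive y 1 (flat p) (flat (flat_deriv p) y).
Proof.
have [y0|y0|->] := ltgtP y 0.
- rewrite /flat ltNge (ltW y0)/=.
  apply: (@near_eq_is_derive _ _ _ (cst 0)) => //.
  near=> z; rewrite ifF//; apply/negbTE; rewrite -leNgt ltW//; near: z.
  exact: lt_nbhsl.
- have -> : flat (flat_deriv p) y =
      p.[y^-1] * (expR (- y^-1) * y^-1 ^+ 2)
      + expR (- y^-1) * (p^`().[y^-1] * (- (y^-1 ^+ 2))).
    rewrite /flat y0 /flat_deriv hornerM hornerXn hornerD hornerN; ring.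
  have dV : is_derive y 1 (fun z : R => z^-1) (- (y^-1 ^+ 2)).
    have H := @is_deriveV _ id y 1 1 (lt0r_neq0 y0) (is_derive_id _ _).
    by apply: is_derive_eq H _; rewrite [LHS]mulr1 exprVn.
  have dp : is_derive y 1 (horner p \o (fun z : R => z^-1))
      (p^`().[y^-1] * (- (y^-1 ^+ 2))).
    exact: is_derive1_comp.
  have de : is_derive y 1 (expR \o (-%R \o (fun z : R => z^-1)))
      (expR (- y^-1) * y^-1 ^+ 2).
    apply: is_derive1_comp; rewrite -[y^-1 ^+ 2]opprK; exact: is_deriveN.
  apply: near_eq_is_derive (is_deriveM dp de).
  by near=> z; rewrite /flat ifT//; near: z; exact: lt_nbhsr.
- rewrite {2}/flat ltxx.
  have [M M0 fM] := flat_le_sqr p.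
  suff H : h^-1 *: (flat p (h *: 1 + 0) - flat p 0) @[h --> 0^'] --> (0 : R).
    by apply: DeriveDef; [apply/cvg_ex; exists 0|exact: cvg_lim H].
  apply: norm_cvg0.
  apply: (@squeeze_cvgr _ _ _ _ (cst 0) (fun h => M * `|h|)).
  + near=> h; rewrite normr_ge0/= scaler1 addr0 {2}/flat ltxx subr0.
    rewrite [h^-1 *: _]/(h^-1 * _) normrM normfV.
    have h0 : h != 0 by near: h; exact: nbhs_dnbhs_neq.
    rewrite ler_pdivrMl ?normr_gt0//; apply: le_trans (fM h) _.
    by rewrite [leRHS]mulrCA -expr2 real_normK ?num_real.
  + exact: cvg_cst.
  + have H : `|h| @[h --> (0 : R)^'] --> (0 : R).
      by rewrite -[X in _ --> X](normr0 R); apply: cvg_norm; exact: cvg_within.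
    by rewrite -[X in _ --> X](mulr0 M); exact: cvgMr.
Unshelve. all: by end_near. Qed.

End flat.

Section chain_rule.
Context {R : realType}.

Lemma differentiable_comp1 (V : normedModType R) (phi : R -> R) (f : V -> R) x c :
  differentiable f x -> is_derive (f x) 1 phi c ->
  differentiable (fun y => phi (f y)) x /\
  forall v, 'D_v (fun y => phi (f y)) x = c * 'D_v f x.
Proof.
move=> df [dphi phiE].
have dphi' : differentiable phi (f x) by exact/derivable1_diffP.
have dc : differentiable (phi \o f) x by exact: differentiable_comp.
split => // v; rewrite [LHS]deriveE// diff_comp//= (deriveE _ df).
by rewrite -[RHS]mulrC -phiE -derive1E deriv1E.
Qed.

Lemma derivable_along (n : nat) (f : 'rV[R]_n -> R) (c : R -> 'rV[R]_n)
    (c' : 'rV[R]_n) t :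
  differentiable f (c t) -> is_derive t 1 c c' ->
  is_derive t 1 (fun s => f (c s)) ('D_c' f (c t)).
Proof.
move=> df [dc cE].
have dc' : differentiable c t by exact/derivable1_diffP.
have dfc : differentiable (f \o c) t by exact: differentiable_comp.
apply: DeriveDef; first exact/derivable1_diffP.
by rewrite [LHS]deriveE// diff_comp//= -cE !deriveE.
Qed.

End chain_rule.

(** [smooth] concerns all iterated partial derivatives at once; a syntactic class stable under
    [partial] reduces it to a single induction. Square roots and reciprocals are written with [expR]
    and [ln], cutoffs with [flat]. *)
Inductive smooth_expr {R : realType} (n : nat) : ('rV[R]_n -> R) -> Prop :=
| smooth_cst c : smooth_expr (fun=> c)
| smooth_coord i : smooth_expr (fun x => x ord0 i)
| smooth_add f g : smooth_expr f -> smooth_expr g ->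
    smooth_expr (fun x => f x + g x)
| smooth_mul f g : smooth_expr f -> smooth_expr g ->
    smooth_expr (fun x => f x * g x)
| smooth_exp f : smooth_expr f -> smooth_expr (fun x => expR (f x))
| smooth_ln f : (forall x, 0 < f x) -> smooth_expr f ->
    smooth_expr (fun x => ln (f x))
| smooth_flat p f : smooth_expr f -> smooth_expr (fun x => flat p (f x)).

Section smooth_expr_theory.
Context {R : realType} {n : nat}.
Implicit Types (f : 'rV[R]_n -> R).

(** Both halves go through one induction, because the formula for each partial derivative requires
    the components to be differentiable. *)
Lemma smooth_expr_diff f : smooth_expr f ->
  (forall x, differentiable f x) /\ forall i, smooth_expr (partial i f).
Proof.
elim=> {f} [c|i|f g _ [df sf] _ [dg sg]|f g fS [df sf] gS [dg sg]|f fS [df sf]|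
  f f0 fS [df sf]|p f fS [df sf]].
- split=> [x|i]; first exact: differentiable_cst.
  rewrite (_ : partial i _ = fun=> 0); first exact: smooth_cst.
  by apply/funext => x; rewrite /partial derive_cst.
- split=> [x|j]; first exact: differentiable_coord.
  rewrite (_ : partial j _ = fun=> (i == j)%:R); first exact: smooth_cst.
  apply/funext => x; rewrite /partial.
  have := derive_id x (delta_mx ord0 j); rewrite derive_mx; last first.
    exact: derivable_id.
  by move=> /rowP/(_ i); rewrite !mxE.
- split=> [x|i]; first exact: (differentiableD (df x) (dg x)).
  rewrite (_ : partial i _ = fun x => partial i f x + partial i g x).
    exact: smooth_add.
  apply/funext => x; rewrite /partial.
  by apply: deriveD; exact: diff_derivable.
- split=> [x|i]; first exact: (differentiableM (df x) (dg x)).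
  rewrite (_ : partial i _ = fun x => f x * partial i g x + g x * partial i f x).
    by apply: smooth_add; exact: smooth_mul.
  apply/funext => x; rewrite /partial.
  by apply: deriveM; exact: diff_derivable.
- have H x := differentiable_comp1 (df x) (is_derive_expR (f x)).
  split=> [x|i]; first exact: (H x).1.
  rewrite (_ : partial i _ = fun x => expR (f x) * partial i f x).
    by apply: smooth_mul => //; exact: smooth_exp.
  by apply/funext => x; rewrite /partial (H x).2.
- have H x := differentiable_comp1 (df x) (is_derive1_ln (f0 x)).
  split=> [x|i]; first exact: (H x).1.
  (* The reciprocal of f is written exp(- ln f), which stays in the class. *)
  rewrite (_ : partial i _ =
    fun x => expR (-1 * ln (f x)) * partial i f x).
    apply: smooth_mul => //; apply: smooth_exp; apply: smooth_mul.
      exact: smooth_cst.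
    exact: smooth_ln.
  apply/funext => x; rewrite /partial (H x).2 mulN1r expRN lnK//.
  exact: f0.
- have H x := differentiable_comp1 (df x) (is_derive_flat p (f x)).
  split=> [x|i]; first exact: (H x).1.
  rewrite (_ : partial i _ = fun x => flat (flat_deriv p) (f x) * partial i f x).
    by apply: smooth_mul => //; exact: smooth_flat.
  by apply/funext => x; rewrite /partial (H x).2.
Qed.

Lemma smooth_expr_differentiable f x : smooth_expr f -> differentiable f x.
Proof. by move=> /smooth_expr_diff[]. Qed.

Lemma smooth_expr_partial f i : smooth_expr f -> smooth_expr (partial i f).
Proof. by move=> /smooth_expr_diff[]. Qed.

Lemma smooth_expr_continuous f : smooth_expr f -> continuous f.
Proof.
by move=> fS x; apply: differentiable_continuous;
  exact: smooth_expr_differentiable.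
Qed.

Lemma smooth_expr_measurable f : smooth_expr f -> measurable_fun setT f.
Proof.
by move=> fS; apply: continuous_measurable_rV; exact: smooth_expr_continuous.
Qed.

Lemma smooth_expr_smooth f : smooth_expr f -> smooth f.
Proof.
move=> fS s; have {fS} : smooth_expr (foldr partial f s).
  by elim: s => //= i s; exact: smooth_expr_partial.
move=> fS; split; first exact: smooth_expr_continuous.
by move=> i x; apply: diff_derivable; exact: smooth_expr_differentiable.
Qed.

Lemma smooth_sum (I : Type) (r : seq I) (F : I -> 'rV[R]_n -> R) :
  (forall i, smooth_expr (F i)) -> smooth_expr (fun x => \sum_(i <- r) F i x).
Proof.
move=> FS; elim: r => [|i r IH].
  by under eq_fun do rewrite big_nil; exact: smooth_cst.
by under eq_fun do rewrite big_cons; exact: smooth_add.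
Qed.

Lemma smooth_scale a f : smooth_expr f -> smooth_expr (fun x => a * f x).
Proof. by move=> fS; apply: smooth_mul => //; exact: smooth_cst. Qed.

Lemma smooth_opp f : smooth_expr f -> smooth_expr (fun x => - f x).
Proof. by move=> fS; under eq_fun do rewrite -mulN1r; exact: smooth_scale. Qed.

Lemma smooth_sub f g : smooth_expr f -> smooth_expr g ->
  smooth_expr (fun x => f x - g x).
Proof. by move=> fS gS; apply: smooth_add => //; exact: smooth_opp. Qed.

Lemma smooth_dotp v : smooth_expr (fun x : 'rV[R]_n => dotp x v).
Proof.
by apply: smooth_sum => i; apply: smooth_mul; [exact: smooth_coord|exact: smooth_cst].
Qed.

Lemma smooth_dotpp : smooth_expr (fun x : 'rV[R]_n => dotp x x).
Proof. by apply: smooth_sum => i; apply: smooth_mul; exact: smooth_coord. Qed.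

Lemma smooth_comp m (f : 'rV[R]_m -> R) (A : 'rV[R]_n -> 'rV[R]_m) :
  smooth_expr f -> (forall i, smooth_expr (fun x => A x ord0 i)) ->
  smooth_expr (fun x => f (A x)).
Proof.
move=> fS AS; elim: fS => {f} [c|i|f g _ ? _ ?|f g _ ? _ ?|f _ ?|f f0 _ ?|p f _ ?].
- exact: smooth_cst.
- exact: AS.
- exact: smooth_add.
- exact: smooth_mul.
- exact: smooth_exp.
- by apply: smooth_ln => // x; exact: f0.
- exact: smooth_flat.
Qed.

Lemma derive_dotp_grad f x v : differentiable f x ->
  'D_v f x = dotp (grad f x) v.
Proof.
move=> df; rewrite deriveE// {1}(row_sum_delta v) linear_sum.
apply: eq_bigr => i _; rewrite linearZ/= mxE /partial deriveE//.
by rewrite mulrC.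
Qed.

Definition elipschitz (L : R) f := forall x y, `|f x - f y| <= L * enorm (x - y).

Lemma elipschitz_derive L f x v : elipschitz L f -> differentiable f x ->
  `|'D_v f x| <= L * enorm v.
Proof.
move=> fL df.
have dv : derivable f x v by exact: diff_derivable.
have H : `|h^-1 *: (f (h *: v + x) - f x)| @[h --> 0^'] --> `|'D_v f x|.
  by apply: cvg_norm; exact: dv.
apply: cvgr_to_le H _; near=> h.
rewrite normrM normfV ler_pdivrMl; last first.
  by rewrite normr_gt0; near: h; exact: nbhs_dnbhs_neq.
by apply: le_trans (fL _ _) _; rewrite addrK enormZ mulrCA.
Unshelve. all: by end_near. Qed.

(** The direction [grad f x] itself in [elipschitz_derive] gives |grad f|^2 <= L |grad f|. *)
Lemma enorm_grad_le L f x : 0 <= L -> elipschitz L f -> differentiable f x ->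
  enorm (grad f x) <= L.
Proof.
move=> L0 fL df; have := elipschitz_derive (grad f x) fL df.
rewrite derive_dotp_grad// -enorm_sqr ger0_norm ?sqr_ge0// expr2.
have [->//|g0] := eqVneq (enorm (grad f x)) 0.
by rewrite ler_pM2r// lt_def g0 enorm_ge0.
Qed.

End smooth_expr_theory.

(** * Finite transport problems *)

Section finite_transport_duality.
Context {R : realType} {I : finType}.
Variables (a b : I -> R) (d : I -> I -> R) (K : R).
Hypotheses (a0 : forall s, 0 <= a s) (b0 : forall s, 0 <= b s).
Hypotheses (a1 : \sum_s a s = 1) (b1 : \sum_s b s = 1).
Hypothesis d0 : forall s t, 0 <= d s t.
Hypothesis dualK : forall phi psi : I -> R,
  (forall s t, phi s + psi t <= d s t) ->
  \sum_s a s * phi s + \sum_t b t * psi t <= K.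

Let row (p : I -> I -> R) s := \sum_t p s t.
Let col (p : I -> I -> R) t := \sum_s p s t.
Let cost (p : I -> I -> R) := \sum_s \sum_t p s t * d s t.
Let excess p := Num.max (cost p - K) 0.
(** Least-squares relaxation of the transport problem: squared violations of both marginal
    constraints and of [cost p <= K]. Its zeros among nonnegative [p] are the plans sought. *)
Let defect p := \sum_s (row p s - a s) ^+ 2 + \sum_t (col p t - b t) ^+ 2
  + excess p ^+ 2.

Let bump (p : I -> I -> R) s0 t0 tau s t :=
  p s t + tau * ((s == s0)%:R * (t == t0)%:R).

(** Homogeneity for positive [c]. The case [c = 0] is a limit: as [d] is nonnegative, a pair
    feasible for the zero cost is feasible at every positive scale. It is required because the
    multiplier [excess p] may vanish. *)
Lemma dual_scaled c (phi psi : I -> R) : 0 <= c ->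
  (forall s t, phi s + psi t <= c * d s t) ->
  \sum_s a s * phi s + \sum_t b t * psi t <= c * K.
Proof.
have pos c' phi' psi' : 0 < c' -> (forall s t, phi' s + psi' t <= c' * d s t) ->
    \sum_s a s * phi' s + \sum_t b t * psi' t <= c' * K.
  move=> c0 H; rewrite -ler_pdivrMl// mulrDr !mulr_sumr.
  rewrite (eq_bigr (fun s => a s * (c'^-1 * phi' s))); last first.
    by move=> s _; rewrite mulrCA.
  rewrite [X in _ + X](eq_bigr (fun s => b s * (c'^-1 * psi' s))); last first.
    by move=> s _; rewrite mulrCA.
  by apply: dualK => s t; rewrite -mulrDr ler_pdivrMl.
rewrite le_eqVlt => /predU1P[<-|]; last exact: pos.
move=> H; rewrite mul0r; apply/ler_addgt0Pr => e e0; rewrite add0r.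
have K1 : 0 < `|K| + 1 by rewrite ltr_wpDl.
apply: (@le_trans _ _ (e / (`|K| + 1) * K)).
  apply: pos; first by rewrite divr_gt0.
  move=> s t; apply: le_trans (H s t) _; rewrite mul0r mulr_ge0//.
  by rewrite divr_ge0 ?ltW.
rewrite mulrAC ler_pdivrMr// ler_pM2l//; apply: le_trans (ler_norm _) _.
by rewrite lerDl.
Qed.

Lemma row_bump p s0 t0 tau s : row (bump p s0 t0 tau) s = row p s + tau * (s == s0)%:R.
Proof.
rewrite /row /bump big_split/=; congr (_ + _).
rewrite (bigD1 t0)//= eqxx mulr1 big1 ?addr0// => t /negbTE ->.
by rewrite !mulr0.
Qed.

Lemma col_bump p s0 t0 tau t : col (bump p s0 t0 tau) t = col p t + tau * (t == t0)%:R.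
Proof.
rewrite /col /bump big_split/=; congr (_ + _).
rewrite (bigD1 s0)//= eqxx mul1r big1 ?addr0// => s /negbTE ->.
by rewrite mul0r mulr0.
Qed.

Lemma cost_bump p s0 t0 tau : cost (bump p s0 t0 tau) = cost p + tau * d s0 t0.
Proof.
transitivity (cost p + \sum_s \sum_t tau * ((s == s0)%:R * (t == t0)%:R) * d s t).
  rewrite /cost -big_split; apply: eq_bigr => s _ /=.
  by rewrite -big_split; apply: eq_bigr => t _ /=; rewrite mulrDl.
congr (_ + _); rewrite (bigD1 s0)//= [X in _ + X]big1 => [|s /negbTE ->]; last first.
  by rewrite big1// => t _; rewrite mul0r mulr0 mul0r.
rewrite addr0 (bigD1 t0)//= big1 => [|t /negbTE ->].
  by rewrite !eqxx !mulr1 addr0.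
by rewrite !mulr0 mul0r.
Qed.

Let sum_sqr_bump (u : I -> R) s0 tau :
  \sum_s (u s + tau * (s == s0)%:R) ^+ 2 =
  \sum_s u s ^+ 2 + (2 * tau * u s0 + tau ^+ 2).
Proof.
rewrite (bigD1 s0)//= [in RHS](bigD1 s0)//= eqxx mulr1.
rewrite (eq_bigr (fun s => u s ^+ 2)) => [|s /negbTE ->]; last first.
  by rewrite mulr0 addr0.
ring.
Qed.

(** Half the derivative of [defect] when mass is added to the cell (s, t). *)
Let slope p s t := (row p s - a s) + (col p t - b t) + excess p * d s t.

(** The marginal terms expand exactly. For the excess, max(x + tau y - K, 0)^2 <= (max(x - K, 0) +
    tau y)^2 holds for either sign of [tau]; an upper bound is all that a first-order condition at a
    minimum requires. *)
Lemma defect_bump p s t tau : defect (bump p s t tau) <=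
  defect p + (2 * tau * slope p s t + tau ^+ 2 * (2 + d s t ^+ 2)).
Proof.
rewrite /defect.
rewrite (eq_bigr (fun s' => ((row p s' - a s') + tau * (s' == s)%:R) ^+ 2)); last first.
  by move=> s' _; rewrite row_bump addrAC.
rewrite sum_sqr_bump [X in _ + X + _](eq_bigr
  (fun s' => ((col p s' - b s') + tau * (s' == t)%:R) ^+ 2)); last first.
  by move=> s' _; rewrite col_bump addrAC.
rewrite sum_sqr_bump.
have : excess (bump p s t tau) ^+ 2 <=
    excess p ^+ 2 + 2 * tau * (excess p * d s t) + tau ^+ 2 * d s t ^+ 2.
  rewrite /excess cost_bump.
  set x := cost p; set y := d s t.
  rewrite [leRHS](_ : _ = (Num.max (x - K) 0 + tau * y) ^+ 2); last by ring.
  have [h|h] := leP (x + tau * y - K) 0; first by rewrite expr0n sqr_ge0.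
  have h2 : x + tau * y - K <= Num.max (x - K) 0 + tau * y.
    by rewrite addrAC lerD2r le_max lexx.
  by rewrite ler_sqr// nnegrE ?(ltW h)// (le_trans (ltW h)).
rewrite /slope; lra.
Qed.

Let slope_ge0 (g c eta : R) : 0 < eta -> 0 <= c ->
  (forall tau, 0 < tau -> tau <= eta -> 0 <= 2 * tau * g + tau ^+ 2 * c) ->
  0 <= g.
Proof.
move=> eta0 c0 H; rewrite leNgt; apply/negP => g0.
have c1 : 0 < c + 1 by rewrite ltr_wpDl.
have ng : 0 < - g / (c + 1) by rewrite divr_gt0 ?oppr_gt0.
pose tau := Num.min eta (- g / (c + 1)).
have tau0 : 0 < tau by rewrite lt_min eta0 ng.
have := H tau tau0; rewrite ge_min lexx => /(_ isT).
rewrite (_ : _ + _ = tau * (2 * g + tau * c)); last by ring.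
rewrite pmulr_rge0//.
have : tau * (c + 1) <= - g by rewrite -ler_pdivlMr// ge_min lexx orbT.
nra.
Qed.

(** A minimiser p of [defect] over a compact box has nonnegative slopes, equal to 0 wherever p > 0.
    Hence phi = a - row p and psi = b - col p are dual potentials for the cost [excess p * d], so
    sum a phi + sum b psi <= excess K, while complementary slackness gives sum (row p) phi + sum
    (col p) psi = excess * cost. Subtracting, sum phi^2 + sum psi^2 <= - excess^2, so every
    violation is zero. *)
Lemma finite_coupling : exists p : I -> I -> R,
  [/\ forall s t, 0 <= p s t, forall s, \sum_t p s t = a s,
      forall t, \sum_s p s t = b t & \sum_s \sum_t p s t * d s t <= K].
Proof.
pose N := #|{: I * I}|.
pose P (x : 'rV[R]_N) s t := x ord0 (enum_rank (s, t)).
(* The bound 3 is never active at the minimum: [defect] is there at most its value at 0, hence at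
   most 2, so each entry is at most 1 + sqrt 2 < 5/2, and an increase of up to 1/2 stays in the
   box. *)
pose box : set 'rV[R]_N := [set x | forall i, `[0, 3]%classic (x ord0 i)].
have cbox : compact box.
  by apply: (@rV_compact R N (fun=> `[0, 3]%classic)) => _; exact: segment_compact.
have cP s t : continuous (fun x => P x s t).
  by move=> x; exact: coord_continuous.
have csum (J : finType) (F : J -> 'rV[R]_N -> R) : (forall j, continuous (F j)) ->
    continuous (fun x => \sum_j F j x).
  by move=> cF; apply: continuous_big => [|j _]; [exact: add_continuous|exact: cF].
have csqr (F : 'rV[R]_N -> R) : continuous F -> continuous (fun x => F x ^+ 2).
  by move=> cF x; exact: (@cvgM _ _ (nbhs x) _ _ _ _ _ (cF x) (cF x)).
have cB (F : 'rV[R]_N -> R) c : continuous F -> continuous (fun x => F x - c).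
  by move=> cF x; apply: (@cvgB _ _ _ (nbhs x)); [exact: cF|exact: cvg_cst].
have cD (F G : 'rV[R]_N -> R) : continuous F -> continuous G ->
    continuous (fun x => F x + G x).
  by move=> cF cG x; apply: (@cvgD _ _ _ (nbhs x)); [exact: cF|exact: cG].
have cdef : continuous (fun x => defect (P x)).
  apply: (cD _ (fun x => excess (P x) ^+ 2)); first apply: cD.
  - by apply: (csum _) => s; apply: csqr; apply: cB; apply: (csum _) => t; exact: cP.
  - by apply: (csum _) => t; apply: csqr; apply: cB; apply: (csum _) => s; exact: cP.
  - apply: csqr => x; apply: (@continuous_max _ _ (fun x => cost (P x) - K) (cst 0)).
      apply: cB; apply: (csum _) => s; apply: (csum _) => t {}x.
      by apply: (@cvgM _ _ (nbhs x)); [exact: cP|exact: cvg_cst].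
    exact: cst_continuous.
have box0 : box !=set0.
  by exists 0 => i; rewrite /= mxE in_itv/= lexx/=; lra.
have [x /set_mem xbox xmin] := @compact_EVT_min _ _ (fun x => defect (P x)) box box0 cbox
  (continuous_subspaceT cdef).
set p := P x.
have K0 : 0 <= K.
  have := @dualK (fun=> 0) (fun=> 0) (fun s t => ltac:(by rewrite addr0)).
  by do 2 (rewrite big1 ?add0r; last by move=> ? _; rewrite mulr0).
have p0 s t : 0 <= p s t by have := xbox (enum_rank (s, t)); rewrite /= in_itv/= => /andP[].
have a_le1 s : a s <= 1.
  by rewrite -a1 (bigD1 s)//= lerDl; apply: sumr_ge0.
have b_le1 s : b s <= 1.
  by rewrite -b1 (bigD1 s)//= lerDl; apply: sumr_ge0.
have def2 : defect p <= 2.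
  apply: (@le_trans _ _ (defect (P 0))).
    by apply: xmin; rewrite inE => i /=; rewrite mxE in_itv/= lexx/=; lra.
  have P00 s t : P 0 s t = 0 by rewrite /P mxE.
  have excess0 : excess (P 0) = 0.
    rewrite /excess (_ : cost _ = 0) ?sub0r; last first.
      by rewrite /cost big1// => s _; rewrite big1// => t _; rewrite P00 mul0r.
    by apply/max_idPr; rewrite oppr_le0.
  rewrite /defect excess0 expr0n addr0 (_ : 2 = \sum_s a s + \sum_s b s); last first.
    by rewrite a1 b1.
  apply: lerD; apply: ler_sum => s _.
    rewrite /row big1 ?sub0r ?sqrrN; last by move=> t _; rewrite P00.
    by rewrite expr2 ler_piMr.
  rewrite /col big1 ?sub0r ?sqrrN; last by move=> t _; rewrite P00.
  by rewrite expr2 ler_piMr.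
have p3 s t : p s t <= 5/2.
  have : (row p s - a s) ^+ 2 <= 2.
    apply: le_trans def2; rewrite /defect (bigD1 s)//= -!addrA lerDl.
    by rewrite !addr_ge0 ?sqr_ge0//; apply: sumr_ge0 => ? _; rewrite sqr_ge0.
  have : p s t <= row p s.
    by rewrite /row (bigD1 t)//= lerDl; apply: sumr_ge0.
  have := a_le1 s; nra.
have bumpmin s t tau : 0 <= p s t + tau -> p s t + tau <= 3 ->
    defect p <= defect (bump p s t tau).
  move=> h1 h2.
  pose y : 'rV[R]_N := \row_i bump p s t tau (enum_val i).1 (enum_val i).2.
  have yE : P y = bump p s t tau.
    by apply/funext => s'; apply/funext => t'; rewrite /P mxE enum_rankK.
  rewrite -yE; apply: xmin; rewrite inE => i /=; rewrite mxE in_itv/=.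
  case: (enum_val i) => s' t' /=; rewrite /bump.
  have [->|_] := eqVneq s' s; last first.
    by rewrite mul0r mulr0 addr0 p0 (le_trans (p3 _ _))//; lra.
  have [->|_] := eqVneq t' t; first by rewrite !mulr1 h1 h2.
  by rewrite mulr0 mulr0 addr0 p0 (le_trans (p3 _ _))//; lra.
have c0 s t : 0 <= 2 + d s t ^+ 2 by rewrite addr_ge0 ?sqr_ge0.
have slope0 s t : 0 <= slope p s t.
  apply: (@slope_ge0 _ (2 + d s t ^+ 2) (1/2)) => //.
  move=> tau t0 t1; rewrite -(lerD2l (defect p)) addr0.
  apply: le_trans (defect_bump p s t tau).
  by apply: bumpmin; [exact: addr_ge0 (p0 s t) (ltW t0)|have := p3 s t; lra].
have slack s t : p s t * slope p s t = 0.
  have := p0 s t; rewrite le_eqVlt => /predU1P[<-|pst]; first by rewrite mul0r.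
  suff : 0 <= - slope p s t.
    rewrite oppr_ge0 => h; have -> : slope p s t = 0.
      by apply/eqP; rewrite eq_le h slope0.
    by rewrite mulr0.
  apply: (@slope_ge0 _ (2 + d s t ^+ 2) (p s t)) => //.
  move=> tau t0 t1; rewrite -(lerD2l (defect p)) addr0.
  rewrite (_ : _ + tau ^+ 2 * _ = 2 * (- tau) * slope p s t +
    (- tau) ^+ 2 * (2 + d s t ^+ 2)); last by ring.
  apply: le_trans (defect_bump p s t _).
  by apply: bumpmin; [rewrite subr_ge0|have := p3 s t; lra].
pose phi s := a s - row p s; pose psi t := b t - col p t.
have ex0 : 0 <= excess p by rewrite le_max lexx orbT.
have feas : \sum_s a s * phi s + \sum_t b t * psi t <= excess p * K.
  apply: dual_scaled => // s t.
  by have := slope0 s t; rewrite /slope /phi /psi; lra.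
have comp : \sum_s row p s * phi s + \sum_t col p t * psi t = excess p * cost p.
  have : \sum_s \sum_t p s t * slope p s t = 0.
    by rewrite big1// => s _; rewrite big1.
  rewrite (eq_bigr (fun s => - (row p s * phi s) + (\sum_t - (p s t * psi t)
     + \sum_t p s t * (excess p * d s t)))); last first.
    move=> s _; rewrite /row mulr_suml -sumrN -!big_split/=.
    by apply: eq_bigr => t _; rewrite /slope /phi /psi; ring.
  rewrite !big_split/= sumrN.
  have -> : \sum_s \sum_t - (p s t * psi t) = - \sum_t col p t * psi t.
    rewrite exchange_big/= -sumrN; apply: eq_bigr => t _.
    by rewrite sumrN /col mulr_suml.
  rewrite (_ : \sum_s \sum_t p s t * (excess p * d s t) = excess p * cost p).
    lra.
  rewrite /cost mulr_sumr; apply: eq_bigr => s _; rewrite mulr_sumr.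
  by apply: eq_bigr => t _; rewrite mulrCA.
have exE : excess p * (cost p - K) = excess p ^+ 2.
  by rewrite /excess; case: leP => _; rewrite ?mul0r ?expr0n.
have tot : \sum_s phi s ^+ 2 + \sum_t psi t ^+ 2 + excess p ^+ 2 <= 0.
  have e1 : \sum_s phi s ^+ 2 = \sum_s a s * phi s - \sum_s row p s * phi s.
    by rewrite -sumrB; apply: eq_bigr => s _; rewrite -mulrBl.
  have e2 : \sum_s psi s ^+ 2 = \sum_s b s * psi s - \sum_s col p s * psi s.
    by rewrite -sumrB; apply: eq_bigr => s _; rewrite -mulrBl.
  by rewrite e1 e2 -exE; lra.
have sq1 : 0 <= \sum_s phi s ^+ 2 by apply: sumr_ge0 => ? _; rewrite sqr_ge0.
have sq2 : 0 <= \sum_s psi s ^+ 2 by apply: sumr_ge0 => ? _; rewrite sqr_ge0.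
have sq3 := sqr_ge0 (excess p).
have zero (F : I -> R) : \sum_s F s ^+ 2 <= 0 -> forall s, F s = 0.
  move=> h s; apply/eqP; rewrite -sqrf_eq0 eq_le sqr_ge0 andbT.
  by apply: le_trans h; rewrite (bigD1 s)//= lerDl; apply: sumr_ge0 => ? _; rewrite sqr_ge0.
exists p; split=> //.
- move=> s; apply/eqP; rewrite eq_sym -subr_eq0; apply/eqP.
  by apply: (zero phi); lra.
- move=> t; apply/eqP; rewrite eq_sym -subr_eq0; apply/eqP.
  by apply: (zero psi); lra.
- have : excess p == 0 by rewrite -sqrf_eq0 eq_le sq3 andbT; lra.
  by rewrite /excess -/(cost p) => /eqP h; rewrite -subr_le0 -h le_max lexx.
Qed.

End finite_transport_duality.

(** * A smooth 1-Lipschitz substitute for a finite minimum of distances *)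

Section softmin.
Context {R : realType} {n : nat} {I : finType}.
Variables (beta : R) (t : I -> 'rV[R]_n) (psi : I -> R).
Hypothesis beta0 : 0 < beta.

(** The parameter [beta] removes the singularity of the distance at its zero. *)
Definition sdist (x y : 'rV[R]_n) := Num.sqrt (dotp (x - y) (x - y) + beta ^+ 2).

(** Log-sum-exp approximation, at temperature [beta], of min_j (|x - t_j| - psi_j), the largest
    potential compatible with [psi]. *)
Definition softmin (x : 'rV[R]_n) :=
  - beta * ln (\sum_j expR ((psi j - sdist x (t j)) / beta)).

Lemma sdist_ge x y : enorm (x - y) <= sdist x y.
Proof. by rewrite ler_sqrt ?lerDl ?addr_ge0 ?dotpp_ge0 ?sqr_ge0. Qed.

Lemma sdistxx x : sdist x x = beta.
Proof. by rewrite /sdist subrr dotp0l add0r sqrtr_sqr gtr0_norm. Qed.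

Lemma smooth_sdist y : smooth_expr (sdist^~ y).
Proof.
have q0 (x : 'rV[R]_n) : 0 < dotp (x - y) (x - y) + beta ^+ 2.
  by rewrite ltr_wpDl ?dotpp_ge0// exprn_gt0.
(* The square root is expressed as exp(ln / 2); the shift by [beta ^+ 2] keeps the logarithm defined
   at [x = y]. *)
rewrite (_ : sdist^~ y =
    fun x => expR (2^-1 * ln (dotp (x - y) (x - y) + beta ^+ 2))).
  apply: smooth_exp; apply: smooth_scale; apply: smooth_ln => //.
  apply: smooth_add; last exact: smooth_cst.
  apply: (@smooth_comp _ _ _ (fun x => dotp x x) (fun x => x - y)).
    exact: smooth_dotpp.
  move=> i; under eq_fun do rewrite !mxE.
  by apply: smooth_add; [exact: smooth_coord|exact: smooth_cst].
apply/funext => x; rewrite /sdist -powR12_sqrt; last exact: ltW.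
by rewrite /powR gt_eqF.
Qed.

(** After squaring, the cross term is controlled by [sdist x' y >= enorm (x' - y)] together with the
    triangle inequality. *)
Lemma sdist_lip x x' y : sdist x y - sdist x' y <= enorm (x - x').
Proof.
have h : enorm (x - y) <= enorm (x' - y) + enorm (x - x').
  by rewrite [leRHS]addrC; exact: enorm_triangle.
have h1 := sdist_ge x' y.
rewrite lerBlDl {1}/sdist -enorm_sqr -[leRHS]ger0_norm; last first.
  by rewrite addr_ge0 ?enorm_ge0 ?sqrtr_ge0.
rewrite -sqrtr_sqr ler_sqrt ?sqr_ge0// [leRHS]sqrrD.
have -> : sdist x' y ^+ 2 = enorm (x' - y) ^+ 2 + beta ^+ 2.
  by rewrite sqr_sqrtr ?addr_ge0 ?dotpp_ge0 ?sqr_ge0// enorm_sqr.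
move: h h1 (enorm_ge0 (x - y)) (enorm_ge0 (x' - y)) (enorm_ge0 (x - x')).
move: (enorm (x - y)) (enorm (x' - y)) (enorm (x - x')) (sdist x' y).
move=> u v w z h h1 u0 v0 w0.
have : u * u <= (v + w) * (v + w) by exact: ler_pM.
have : v * w <= z * w by exact: ler_wpM2r.
lra.
Qed.

Variable i0 : I.

Let Z x := \sum_j expR ((psi j - sdist x (t j)) / beta).

Let Z_gt0 x : 0 < Z x.
Proof.
rewrite /Z (bigD1 i0)//= ltr_wpDr ?expR_gt0//.
by apply: sumr_ge0 => j _; exact: expR_ge0.
Qed.

Lemma smooth_softmin : smooth_expr softmin.
Proof.
apply: smooth_scale; apply: smooth_ln; first exact: Z_gt0.
apply: smooth_sum => j; apply: smooth_exp.
apply: smooth_mul; last exact: smooth_cst.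
by apply: smooth_sub; [exact: smooth_cst|exact: smooth_sdist].
Qed.

(** Replacing y by x multiplies each exponential, hence their sum, by at most exp(|x - y| /
    beta). *)
Let softmin_lip_half x y : softmin y - softmin x <= enorm (x - y).
Proof.
have : Z x <= expR (enorm (x - y) / beta) * Z y.
  rewrite /Z mulr_sumr; apply: ler_sum => j _.
  rewrite -expRD ler_expR -mulrDl ler_pM2r ?invr_gt0//.
  have := sdist_lip y x (t j); rewrite enormC; lra.
rewrite -ler_ln ?posrE ?mulr_gt0 ?expR_gt0 ?Z_gt0//.
rewrite lnM ?posrE ?expR_gt0 ?Z_gt0// expRK.
rewrite -(ler_pM2l beta0) mulrDr mulrC [beta * (_ / _)]mulrC divfK ?gt_eqF//.
rewrite /softmin -/(Z x) -/(Z y); lra.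
Qed.

Lemma softmin_lip : elipschitz 1 softmin.
Proof.
move=> x y; rewrite mul1r ler_norml; apply/andP; split.
  by have := softmin_lip_half x y; lra.
by rewrite enormC; have := softmin_lip_half y x; lra.
Qed.

(** Only the term [j = s] of the sum is kept; its smoothed distance is [beta] rather than 0. *)
Lemma softmin_le s : softmin (t s) <= beta - psi s.
Proof.
have : expR ((psi s - beta) / beta) <= Z (t s).
  rewrite /Z (bigD1 s)//= sdistxx lerDl.
  by apply: sumr_ge0 => j _; exact: expR_ge0.
rewrite -ler_ln ?posrE ?expR_gt0 ?Z_gt0// expRK ler_pdivrMr//.
rewrite /softmin -/(Z (t s)); lra.
Qed.

(** Each of the #|I| exponentials is at most exp(- c / beta), whence the entropic loss
    [beta * ln #|I|]. *)
Lemma softmin_ge c x : (forall j, c + psi j <= enorm (x - t j)) ->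
  c - beta * ln #|I|%:R <= softmin x.
Proof.
move=> H; have I0 : (0 < #|I|)%N by apply/card_gt0P; exists i0.
have : Z x <= #|I|%:R * expR (- c / beta).
  rewrite -sum1_card natr_sum mulr_suml; apply: ler_sum => j _.
  rewrite mul1r ler_expR ler_pM2r ?invr_gt0//.
  by have := H j; have := sdist_ge x (t j); lra.
rewrite -ler_ln ?posrE ?mulr_gt0 ?ltr0n ?expR_gt0 ?Z_gt0//.
rewrite lnM ?posrE ?expR_gt0 ?ltr0n// expRK -(ler_pM2l beta0) mulrDr.
rewrite [beta * (_ / _)]mulrC divfK ?gt_eqF//.
rewrite /softmin -/(Z x); lra.
Qed.

End softmin.

(** * Upper bounds on the Wasserstein distance *)

Section integration_tools.
Context d {T : measurableType d} {R : realType}.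
Variable mu : {measure set T -> \bar R}.
Implicit Types f g W : T -> R.

Lemma Rdominated_cvg (f_ : nat -> T -> R) f g :
  (forall m, measurable_fun setT (f_ m)) ->
  (forall x, f_ m x @[m --> \oo] --> f x) ->
  mu.-integrable setT (EFin \o g) ->
  (forall m x, `|f_ m x| <= g x) ->
  \int[mu]_x f_ m x @[m --> \oo] --> \int[mu]_x f x.
Proof.
move=> mf ff ig fg.
have ff' x : (f_ m x)%:E @[m --> \oo] --> (f x)%:E by apply/cvg_EFin; [exact: nearW|exact: ff].
have mf_ m : measurable_fun setT (fun x => (f_ m x)%:E) by exact/measurable_EFinP.
have mf' : measurable_fun setT (fun x => (f x)%:E).
  by apply: (@emeasurable_fun_cvg _ _ _ _ (fun m x => (f_ m x)%:E)).
have fg' : {ae mu, forall x m, setT x -> (`|(f_ m x)%:E| <= (EFin \o g) x)%E}.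
  by apply: aeW => x m _; rewrite /= lee_fin fg.
have [iF _ H] := @dominated_convergence _ _ _ mu setT measurableT
  (fun m x => (f_ m x)%:E) (fun x => (f x)%:E) (EFin \o g) mf_ mf'
  (aeW _ (fun x _ => ff' x)) ig fg'.
apply: fine_cvg; rewrite fineK; last exact: integrable_fin_num.
exact: H.
Qed.

Lemma integrable_dominated f g : measurable_fun setT f ->
  mu.-integrable setT (EFin \o g) -> (forall x, `|f x| <= g x) ->
  mu.-integrable setT (EFin \o f).
Proof.
move=> mf ig fg; apply: le_integrable ig => //; first exact/measurable_EFinP.
by move=> x _; rewrite /= lee_fin (le_trans (fg x))// ler_norm.
Qed.

Lemma integrableDr f g : mu.-integrable setT (EFin \o f) ->
  mu.-integrable setT (EFin \o g) -> mu.-integrable setT (EFin \o (fun x => f x + g x)).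
Proof.
move=> mf mg; rewrite (_ : _ \o _ = (EFin \o f) \+ (EFin \o g))%E; last exact/funext.
exact: integrableD.
Qed.

Lemma integrableZr c f : mu.-integrable setT (EFin \o f) ->
  mu.-integrable setT (EFin \o (fun x => c * f x)).
Proof.
move=> mf; rewrite (_ : _ \o _ = (fun x => c%:E * (EFin \o f) x)%E); last exact/funext.
exact: integrableZl.
Qed.

Lemma integrableBr f g : mu.-integrable setT (EFin \o f) ->
  mu.-integrable setT (EFin \o g) -> mu.-integrable setT (EFin \o (fun x => f x - g x)).
Proof.
move=> mf mg; rewrite (_ : _ \o _ = (EFin \o f) \- (EFin \o g))%E; last exact/funext.
exact: integrableB.
Qed.

Lemma integrable_sumr (I : Type) (r : seq I) (F : I -> T -> R) :
  (forall i, mu.-integrable setT (EFin \o F i)) ->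
  mu.-integrable setT (EFin \o (fun x => \sum_(i <- r) F i x)).
Proof.
move=> iF; elim: r => [|i r IH].
  under eq_fun do rewrite big_nil; exact: integrable0.
by under eq_fun do rewrite big_cons; exact: integrableDr.
Qed.

Lemma Rintegral_sum (I : Type) (r : seq I) (F : I -> T -> R) :
  (forall i, mu.-integrable setT (EFin \o F i)) ->
  \int[mu]_x (\sum_(i <- r) F i x) = \sum_(i <- r) \int[mu]_x F i x.
Proof.
move=> iF; elim: r => [|i r IH].
  by under eq_Rintegral do rewrite big_nil; rewrite Rintegral_cst// mul0r big_nil.
under eq_Rintegral do rewrite big_cons.
by rewrite RintegralD//; [rewrite IH big_cons|exact: integrable_sumr].
Qed.

(** Dominated convergence with bound [W]: each point eventually leaves the sets [E m]. *)
Lemma integral_tail_lt W (E : nat -> set T) (e : R) :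
  mu.-integrable setT (EFin \o W) -> (forall x, 0 <= W x) ->
  (forall m, measurable (E m)) -> (forall x, \forall m \near \oo, ~ E m x) ->
  0 < e -> \forall m \near \oo, \int[mu]_x (W x * \1_(E m) x) < e.
Proof.
move=> iW W0 mE Ex e0.
have mW : measurable_fun setT W by apply/measurable_EFinP; case/integrableP : iW.
have : \int[mu]_x (W x * \1_(E m) x) @[m --> \oo] --> \int[mu]_x (cst 0 x).
  apply: (@Rdominated_cvg _ _ W) => //.
  - by move=> m; apply: measurable_funM.
  - move=> x; apply: cvg_near_cst; have := Ex x; apply: filterS => m Emx.
    by rewrite indicE memNset// mulr0.
  - move=> m x; rewrite normrM (ger0_norm (W0 x)) indicE.
    by case: (_ \in _); rewrite ?normr1 ?normr0 ?mulr1 ?mulr0.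
rewrite Rintegral_cst// mul0r => /cvgr_lt; exact.
Qed.

End integration_tools.

Section finite_range.
Context d {T : measurableType d} {R : realType} {I : finType}.
Variables (P : probability T R) (J : T -> I).
Hypothesis mJ : forall s, measurable (J @^-1` [set s]).
Variable g : I -> R.

Let gJE x : g (J x) = \sum_s g s * \1_(J @^-1` [set s]) x.
Proof.
rewrite (bigD1 (J x))//= indicE mem_set// mulr1 big1 ?addr0// => s sJ.
by rewrite indicE memNset ?mulr0//= => Js; rewrite Js eqxx in sJ.
Qed.

Lemma measurable_finite_range : measurable_fun setT (fun x => g (J x)).
Proof.
under eq_fun do rewrite gJE; apply: measurable_sum => s.
by apply: measurable_funM => //; exact: measurable_indic.
Qed.

Lemma integrable_finite_range : P.-integrable setT (EFin \o (fun x => g (J x))).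
Proof.
apply: (@integrable_dominated _ _ _ _ _ (cst (\sum_s `|g s|))).
- exact: measurable_finite_range.
- exact: finite_measure_integrable_cst.
- move=> x; rewrite (bigD1 (J x))//= lerDl; exact: sumr_ge0.
Qed.

Lemma Rintegral_finite_range :
  \int[P]_x g (J x) = \sum_s g s * fine (P (J @^-1` [set s])).
Proof.
have iI s : P.-integrable setT (EFin \o \1_(J @^-1` [set s])).
  exact: integrable_indic.
under eq_Rintegral do rewrite gJE.
rewrite Rintegral_sum; last by move=> s; exact: integrableZr.
apply: eq_bigr => s _; rewrite RintegralZl//; congr (_ * _).
by rewrite /Rintegral integral_indic// setIT.
Qed.

End finite_range.

(** * Lifting a finite plan to a coupling of two measures *)

Section plan_coupling.
Context d {T : measurableType d} {R : realType}.
Variables (mu nu : probability T R) (N : nat) (J : T -> 'I_N).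
Hypothesis mJ : forall s : nat, measurable [set x | J x = s :> nat].
Variable p : nat -> nat -> R.

Let A s := [set x | J x = s :> nat].
Let a s := fine (mu (A s)).
Let b s := fine (nu (A s)).
Hypotheses (p0 : forall s t, 0 <= p s t)
  (pa : forall s : 'I_N, \sum_(t < N) p s t = a s)
  (pb : forall t : 'I_N, \sum_(s < N) p s t = b t).

Let w s t := p s t / (a s * b t).

Let w_ge0 s t : 0 <= w s t.
Proof. by rewrite divr_ge0// mulr_ge0// fine_ge0. Qed.

Let mA s t : measurable (A s `*` A t : set (T * T)).
Proof. by apply: measurableX; exact: mJ. Qed.

(** On each rectangle A_s x A_t this is the product measure rescaled to have mass [p s t]. If [a s]
    or [b t] vanishes, the weight is 0 by the convention on division, in agreement with [p s t = 0],
    which the marginal conditions force. Indices are natural numbers because [msum] ranges over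
    them. *)
Definition plan_measure : {measure set (T * T) -> \bar R} :=
  msum (fun s => msum (fun t =>
    mscale (NngNum (w_ge0 s t)) (mrestr (mu \x nu)%E (mA s t))) N) N.

Lemma plan_measureX (E F : set T) : measurable E -> measurable F ->
  plan_measure (E `*` F) = (\sum_(s < N) \sum_(t < N)
    w s t * (fine (mu (E `&` A s)) * fine (nu (F `&` A t))))%:E.
Proof.
move=> mE mF; transitivity (\sum_(s < N) \sum_(t < N) (w s t)%:E *
    (mu \x nu) ((E `*` F) `&` (A s `*` A t)))%E; first by [].
rewrite -sumEFin; apply: eq_bigr => s _.
rewrite -sumEFin; apply: eq_bigr => t _.
rewrite -setXI.
have mEs : measurable (E `&` A s) by apply: measurableI => //; exact: mJ.
have mFt : measurable (F `&` A t) by apply: measurableI => //; exact: mJ.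
rewrite product_measure1E// [RHS]EFinM (EFinM (fine _)).
by rewrite !fineK ?fin_num_measure.
Qed.

Let fineI (m : probability T R) E : measurable E ->
  \sum_(s < N) fine (m (E `&` A s)) = fine (m E).
Proof.
move=> mE.
have mEA (s : 'I_N) : measurable (E `&` A s) by apply: measurableI => //; exact: mJ.
have EE : E = \big[setU/set0]_(s < N) (E `&` A s).
  rewrite -bigcup_seq/=; apply/seteqP; split=> [x Ex|x [s _ []//]].
  by exists (J x) => //=; rewrite mem_index_enum.
rewrite [in RHS]EE measure_bigsetU_ord//.
  by rewrite -EFin_sum_fine// => s _; exact: fin_num_measure.
apply/trivIsetP => s t _ _ st; apply/seteqP; split => // x [[_ Jxs] [_ Jxt]].
by move/negP: st; apply; apply/eqP/val_inj; rewrite /= -Jxs -Jxt.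
Qed.

Let a_eq0 s E : measurable E -> a s = 0 -> fine (mu (E `&` A s)) = 0.
Proof.
move=> mE as0; apply/eqP; rewrite eq_le fine_ge0// andbT -as0.
have mEA : measurable (E `&` A s) by apply: measurableI => //; exact: mJ.
apply: fine_le; [exact: fin_num_measure|exact: fin_num_measure (mJ s)|].
by apply: le_measure; rewrite ?inE//; exact: mJ.
Qed.

Let b_eq0 s E : measurable E -> b s = 0 -> fine (nu (E `&` A s)) = 0.
Proof.
move=> mE as0; apply/eqP; rewrite eq_le fine_ge0// andbT -as0.
have mEA : measurable (E `&` A s) by apply: measurableI => //; exact: mJ.
apply: fine_le; [exact: fin_num_measure|exact: fin_num_measure (mJ s)|].
by apply: le_measure; rewrite ?inE//; exact: mJ.
Qed.

Lemma plan_measure_fst E : measurable E -> plan_measure (E `*` setT) = mu E.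
Proof.
move=> mE; rewrite plan_measureX// -[RHS]fineK ?fin_num_measure// -fineI//.
congr EFin; apply: eq_bigr => s _.
have [as0|as0] := eqVneq (a s) 0.
  by rewrite a_eq0// big1// => t _; rewrite mul0r mulr0.
transitivity (\sum_(t < N) p s t / a s * fine (mu (E `&` A s))); last first.
  by rewrite -!mulr_suml pa divff// mul1r.
apply: eq_bigr => t _; rewrite setTI -/(b t) /w.
have [bt0|bt0] := eqVneq (b t) 0.
  have -> : p s t = 0.
    have := pb t; rewrite bt0 => /psumr_eq0P; exact.
  by rewrite !mul0r.
by field; rewrite as0 bt0.
Qed.

Lemma plan_measure_snd E : measurable E -> plan_measure (setT `*` E) = nu E.
Proof.
move=> mE; rewrite plan_measureX// -[RHS]fineK ?fin_num_measure// -fineI//.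
congr EFin; rewrite exchange_big/=; apply: eq_bigr => t _.
have [bt0|bt0] := eqVneq (b t) 0.
  by rewrite b_eq0// big1// => s _; rewrite !mulr0.
transitivity (\sum_(s < N) p s t / b t * fine (nu (E `&` A t))); last first.
  by rewrite -!mulr_suml pb divff// mul1r.
apply: eq_bigr => s _; rewrite setTI -/(a s) /w.
have [as0|as0] := eqVneq (a s) 0.
  have -> : p s t = 0.
    have := pa s; rewrite as0 => /psumr_eq0P; exact.
  by rewrite !mul0r.
by field; rewrite as0 bt0.
Qed.

Lemma plan_measure_cell (s t : 'I_N) : plan_measure (A s `*` A t) = (p s t)%:E.
Proof.
have AI (s' s'' : 'I_N) : A s' `&` A s'' = if s' == s'' then A s' else set0.
  case: eqVneq => [->|s's]; first by rewrite setIid.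
  apply/seteqP; split=> // x [Jx1 Jx2].
  by move/negP: s's; apply; apply/eqP/val_inj; rewrite /= -Jx1 -Jx2.
rewrite plan_measureX; [|exact: mJ..]; congr EFin.
rewrite (bigD1 s)//= [X in _ + X]big1 => [|s' s's]; last first.
  by rewrite big1// => t' _; rewrite AI eq_sym (negbTE s's) measure0 mul0r mulr0.
rewrite addr0 (bigD1 t)//= big1 => [|t' t't]; last first.
  by rewrite [in nu _]AI eq_sym (negbTE t't) measure0 !mulr0.
rewrite addr0 !setIid -/(a s) -/(b t) /w.
have [as0|as0] := eqVneq (a s) 0.
  have -> : p s t = 0.
    have := pa s; rewrite as0 => /psumr_eq0P; exact.
  by rewrite !mul0r.
have [bt0|bt0] := eqVneq (b t) 0.
  have -> : p s t = 0.
    have := pb t; rewrite bt0 => /psumr_eq0P; exact.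
  by rewrite !mul0r.
by rewrite divfK// mulf_neq0.
Qed.

Let plan_measure_setT : plan_measure setT = 1%E.
Proof. by rewrite -setXTT plan_measure_fst// probability_setT. Qed.

Let plan_isProbability :=
  Measure_isProbability.Build _ _ R plan_measure plan_measure_setT.

Definition plan_probability : probability (T * T)%type R :=
  HB.pack (Measure.sort plan_measure) plan_isProbability.

End plan_coupling.

Section kantorovich.
Context {R : realType} {n : nat}.
Implicit Types mu nu : probability 'rV[R]_n R.

Lemma measurable_enorm : measurable_fun setT (@enorm R n).
Proof. by apply: continuous_measurable_rV; exact: continuous_enorm. Qed.

Lemma measurable_enormB d (T : measurableType d) (f g : T -> 'rV[R]_n) :
  measurable_fun setT f -> measurable_fun setT g ->
  measurable_fun setT (fun x => enorm (f x - g x)).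
Proof.
move=> mf mg; apply: (measurableT_comp measurable_enorm).
apply: measurable_fun_rVP => i; under eq_fun do rewrite !mxE.
apply: measurable_funB.
  by apply: (measurableT_comp (measurable_coord i)).
by apply: (measurableT_comp (measurable_coord i)).
Qed.

Section cells.
Variables (N : nat) (J : 'rV[R]_n -> 'I_N) (r : 'I_N -> 'rV[R]_n).
Hypothesis mJ : forall s : nat, measurable [set x | J x = s :> nat].

Lemma measurable_cell s : measurable (J @^-1` [set s]).
Proof.
rewrite (_ : _ @^-1` _ = [set x | J x = s :> nat]); first exact: mJ.
by apply/seteqP; split=> x /=; [move=> ->|move/val_inj].
Qed.

Lemma measurable_cell_dist : measurable_fun setT (fun x : 'rV[R]_n => enorm (x - r (J x))).
Proof.
apply: measurable_enormB; first exact: measurable_id.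
apply: measurable_fun_rVP => i.
exact: (measurable_finite_range measurable_cell (fun s => r s ord0 i)).
Qed.

Lemma integrable_cell_dist mu : mu.-integrable setT (EFin \o @enorm R n) ->
  mu.-integrable setT (EFin \o (fun x : 'rV[R]_n => enorm (x - r (J x)))).
Proof.
move=> imu.
apply: (@integrable_dominated _ _ _ _ _ (fun x => enorm x + enorm (r (J x)))).
- exact: measurable_cell_dist.
- apply: integrableDr => //.
  exact: (integrable_finite_range mu measurable_cell (fun s => enorm (r s))).
- move=> x; rewrite ger0_norm ?enorm_ge0//.
  by apply: le_trans (enormD _ _) _; rewrite enormN.
Qed.

(** Triangle inequality along z.1, r (J z.1), r (J z.2), z.2. The outer terms see only the marginals
    of the coupling, the middle one only the masses of the rectangles. *)
Lemma wasserstein1_plan mu nu (p : nat -> nat -> R) :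
  mu.-integrable setT (EFin \o @enorm R n) ->
  nu.-integrable setT (EFin \o @enorm R n) ->
  (forall s t, 0 <= p s t) ->
  (forall s : 'I_N, \sum_(t < N) p s t = fine (mu [set x | J x = s :> nat])) ->
  (forall t : 'I_N, \sum_(s < N) p s t = fine (nu [set x | J x = t :> nat])) ->
  (wasserstein1 mu nu <= (\int[mu]_x enorm (x - r (J x)) +
     (\sum_(s < N) \sum_(t < N) p s t * enorm (r s - r t)) +
     \int[nu]_x enorm (x - r (J x)))%:E)%E.
Proof.
move=> imu inu p0 pa pb.
pose P := plan_probability mJ p0 pa pb.
apply: (@le_trans _ _ (\int[P]_z (enorm (z.1 - z.2))%:E)%E).
  apply: ereal_inf_lbound; exists P => //; split => E mE.
    exact: plan_measure_fst.
  exact: plan_measure_snd.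
pose JJ (z : 'rV[R]_n * 'rV[R]_n) := (J z.1, J z.2).
have mJJ st : measurable (JJ @^-1` [set st]).
  rewrite (_ : _ @^-1` _ = (J @^-1` [set st.1]) `*` (J @^-1` [set st.2])).
    by apply: measurableX; exact: measurable_cell.
  case: st => s t; apply/seteqP; split=> z /=; first by move=> -[<- <-].
  by move=> [zs zt]; rewrite /JJ zs zt.
pose f1 (x : 'rV[R]_n) := enorm (x - r (J x)).
pose g (st : 'I_N * 'I_N) := enorm (r st.1 - r st.2).
have mf1 : measurable_fun setT f1 by exact: measurable_cell_dist.
have f10 x : 0 <= f1 x by exact: enorm_ge0.
apply: (@le_trans _ _ (\int[P]_z ((f1 z.1)%:E + (g (JJ z))%:E + (f1 z.2)%:E))%E).
  apply: ge0_le_integral => //=.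
  - by move=> z _; rewrite lee_fin enorm_ge0.
  - by apply/measurable_EFinP; exact: measurable_enormB.
  - apply: emeasurable_funD; first apply: emeasurable_funD.
    + by apply/measurable_EFinP; exact: (measurableT_comp mf1).
    + by apply/measurable_EFinP; exact: (measurable_finite_range mJJ g).
    + by apply/measurable_EFinP; exact: (measurableT_comp mf1).
  - move=> z _; rewrite -!EFinD lee_fin /f1 /g /=.
    apply: le_trans (enorm_triangle _ (r (J z.2)) _) _.
    rewrite [enorm (z.2 - _)]enormC lerD2r; exact: enorm_triangle.
have P1 : (\int[P]_z (f1 z.1)%:E = \int[mu]_x (f1 x)%:E)%E.
  transitivity (\int[pushforward P (@fst 'rV[R]_n 'rV[R]_n)]_x (f1 x)%:E)%E.
    rewrite ge0_integral_pushforward//; first exact/measurable_EFinP.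
    by move=> x _; rewrite lee_fin.
  apply: eq_measure_integral => E mE _; apply: etrans (plan_measure_fst mJ p0 pa pb mE).
  rewrite -[LHS]/(plan_measure mu nu mJ p0 (@fst 'rV[R]_n 'rV[R]_n @^-1` E)).
  by congr (plan_measure _ _ _ _ _); apply/seteqP; split=> z //= -[].
have P2 : (\int[P]_z (f1 z.2)%:E = \int[nu]_x (f1 x)%:E)%E.
  transitivity (\int[pushforward P (@snd 'rV[R]_n 'rV[R]_n)]_x (f1 x)%:E)%E.
    rewrite ge0_integral_pushforward//; first exact/measurable_EFinP.
    by move=> x _; rewrite lee_fin.
  apply: eq_measure_integral => E mE _; apply: etrans (plan_measure_snd mJ p0 pa pb mE).
  rewrite -[LHS]/(plan_measure mu nu mJ p0 (@snd 'rV[R]_n 'rV[R]_n @^-1` E)).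
  by congr (plan_measure _ _ _ _ _); apply/seteqP; split=> z //= -[].
have P3 : (\int[P]_z (g (JJ z))%:E =
    (\sum_(s < N) \sum_(t < N) p s t * enorm (r s - r t))%:E)%E.
  rewrite -[LHS]fineK; last first.
    exact: integrable_fin_num (integrable_finite_range P mJJ g).
  congr EFin; rewrite [LHS](Rintegral_finite_range P mJJ g) pair_bigA/=.
  apply: eq_bigr => -[s t] _ /=; rewrite mulrC /g/=; congr (_ * _).
  rewrite -[RHS]/(fine (p s t)%:E) -(plan_measure_cell mJ p0 pa pb).
  rewrite -[LHS]/(fine (plan_measure mu nu mJ p0 (JJ @^-1` [set (s, t)]))).
  congr (fine (plan_measure _ _ _ _ _)); apply/seteqP; split=> z /=.
    by move=> -[-> ->].
  by move=> [/val_inj zs /val_inj zt]; rewrite /JJ zs zt.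
rewrite ge0_integralD//=; last 4 first.
- by move=> z _; rewrite adde_ge0// lee_fin enorm_ge0.
- apply: emeasurable_funD.
  + by apply/measurable_EFinP; exact: (measurableT_comp mf1).
  + by apply/measurable_EFinP; exact: (measurable_finite_range mJJ g).
- by move=> z _; rewrite lee_fin enorm_ge0.
- by apply/measurable_EFinP; exact: (measurableT_comp mf1).
rewrite ge0_integralD//=; last 4 first.
- by move=> z _; rewrite lee_fin enorm_ge0.
- by apply/measurable_EFinP; exact: (measurableT_comp mf1).
- by move=> z _; rewrite lee_fin enorm_ge0.
- by apply/measurable_EFinP; exact: (measurable_finite_range mJJ g).
rewrite P1 P2 P3 2!EFinD /Rintegral !fineK//.
  exact: integrable_fin_num (integrable_cell_dist inu).
exact: integrable_fin_num (integrable_cell_dist imu).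
Qed.

End cells.

End kantorovich.

Section kantorovich_duality.
Context {R : realType} {n : nat}.
Implicit Types mu nu : probability 'rV[R]_n R.

(** A grid of small cubes, enumerated by [pickle]: those with code below some m are cells, and all
    others merge into one cell represented by 0, where the error is a tail of the first moment. A
    single partition serves both measures, since the finite plan lives on common cells. *)
Lemma discretize mu nu (e : R) : 0 < e ->
  mu.-integrable setT (EFin \o @enorm R n) ->
  nu.-integrable setT (EFin \o @enorm R n) ->
  exists (N : nat) (J : 'rV[R]_n -> 'I_N) (r : 'I_N -> 'rV[R]_n),
    [/\ forall s : nat, measurable [set x | J x = s :> nat],
        \int[mu]_x enorm (x - r (J x)) <= e &
        \int[nu]_x enorm (x - r (J x)) <= e].
Proof.
move=> e0 imu inu.
(* Inside a cube the error is at most n * eta <= e / 2; [n.+1] keeps the denominator positive when n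
   = 0. *)
pose eta := e / (2 * n.+1%:R).
have eta0 : 0 < eta by rewrite divr_gt0// mulr_gt0.
pose c (x : 'rV[R]_n) : 'rV[int]_n := \row_i Num.floor (x ord0 i / eta).
pose code x : nat := pickle (c x).
have mcode j : measurable [set x | code x = j].
  have [[al <-]|H] := pselect (exists al : 'rV[int]_n, pickle al = j); last first.
    rewrite (_ : [set x | _] = set0)//; apply/seteqP; split=> // x /= xj.
    by apply: H; exists (c x).
  have -> : [set x | code x = pickle al] = \bigcap_(i in [set: 'I_n])
      ((fun x : 'rV[R]_n => x ord0 i) @^-1`
        `[eta * (al ord0 i)%:~R, eta * (al ord0 i + 1)%:~R[%classic).
    apply/seteqP; split=> [x /(pcan_inj pickleK) /rowP cx i _|x H].
      have := cx i; rewrite mxE => /eqP; rewrite floor_eq => /andP[h1 h2].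
      rewrite /= in_itv/=; apply/andP; split.
        by rewrite mulrC -ler_pdivlMr.
      by rewrite mulrC -ltr_pdivrMr.
    rewrite /= /code; congr pickle; apply/rowP => i; rewrite mxE.
    apply/eqP; rewrite floor_eq; have := H i I.
    rewrite /= in_itv/= => /andP[h1 h2].
    by rewrite ler_pdivlMr// mulrC h1/= ltr_pdivrMr// mulrC.
  apply: fin_bigcap_measurable; first exact: finite_finset.
  move=> i _; rewrite -[X in measurable X]setTI; apply: measurable_coord => //.
pose E m := [set x | (m <= code x)%N].
have mE m : measurable (E m).
  rewrite (_ : E m = ~` \bigcup_(j < m) [set x | code x = j]).
    by apply: measurableC; apply: bigcup_measurable => j _; exact: mcode.
  apply/seteqP; split=> [x /= mx [j /= jm xj]|x /= H].
    by move: mx; rewrite /E/= xj leqNgt jm.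
  by rewrite /E/= leqNgt; apply/negP => xm; apply: H; exists (code x).
have Ex x : \forall m \near \oo, ~ E m x.
  exists (code x).+1 => // m /= xm; rewrite /E/=.
  by apply/negP; rewrite -ltnNge.
have e2 : 0 < e / 2 by rewrite divr_gt0.
have [m [mu_m nu_m]] : exists m, \int[mu]_x (enorm x * \1_(E m) x) < e / 2 /\
    \int[nu]_x (enorm x * \1_(E m) x) < e / 2.
  have [m1 _ H1] := integral_tail_lt imu enorm_ge0 mE Ex e2.
  have [m2 _ H2] := integral_tail_lt inu enorm_ge0 mE Ex e2.
  by exists (maxn m1 m2); split; [apply: H1|apply: H2] => /=;
    rewrite ?leq_maxl ?leq_maxr.
(* The last cell m collects every code that is at least m. *)
pose J x : 'I_m.+1 := inord (minn (code x) m).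
have JE x : J x = minn (code x) m :> nat by rewrite inordK// ltnS geq_minr.
pose dec (s : nat) : 'rV[R]_n :=
  if @unpickle 'rV[int]_n s is Some al then \row_i (eta * (al ord0 i)%:~R) else 0.
pose r (s : 'I_m.+1) : 'rV[R]_n := if (s < m)%N then dec s else 0.
have mJ s : measurable [set x | J x = s :> nat].
  have [sm|ms|->] := ltngtP s m.
  - rewrite (_ : [set x | _] = [set x | code x = s])//.
    by apply/seteqP; split=> x /=; rewrite JE; lia.
  - rewrite (_ : [set x | _] = set0)//.
    by apply/seteqP; split=> // x /=; rewrite JE; lia.
  - rewrite (_ : [set x | _] = E m)//.
    by apply/seteqP; split=> x; rewrite /E /= JE; lia.
have bound x : enorm (x - r (J x)) <= n%:R * eta + enorm x * \1_(E m) x.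
  rewrite /r JE indicE; have [xm|mx] := ltnP (code x) m.
    rewrite xm memNset ?mulr0 ?addr0; last first.
      by rewrite /E/=; lia.
    apply: le_trans (enorm_le_sum_coord _) _.
    rewrite mulr_natl -[X in _ *+ X]card_ord -sumr_const; apply: ler_sum => i _.
    rewrite !mxE /dec /code pickleK !mxE.
    have /andP[h1 h2] := floor_itv (x ord0 i / eta).
    move: h1 h2; rewrite ler_pdivlMr// ltr_pdivrMr// intrD mulrDl mul1r mulrC.
    by move=> h1 h2; rewrite ger0_norm; lra.
  rewrite ltnn subr0 mem_set// mulr1 lerDr.
  by rewrite mulr_ge0// ltW.
have concl (P : probability 'rV[R]_n R) : P.-integrable setT (EFin \o @enorm R n) ->
    \int[P]_x (enorm x * \1_(E m) x) < e / 2 ->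
    \int[P]_x enorm (x - r (J x)) <= e.
  move=> iP Pm.
  have iPE : P.-integrable setT (EFin \o (fun x => enorm x * \1_(E m) x)).
    apply: (integrable_dominated _ iP).
      by apply: measurable_funM => //; exact: measurable_enorm.
    move=> x; rewrite ger0_norm ?mulr_ge0 ?enorm_ge0//.
    by rewrite indicE ler_piMr ?enorm_ge0//; case: (_ \in _).
  have ic : P.-integrable setT (EFin \o cst (n%:R * eta)).
    exact: finite_measure_integrable_cst.
  apply: (@le_trans _ _ (\int[P]_x (n%:R * eta + enorm x * \1_(E m) x))).
    apply: le_Rintegral => //; first exact: integrable_cell_dist.
    exact: integrableDr.
  rewrite RintegralD//. 
  rewrite (@Rintegral_cst _ _ _ P) //= (@probability_setT _ _ _ P) mulr1.
  have : n%:R * eta <= e / 2.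
    rewrite /eta mulrA ler_pdivrMr ?mulr_gt0// mulrA divfK ?pnatr_eq0//.
    by rewrite mulrC ler_pM2l// ler_nat.
  by move: Pm; lra.
exists m.+1, J, r; split=> //; exact: concl.
Qed.

Lemma wasserstein1_le_dual mu nu (K : R) :
  mu.-integrable setT (EFin \o @enorm R n) ->
  nu.-integrable setT (EFin \o @enorm R n) ->
  (forall h : 'rV[R]_n -> R, smooth_expr h -> elipschitz 1 h ->
    \int[mu]_x h x - \int[nu]_x h x <= K) ->
  (wasserstein1 mu nu <= K%:E)%E.
Proof.
move=> imu inu HK; apply/lee_addgt0Pr => e e0; rewrite -EFinD.
(* Five losses of size q: two discretisation errors in the coupling, two more for evaluating [h] at
   representatives, and one for the soft minimum. *)
pose q : R := e / 5.
have q0 : 0 < q by rewrite divr_gt0.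
have [N [J [r [mJ rmu rnu]]]] := discretize q0 imu inu.
pose i0 := J 0.
pose a (s : 'I_N) := fine (mu [set x | J x = s :> nat]).
pose b (s : 'I_N) := fine (nu [set x | J x = s :> nat]).
have mcell := measurable_cell mJ.
have cellE s : J @^-1` [set s] = [set x | J x = s :> nat].
  by apply/seteqP; split=> x /=; [move=> ->|move/val_inj].
have sumE (P : probability 'rV[R]_n R) (g : 'I_N -> R) :
    \sum_(s < N) fine (P [set x | J x = s :> nat]) * g s = \int[P]_x g (J x).
  rewrite (Rintegral_finite_range P mcell); apply: eq_bigr => s _.
  by rewrite mulrC cellE.
have sum1 (P : probability 'rV[R]_n R) :
    \sum_(s < N) fine (P [set x | J x = s :> nat]) = 1.
  under eq_bigr do rewrite -[fine _]mulr1.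
  by rewrite (sumE _ (fun=> 1)) (@Rintegral_cst _ _ _ P)//= (@probability_setT _ _ _ P) mulr1.
pose d s t := enorm (r s - r t).
have lip_int (P : probability 'rV[R]_n R) (h : 'rV[R]_n -> R) :
    P.-integrable setT (EFin \o @enorm R n) ->
    smooth_expr h -> elipschitz 1 h -> \int[P]_x enorm (x - r (J x)) <= q ->
    `|\int[P]_x h (r (J x)) - \int[P]_x h x| <= q.
  move=> iP sh lh Pq.
  have ih : P.-integrable setT (EFin \o h).
    apply: (@integrable_dominated _ _ _ _ _ (fun x => `|h 0| + enorm x)).
    - exact: smooth_expr_measurable.
    - by apply: integrableDr => //; exact: finite_measure_integrable_cst.
    - move=> x; rewrite -[h x](subrK (h 0)) addrC (le_trans (ler_normD _ _))//.
      by rewrite lerD2l (le_trans (lh _ _))// subr0 mul1r.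
  have irh := integrable_finite_range P mcell (fun s => h (r s)).
  rewrite -RintegralB//; apply: le_trans Pq.
  apply: le_trans (le_normr_Rintegral _ _) _ => //; first exact: integrableBr.
  apply: le_Rintegral => //.
  - by apply: integrable_norm => //; exact: integrableBr.
  - exact: integrable_cell_dist.
  - by move=> x _; rewrite (le_trans (lh _ _))// mul1r enormC.
have [p' [p0 pa pb pK]] : exists p' : 'I_N -> 'I_N -> R,
    [/\ forall s t, 0 <= p' s t, forall s, \sum_t p' s t = a s,
      forall t, \sum_s p' s t = b t & \sum_s \sum_t p' s t * d s t <= K + 3 * q].
  apply: finite_coupling.
  - by move=> s; exact: fine_ge0.
  - by move=> s; exact: fine_ge0.
  - exact: sum1.
  - exact: sum1.
  - by move=> s t; exact: enorm_ge0.
  move=> phi psi phipsi.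
  have L0 : 0 <= ln #|'I_N|%:R :> R.
    rewrite ln_ge0// ler1n card_ord; exact: leq_ltn_trans (leq0n _) (ltn_ord i0).
  (* Chosen so that beta + beta ln N = q, the combined loss of [softmin_le] and [softmin_ge]. *)
  pose beta := q / (1 + ln #|'I_N|%:R).
  have beta0 : 0 < beta by rewrite divr_gt0// ltr_wpDr.
  pose h := softmin beta r psi.
  have sh : smooth_expr h by exact: smooth_softmin.
  have lh : elipschitz 1 h by exact: softmin_lip.
  have := HK h sh lh.
  have := lip_int mu h imu sh lh rmu; have := lip_int nu h inu sh lh rnu.
  rewrite -(sumE mu (fun s => h (r s))) -(sumE nu (fun s => h (r s))).
  have h1 : \sum_s a s * phi s <=
      \sum_s a s * h (r s) + beta * ln #|'I_N|%:R.
    rewrite (_ : beta * _ = \sum_s a s * (beta * ln #|'I_N|%:R)); last first.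
      by rewrite -mulr_suml [\sum_s a s](sum1 mu) mul1r.
    rewrite -big_split/=.
    apply: ler_sum => s _; rewrite -mulrDr ler_wpM2l ?fine_ge0//.
    rewrite -lerBlDr.
    by apply: (@softmin_ge _ _ _ beta r psi beta0 i0) => j; exact: phipsi.
  have h2 : \sum_s b s * psi s <= beta - \sum_s b s * h (r s).
    rewrite [X in _ <= X - _](_ : _ = \sum_s b s * beta); last first.
      by rewrite -mulr_suml [\sum_s b s](sum1 nu) mul1r.
    rewrite -sumrB/=.
    apply: ler_sum => s _; rewrite -mulrBr ler_wpM2l ?fine_ge0//.
    by rewrite lerBrDr addrC -lerBrDr; exact: softmin_le.
  have h3 : beta + beta * ln #|'I_N|%:R = q.
    by rewrite -[X in X + _]mulr1 -mulrDr divfK// gt_eqF// ltr_wpDr.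
  rewrite !ler_norml -/(a _) -/(b _) => /andP[k1 k2] /andP[k3 k4].
  by move: h1 h2 h3 k1 k2 k3 k4; rewrite /a /b; lra.
pose o (s : nat) : 'I_N := odflt i0 (insub s).
have oE (s : 'I_N) : o s = s by rewrite /o valK.
apply: le_trans (wasserstein1_plan r mJ imu inu (p := fun s t => p' (o s) (o t)) _ _ _) _.
- by move=> s t; exact: p0.
- by move=> s; rewrite -[RHS]pa oE; apply: eq_bigr => t _; rewrite oE.
- by move=> t; rewrite -[RHS]pb oE; apply: eq_bigr => s _; rewrite oE.
rewrite lee_fin (_ : \sum_(s < N) \sum_(t < N) _ =
  \sum_s \sum_t p' s t * d s t); last first.
  by apply: eq_bigr => s _; apply: eq_bigr => t _; rewrite !oE.
by move: rmu rnu pK; rewrite /q; lra.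
Qed.

End kantorovich_duality.

(** * Gaussian integration by parts *)

Section standard_normal.
Context {R : realType}.
Local Notation leb := (@lebesgue_measure R).
Local Notation gamma := (@normal_prob R 0 1).
Local Notation dens := (@normal_pdf R 0 1).
Implicit Types w f : R -> R.

(** The Radon-Nikodym derivative and [dens] have the same integral over every measurable set, hence
    coincide almost everywhere. *)
Lemma ge0_integral_normal_prob (f : measurableTypeR R -> \bar R) :
  measurable_fun setT f -> (forall x, 0 <= f x)%E ->
  (\int[gamma]_x f x = \int[leb]_x (f x * (dens x)%:E))%E.
Proof.
move=> mf f0.
have dom := @normal_prob_dominates R 0 1.
have mdens : measurable_fun setT (fun x => (dens x)%:E).
  by apply/measurable_EFinP; exact: measurable_normal_pdf.
rewrite -(Radon_Nikodym_SigmaFinite.change_of_variables dom)//.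
have iF := Radon_Nikodym_SigmaFinite.f_integrable dom.
apply: ae_eq_integral => //.
- by apply: emeasurable_funM => //; exact: measurable_int iF.
- exact: emeasurable_funM.
apply: ae_eqe_mul2l; apply: integral_ae_eq => // E _ mE.
by rewrite -Radon_Nikodym_SigmaFinite.f_integral.
Qed.

Lemma integrable_normal_prob f : measurable_fun setT f ->
  leb.-integrable setT (EFin \o (fun x => f x * dens x)) ->
  gamma.-integrable setT (EFin \o f).
Proof.
move=> mf /integrableP[_ fi]; apply/integrableP; split.
  exact/measurable_EFinP.
rewrite ge0_integral_normal_prob//=; last first.
  by apply/measurable_EFinP; exact: measurableT_comp.
apply: le_lt_trans fi; rewrite le_eqVlt; apply/orP; left; apply/eqP.
by apply: eq_integral => x _; rewrite /= -EFinM normrM (ger0_norm (normal_pdf_ge0 _ _ _)).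
Qed.

Lemma Rintegral_normal_prob f : measurable_fun setT f ->
  \int[gamma]_x f x = \int[leb]_x (f x * dens x).
Proof.
move=> mf; congr fine; rewrite integralE [RHS]integralE.
have mf' : measurable_fun setT (fun x => (f x)%:E) by exact/measurable_EFinP.
congr (_ - _)%E; rewrite ge0_integral_normal_prob//.
- apply: eq_integral => x _; rewrite !funeposE -!EFin_max -EFinM; congr EFin.
  by rewrite maxr_pMl ?normal_pdf_ge0// mul0r.
- exact: measurable_funepos.
- apply: eq_integral => x _; rewrite !funenegE -!EFinN -!EFin_max -EFinM; congr EFin.
  by rewrite maxr_pMl ?normal_pdf_ge0// mul0r mulNr.
- exact: measurable_funeneg.
Qed.

Lemma normal_pdf01 (x : R) : dens x = normal_peak 1 * expR (- (x ^+ 2) / 2).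
Proof. by rewrite normal_pdfE ?oner_neq0// /normal_fun subr0 expr1n. Qed.

Lemma is_derive_normal_pdf (x : R) : is_derive x 1 dens (- x * dens x).
Proof.
rewrite (_ : dens = (fun y => normal_peak 1 * expR (- (y ^+ 2) / 2))); last first.
  by apply/funext => y; exact: normal_pdf01.
have dq : is_derive x 1 (fun y : R => - (y ^+ 2) / 2) (- x).
  have H := is_deriveZ (- 2^-1 : R)
    (is_deriveM (is_derive_id x (1 : R)) (is_derive_id x (1 : R))).
  rewrite (_ : (fun y : R => - (y ^+ 2) / 2) = - 2^-1 \*: (id * id : R -> R)).
    apply: is_derive_eq H _; rewrite /GRing.scale/= mulr1.
    by field.
  by apply/funext => y; rewrite -[RHS]/(- 2^-1 * (y * y)); field.
have de : is_derive x 1 (expR \o (fun y : R => - (y ^+ 2) / 2))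
    (expR (- (x ^+ 2) / 2) * - x).
  exact: is_derive1_comp.
have H := is_deriveZ (normal_peak 1) de.
by apply: is_derive_eq H _; rewrite /GRing.scale/=; ring.
Qed.

(** From exp u >= 1 + u. Quadratic decay is enough to kill boundary terms in which the other factor
    grows linearly. *)
Lemma normal_pdf_tail m : dens m.+1%:R <= 2 * normal_peak 1 / m.+1%:R ^+ 2.
Proof.
rewrite normal_pdf01 mulNr expRN (mulrC 2) -[leRHS]mulrA ler_wpM2l ?normal_peak_ge0//.
have q0 : 0 < m.+1%:R ^+ 2 / 2 :> R by rewrite divr_gt0// exprn_gt0.
rewrite -[leRHS]invrK lef_pV2 ?posrE ?expR_gt0 ?invr_gt0 ?divr_gt0 ?exprn_gt0//.
by rewrite invfM invrK mulrC; apply: le_trans (expR_ge1Dx _); rewrite lerDr.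
Qed.

Lemma normal_pdfN (x : R) : dens (- x) = dens x.
Proof. by rewrite !normal_pdf01 sqrrN. Qed.

End standard_normal.

Section normal_integration_by_parts.
Context {R : realType}.
Local Notation leb := (@lebesgue_measure R).
Local Notation gamma := (@normal_prob R 0 1).
Local Notation dens := (@normal_pdf R 0 1).
Implicit Types w f : R -> R.

Let D m : set (measurableTypeR R) := `[(- m.+1%:R : R), m.+1%:R]%classic.

Let mD m : measurable (D m).
Proof. exact: measurable_itv. Qed.

Let near_D (x : R) : \forall m \near \oo, D m x.
Proof.
exists (Num.truncn `|x|) => // m /= xm; rewrite /D/= in_itv/= -ler_norml.
by rewrite ltW// (lt_le_trans (truncnS_gt _))// ler_nat.
Qed.

Let Rintegral_exhaust f : leb.-integrable setT (EFin \o f) ->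
  \int[leb]_(x in D m) f x @[m --> \oo] --> \int[leb]_x f x.
Proof.
move=> fi; under eq_fun do rewrite Rintegral_mkcond.
have mf : measurable_fun setT f by apply/measurable_EFinP; case/integrableP : fi.
apply: (@Rdominated_cvg _ _ _ leb (fun m => f \_ (D m)) f (fun x => `|f x|)).
- by move=> m; apply/(measurable_restrictT f (mD m)); exact: measurable_funTS.
- move=> x; apply: cvg_near_cst; have := near_D x; apply: filterS => m Dx.
  by rewrite patchE mem_set.
- exact: integrable_norm.
- by move=> m x; rewrite patchE; case: ifP => // _; rewrite normr0.
Qed.

Let continuous_dens : continuous dens.
Proof. by apply: continuous_normal_pdf; rewrite oner_neq0. Qed.

Let is_derive_continuous w w' : (forall x : R, is_derive x 1 w (w' x)) -> continuous w.
Proof.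
by move=> dw x; apply/differentiable_continuous/derivable1_diffP; case: (dw x).
Qed.

Let continuousMR f g : continuous f -> continuous g ->
  continuous (fun x => f x * g x : R).
Proof. by move=> cf cg x; apply: (@cvgM _ _ (nbhs x)); [exact: cf|exact: cg]. Qed.

Let LR w w' a b : (forall x : R, is_derive x 1 w (w' x)) ->
  derivable_oo_LRcontinuous w a b.
Proof.
move=> dw; have cw := is_derive_continuous dw; split.
- by move=> x _; case: (dw x).
- by apply: cvg_at_right_filter; exact: cw.
- by apply: cvg_at_left_filter; exact: cw.
Qed.

Let integrable_itv f a b : continuous f -> leb.-integrable `[a, b] (EFin \o f).
Proof.
move=> cf; apply: continuous_compact_integrable; first exact: segment_compact.
exact: continuous_subspaceT.
Qed.

Lemma normal_IBP_itv w w' (a b : R) : a < b ->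
  (forall x : R, is_derive x 1 w (w' x)) -> continuous w' ->
  \int[leb]_(x in `[a, b]) (w' x * dens x) =
  w b * dens b - w a * dens a + \int[leb]_(x in `[a, b]) (x * w x * dens x).
Proof.
move=> ab dw cw'; have cw := is_derive_continuous dw.
have dd := @is_derive_normal_pdf R.
have cg : continuous (fun x : R => - x * dens x).
  by apply: continuousMR => //; exact: opp_continuous.
have dw1 : {in `]a, b[, (w^`())%classic =1 w'}.
  by move=> x _; rewrite derive1E; case: (dw x).
have dd1 : {in `]a, b[, (dens^`())%classic =1 (fun x => - x * dens x)}.
  by move=> x _; rewrite derive1E; case: (dd x).
have := Rintegration_by_parts ab (continuous_subspaceT cw') (LR a b dw) dw1
  (continuous_subspaceT cg) (LR a b dd) dd1.
rewrite (_ : \int[leb]_(x in `[a, b]) (w x * (- x * dens x)) =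
   -1 * \int[leb]_(x in `[a, b]) (x * w x * dens x)).
  lra.
rewrite -RintegralZl//.
  by apply: eq_Rintegral => x _; ring.
apply: integrable_itv; apply: continuousMR => //; apply: continuousMR => //.
by move=> x; exact: cvg_id.
Qed.

(** Integration by parts with [w = id] on symmetric intervals: the boundary term has the favourable
    sign, so the truncated second moment is at most the mass of the density. Monotone convergence
    concludes. *)
Lemma normal_second_moment :
  (\int[leb]_x (x ^+ 2 * dens x)%:E <= 1)%E.
Proof.
have -> : (\int[leb]_x (x ^+ 2 * dens x)%:E =
    \int[leb]_(x in \bigcup_m D m) (x ^+ 2 * dens x)%:E)%E.
  congr (integral _ _ _); apply/esym/seteqP; split=> // x _.
  by have [m _ Dx] := near_D x; exists m => //; apply: Dx => /=.
have mq : measurable_fun setT (fun x : R => (x ^+ 2 * dens x)%:E).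
  apply/measurable_EFinP; apply: measurable_funM; first exact: measurable_funX.
  exact: measurable_normal_pdf.
have cq : continuous (fun x : R => x ^+ 2 * dens x).
  by apply: continuousMR => //; exact: exprn_continuous.
apply: cvge_to_le (@ge0_nondecreasing_set_cvg_integral _ _ _ D
  (fun x => (x ^+ 2 * dens x)%:E) leb _ _ _ _) _.
- move=> m1 m2 m12; apply/subsetPset; apply: subset_itv; rewrite bnd_simp.
    by rewrite lerN2 ler_nat.
  by rewrite ler_nat.
- exact: mD.
- by move=> m; exact: measurable_funTS.
- by move=> m x _; rewrite lee_fin mulr_ge0 ?sqr_ge0 ?normal_pdf_ge0.
- apply: nearW => m.
  have iq : leb.-integrable (D m) (EFin \o (fun x : R => x ^+ 2 * dens x)).
    exact: integrable_itv.
  rewrite -[leLHS]fineK; last exact: integrable_fin_num.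
  have ab : - m.+1%:R < m.+1%:R :> R by rewrite gtrN.
  have H := normal_IBP_itv ab (fun x : R => is_derive_id x 1) (@cst_continuous R R 1).
  have e1 : \int[leb]_(x in D m) (1 * dens x) = \int[leb]_(x in D m) dens x.
    by apply: eq_Rintegral => x _; rewrite mul1r.
  have e2 : \int[leb]_(x in D m) (x * x * dens x) =
      \int[leb]_(x in D m) (x ^+ 2 * dens x).
    by apply: eq_Rintegral => x _; rewrite expr2.
  have d1 : \int[leb]_(x in D m) dens x <= 1.
    rewrite -lee_fin fineK.
      rewrite -(integral_normal_pdf 0 1); apply: ge0_subset_integral => //.
        by apply/measurable_EFinP; exact: measurable_normal_pdf.
      by move=> x _; rewrite lee_fin normal_pdf_ge0.
    by apply: integrable_fin_num => //; exact: integrable_itv.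
  have d2 : 0 <= m.+1%:R * dens m.+1%:R by rewrite mulr_ge0 ?normal_pdf_ge0.
  rewrite lee_fin -/(Rintegral leb (D m) (fun x => x ^+ 2 * dens x)) -e2.
  move: H; rewrite normal_pdfN e1 => H; rewrite /D in d1 *.
  move: H d1 d2; set u := Rintegral _ _ _; set v := Rintegral _ _ _; lra.
Qed.

Lemma integrable_normal_sqr : gamma.-integrable setT (EFin \o (fun x : R => x ^+ 2)).
Proof.
apply: integrable_normal_prob; first exact: measurable_funX.
apply/integrableP; split.
  apply/measurable_EFinP; apply: measurable_funM; first exact: measurable_funX.
  exact: measurable_normal_pdf.
apply: (@le_lt_trans _ _ 1%E); last exact: ltry.
apply: le_trans normal_second_moment; rewrite le_eqVlt; apply/orP; left; apply/eqP.
apply: eq_integral => x _; rewrite /= ger0_norm// mulr_ge0 ?sqr_ge0//.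
exact: normal_pdf_ge0.
Qed.

Lemma Rintegral_normal_sqr : \int[gamma]_x (x ^+ 2) <= 1.
Proof.
rewrite Rintegral_normal_prob; last exact: measurable_funX.
rewrite -lee_fin fineK ?normal_second_moment//.
rewrite ge0_fin_numE; last first.
  by apply: integral_ge0 => x _; rewrite lee_fin mulr_ge0 ?sqr_ge0 ?normal_pdf_ge0.
exact: le_lt_trans normal_second_moment (ltry _).
Qed.

(** Limit of [normal_IBP_itv] on growing intervals. Linear growth of [w] against [normal_pdf_tail]
    makes the boundary terms O(1/m), and the second moment of the density dominates x * w x. *)
Lemma normal_IBP w w' (L : R) : (forall x : R, is_derive x 1 w (w' x)) ->
  continuous w' -> (forall x, `|w' x| <= L) ->
  (forall x, `|w x| <= `|w 0| + L * `|x|) ->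
  \int[gamma]_x w' x = \int[gamma]_x (x * w x).
Proof.
move=> dw cw' w'L wL; have cw := is_derive_continuous dw.
have L0 : 0 <= L by apply: le_trans (w'L 0).
have mw' : measurable_fun setT w' by exact: continuous_measurable_fun.
have mw : measurable_fun setT w by exact: continuous_measurable_fun.
have mxw : measurable_fun setT (fun x : R => x * w x) by exact: measurable_funM.
rewrite !Rintegral_normal_prob//.
have i0 : leb.-integrable setT (EFin \o dens) by exact: integrable_normal_pdf.
have i2 : leb.-integrable setT (EFin \o (fun x : R => x ^+ 2 * dens x)).
  apply/integrableP; split.
    apply/measurable_EFinP; apply: measurable_funM; first exact: measurable_funX.
    exact: measurable_normal_pdf.
  apply: (@le_lt_trans _ _ 1%E); last exact: ltry.
  apply: le_trans normal_second_moment; rewrite le_eqVlt; apply/orP; left; apply/eqP.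
  apply: eq_integral => x _; rewrite /= ger0_norm// mulr_ge0 ?sqr_ge0//.
  exact: normal_pdf_ge0.
have i1 : leb.-integrable setT (EFin \o (fun x : R => w' x * dens x)).
  apply: (integrable_dominated _ (integrableZr L i0)).
    by apply: measurable_funM => //; exact: measurable_normal_pdf.
  move=> x; rewrite normrM (ger0_norm (normal_pdf_ge0 _ _ _)).
  by rewrite ler_wpM2r// normal_pdf_ge0.
have i3 : leb.-integrable setT (EFin \o (fun x : R => x * w x * dens x)).
  apply: (integrable_dominated _
    (integrableDr (integrableZr `|w 0| i0) (integrableZr (`|w 0| + L) i2))).
    by apply: measurable_funM => //; exact: measurable_normal_pdf.
  move=> x; rewrite normrM (ger0_norm (normal_pdf_ge0 _ _ _)) mulrA -mulrDl.
  rewrite ler_wpM2r ?normal_pdf_ge0// normrM.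
  apply: le_trans (ler_wpM2l (normr_ge0 _) (wL x)) _.
  rewrite -(real_normK (num_real x)).
  have := normr_ge0 (w 0); have := normr_ge0 x.
  move: `|x| `|w 0| => u v u0 v0.
  have : v * u <= v * (1 + u ^+ 2) by rewrite ler_wpM2l//; nra.
  lra.
have H1 := Rintegral_exhaust i1; have H3 := Rintegral_exhaust i3.
pose B m := w m.+1%:R * dens m.+1%:R - w (- m.+1%:R) * dens (- m.+1%:R).
have HB m : \int[leb]_(x in D m) (w' x * dens x) =
    B m + \int[leb]_(x in D m) (x * w x * dens x).
  by apply: normal_IBP_itv => //; rewrite gtrN.
pose A := 2 * ((`|w 0| + L) * (2 * normal_peak 1)).
have bd (y : R) m : `|y| = m.+1%:R ->
    `|w y * dens y| <= (`|w 0| + L) * (2 * normal_peak 1) / m.+1%:R.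
  move=> yE; have N0 : 0 < m.+1%:R :> R by [].
  have N1 : 1 <= m.+1%:R :> R by rewrite ler1n.
  have -> : dens y = dens m.+1%:R by rewrite !normal_pdf01 -yE real_normK ?num_real.
  rewrite normrM (ger0_norm (normal_pdf_ge0 _ _ _)).
  apply: (@le_trans _ _ (((`|w 0| + L) * m.+1%:R) *
      (2 * normal_peak 1 / m.+1%:R ^+ 2))).
    apply: ler_pM => //; first exact: normal_pdf_ge0; last exact: normal_pdf_tail.
    apply: le_trans (wL y) _; rewrite yE mulrDl lerD2r.
    by rewrite ler_peMr.
  rewrite le_eqVlt; apply/orP; left; apply/eqP; field.
  by rewrite gt_eqF.
have B0 : B m @[m --> \oo] --> (0 : R).
  apply: norm_cvg0.
  apply: (@squeeze_cvgr _ _ _ _ (cst 0) (fun m => A * harmonic m)).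
  - apply: nearW => m; rewrite normr_ge0/= /B.
    apply: le_trans (ler_normB _ _) _.
    rewrite /A -mulrA mulr_natl mulr2n; apply: lerD; apply: bd.
      by rewrite ger0_norm.
    by rewrite normrN ger0_norm.
  - exact: cvg_cst.
  - by rewrite -[X in _ --> X](mulr0 A); apply: cvgMr; exact: cvg_harmonic.
have H : \int[leb]_(x in D m) (w' x * dens x) @[m --> \oo] -->
    0 + \int[leb]_x (x * w x * dens x).
  by under eq_fun do rewrite HB; exact: cvgD.
by rewrite add0r in H; exact: cvg_unique H1 H.
Qed.

End normal_integration_by_parts.

(** * Fubini and image measures for real-valued integrals *)

Section product_integration.
Context d1 d2 {T1 : measurableType d1} {T2 : measurableType d2} {R : realType}.
Variables (P1 : probability T1 R) (P2 : probability T2 R).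

Lemma integrable_prodM (V1 : T1 -> R) (V2 : T2 -> R) :
  P1.-integrable setT (EFin \o V1) -> P2.-integrable setT (EFin \o V2) ->
  (P1 \x P2)%E.-integrable setT (EFin \o (fun z => V1 z.1 * V2 z.2)).
Proof.
move=> i1 i2.
have m1 : measurable_fun setT V1 by apply/measurable_EFinP; case/integrableP : i1.
have m2 : measurable_fun setT V2 by apply/measurable_EFinP; case/integrableP : i2.
apply/integrable12ltyP.
  apply/measurable_EFinP; apply: measurable_funM.
    exact: (measurableT_comp m1).
  exact: (measurableT_comp m2).
rewrite (eq_integral (fun x => `|V1 x|%:E * \int[P2]_y `|V2 y|%:E)%E); last first.
  move=> x _; rewrite -ge0_integralZl//=.
    by apply: eq_integral => y _; rewrite -EFinM normrM.
  by apply/measurable_EFinP; exact: measurableT_comp.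
move: i1 i2 => /integrableP[_ i1] /integrableP[_ i2].
rewrite ge0_integralZr//=; last 2 first.
- by apply/measurable_EFinP; exact: measurableT_comp.
- by apply: integral_ge0.
by rewrite lte_mul_pinfty// ?integral_ge0// ge0_fin_numE// integral_ge0.
Qed.

Variable f : T1 * T2 -> R.
Hypothesis fi : (P1 \x P2)%E.-integrable setT (EFin \o f).

Lemma Rintegral_prod1 : (forall x, P2.-integrable setT (EFin \o (fun y => f (x, y)))) ->
  \int[(P1 \x P2)%E]_z f z = \int[P1]_x \int[P2]_y f (x, y).
Proof.
move=> fx; rewrite {1}/Rintegral -integral12_prod_meas1//.
congr fine; apply: eq_integral => x _; rewrite fineK//.
exact: integrable_fin_num (fx x).
Qed.

Lemma Rintegral_prod2 : (forall y, P1.-integrable setT (EFin \o (fun x => f (x, y)))) ->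
  \int[(P1 \x P2)%E]_z f z = \int[P2]_y \int[P1]_x f (x, y).
Proof.
move=> fy; rewrite {1}/Rintegral -integral21_prod_meas1//.
congr fine; apply: eq_integral => x _; rewrite fineK//.
exact: integrable_fin_num (fy x).
Qed.

Lemma integrable_Rintegral_prod1 :
  (forall x, P2.-integrable setT (EFin \o (fun y => f (x, y)))) ->
  P1.-integrable setT (EFin \o (fun x => \int[P2]_y f (x, y))).
Proof.
move=> fx; apply: (eq_integrable measurableT (fubini_F P2 (EFin \o f))).
  by move=> x _; rewrite /= /fubini_F fineK//; exact: integrable_fin_num (fx x).
exact: integrable_fubini_F.
Qed.

End product_integration.

Section distribution_integration.
Context d d' {T : measurableType d} {T' : measurableType d'} {R : realType}.
Variables (P : probability T R) (X : {mfun T >-> T'}) (f : T' -> R).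
Hypothesis mf : measurable_fun setT f.
Hypothesis fi : P.-integrable setT (EFin \o (fun x => f (X x))).

Lemma integrable_distribution : (distribution P X).-integrable setT (EFin \o f).
Proof.
by apply: integrable_pushforward => //; exact/measurable_EFinP.
Qed.

Lemma Rintegral_distribution : \int[distribution P X]_y f y = \int[P]_x f (X x).
Proof.
by rewrite /Rintegral integral_distribution//; exact/measurable_EFinP.
Qed.

End distribution_integration.

Section is_derive_scale.
Context {R : realType} {V : normedModType R}.

Lemma is_deriveZv (phi : R -> R) (v : V) (t c : R) : is_derive t 1 phi c ->
  is_derive t 1 (fun s => phi s *: v) (c *: v).
Proof.
move=> [dphi phiE]; have dphi' : differentiable phi t by exact/derivable1_diffP.
have dv : differentiable (fun s => phi s *: v) t by exact: differentiableZl.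
apply: DeriveDef; first exact/derivable1_diffP.
by rewrite deriveE// diffZl// -phiE deriveE.
Qed.

End is_derive_scale.

Section smooth_growth.
Context {R : realType} {n : nat}.

Lemma elipschitz_growth L (f : 'rV[R]_n -> R) x : elipschitz L f ->
  `|f x| <= `|f 0| + L * enorm x.
Proof.
move=> fL; rewrite -[f x](subrK (f 0)) addrC (le_trans (ler_normD _ _))//.
by rewrite lerD2l; have := fL x 0; rewrite subr0.
Qed.

Lemma partial_le L (f : 'rV[R]_n -> R) x i : elipschitz L f -> smooth_expr f ->
  `|partial i f x| <= L.
Proof.
move=> fL sf; have := @elipschitz_derive _ _ L f x (delta_mx ord0 i) fL
  (smooth_expr_differentiable x sf).
rewrite (_ : enorm (delta_mx ord0 i) = 1) ?mulr1//.
rewrite /enorm /dotp (bigD1 i)//= big1 => [|j ji].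
  by rewrite mxE !eqxx mulr1 addr0 sqrtr1.
by rewrite mxE (negbTE ji) andbF mul0r.
Qed.

End smooth_growth.

Section standard_gaussian.
Context {R : realType}.
Local Notation gamma := (@normal_prob R 0 1).

Lemma rV_cons0 k s (g : 'rV[R]_k) : rV_cons (s, g) ord0 ord0 = s.
Proof.
rewrite (_ : ord0 = lshift k (ord0 : 'I_1) :> 'I_(1 + k)); last exact: val_inj.
by rewrite /rV_cons [LHS]row_mxEl mxE.
Qed.

Lemma rV_consS k s (g : 'rV[R]_k) j : rV_cons (s, g) ord0 (lift ord0 j) = g ord0 j.
Proof.
rewrite (_ : lift ord0 j = rshift 1 j :> 'I_(1 + k)); last exact: val_inj.
by rewrite /rV_cons [LHS]row_mxEr.
Qed.

Lemma dotp_rV_cons k s t (g h : 'rV[R]_k) :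
  dotp (rV_cons (s, g)) (rV_cons (t, h)) = s * t + dotp g h.
Proof.
rewrite /dotp big_ord_recl !rV_cons0; congr (_ + _).
by apply: eq_bigr => j _; rewrite !rV_consS.
Qed.

Lemma rV_consE k s (g : 'rV[R]_k) :
  rV_cons (s, g) = s *: delta_mx ord0 ord0 + rV_cons (0, g).
Proof.
apply/rowP => i; rewrite [RHS]mxE [X in _ = X + _]mxE [X in _ = _ * X + _]mxE.
case: (unliftP ord0 i) => [j ->|->].
  by rewrite !rV_consS mulr0 add0r.
by rewrite !rV_cons0 eqxx mulr1 addr0.
Qed.

Lemma rV_consBr k s (g h : 'rV[R]_k) :
  enorm (rV_cons (s, g) - rV_cons (s, h)) = enorm (g - h).
Proof.
rewrite /enorm; congr Num.sqrt.
by rewrite !(dotpBl, dotpBr) !dotp_rV_cons; ring.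
Qed.

Lemma rV_consBl k s t (g : 'rV[R]_k) :
  enorm (rV_cons (s, g) - rV_cons (t, g)) = `|s - t|.
Proof.
rewrite /enorm -sqrtr_sqr; congr Num.sqrt.
by rewrite !(dotpBl, dotpBr) !dotp_rV_cons; ring.
Qed.

Let gk k : probability (measurableTypeR R * 'rV[R]_k)%type R :=
  (gamma \x std_gaussian k)%E.

Lemma integrable_std_gaussianS k (f : 'rV[R]_k.+1 -> R) : measurable_fun setT f ->
  (gamma \x std_gaussian k)%E.-integrable setT (EFin \o (fun z => f (rV_cons z))) ->
  (std_gaussian k.+1).-integrable setT (EFin \o f).
Proof. exact: (@integrable_distribution _ _ _ _ _ (gk k)). Qed.

Lemma Rintegral_std_gaussianS k (f : 'rV[R]_k.+1 -> R) : measurable_fun setT f ->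
  (gamma \x std_gaussian k)%E.-integrable setT (EFin \o (fun z => f (rV_cons z))) ->
  \int[std_gaussian k.+1]_g f g = \int[(gamma \x std_gaussian k)%E]_z f (rV_cons z).
Proof. exact: (@Rintegral_distribution _ _ _ _ _ (gk k)). Qed.

End standard_gaussian.

Section gaussian_integration_by_parts.
Context {R : realType}.
Local Notation gamma := (@normal_prob R 0 1).

Let integrable_gamma1 : gamma.-integrable setT (EFin \o (fun s : R => 1 + s ^+ 2)).
Proof.
apply: (@integrableDr _ _ _ _ (cst 1)); last exact: integrable_normal_sqr.
exact: finite_measure_integrable_cst.
Qed.

Let integrable_cons k (f : measurableTypeR R * 'rV[R]_k -> R) (C : R) :
  (std_gaussian k).-integrable setT (EFin \o (fun g : 'rV[R]_k => dotp g g)) ->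
  measurable_fun setT f ->
  (forall s g, `|f (s, g)| <= C * ((1 + s ^+ 2) * (1 + dotp g g))) ->
  (gamma \x std_gaussian k)%E.-integrable setT (EFin \o f).
Proof.
move=> ik mf fC.
have i1 : (std_gaussian k).-integrable setT
    (EFin \o (fun g : 'rV[R]_k => 1 + dotp g g)).
  apply: (@integrableDr _ _ _ _ (cst 1)) => //.
  exact: finite_measure_integrable_cst.
apply: (integrable_dominated mf
  (integrableZr C (integrable_prodM integrable_gamma1 i1))).
by move=> [s g]; exact: fC.
Qed.

Lemma integrable_std_gaussian_sqr k :
  (@std_gaussian R k).-integrable setT (EFin \o (fun g : 'rV[R]_k => dotp g g)).
Proof.
elim: k => [|k IH].
  rewrite (_ : (fun g : 'rV[R]_0 => dotp g g) = cst 0); last first.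
    by apply/funext => g; rewrite /dotp big_ord0.
  exact: finite_measure_integrable_cst.
have md : measurable_fun setT (fun g : 'rV[R]_k.+1 => dotp g g).
  by apply: smooth_expr_measurable; exact: smooth_dotpp.
apply: integrable_std_gaussianS => //.
apply: (@integrable_cons _ _ 1) => //.
  by apply: (measurableT_comp md); exact: measurable_rV_cons.
move=> s g; rewrite dotp_rV_cons -expr2 mul1r.
have := dotpp_ge0 g; have := sqr_ge0 s.
move: (dotp g g) (s ^+ 2) => u v u0 v0.
by rewrite ger0_norm; nra.
Qed.

Lemma integrable_std_gaussian k (f : 'rV[R]_k -> R) (C : R) :
  measurable_fun setT f -> (forall g, `|f g| <= C * (1 + dotp g g)) ->
  (std_gaussian k).-integrable setT (EFin \o f).
Proof.
move=> mf fC; apply: (integrable_dominated mf (integrableZr C _) fC).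
apply: (@integrableDr _ _ _ _ (cst 1)).
  exact: finite_measure_integrable_cst.
exact: integrable_std_gaussian_sqr.
Qed.

Lemma coord_sqr_le k (g : 'rV[R]_k) i : g ord0 i ^+ 2 <= dotp g g.
Proof.
rewrite /dotp (bigD1 i)//= -expr2 lerDl; apply: sumr_ge0 => j _.
by rewrite -expr2 sqr_ge0.
Qed.

Lemma integrable_gaussian_coord_sqr k i :
  (@std_gaussian R k).-integrable setT (EFin \o (fun g => g ord0 i ^+ 2)).
Proof.
apply: (@integrable_std_gaussian _ _ 1).
  by apply: measurable_funX; exact: measurable_coord.
move=> g; rewrite ger0_norm ?sqr_ge0// mul1r.
by apply: le_trans (coord_sqr_le g i) _; rewrite lerDr.
Qed.

Lemma gaussian_coord_sqr k i : \int[@std_gaussian R k]_g (g ord0 i ^+ 2) <= 1.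
Proof.
elim: k i => [[]//|k IH] i.
have mc : measurable_fun setT (fun g : 'rV[R]_k.+1 => g ord0 i ^+ 2).
  by apply: measurable_funX; exact: measurable_coord.
have mk := @integrable_std_gaussian_sqr k.
have ic : (gamma \x std_gaussian k)%E.-integrable setT
    (EFin \o (fun z => rV_cons z ord0 i ^+ 2)).
  apply: (@integrable_cons _ _ 1) => //.
    by apply: (measurableT_comp mc); exact: measurable_rV_cons.
  move=> s g; rewrite ger0_norm ?sqr_ge0// mul1r.
  apply: le_trans (coord_sqr_le _ _) _; rewrite dotp_rV_cons -expr2.
  have := dotpp_ge0 g; have := sqr_ge0 s.
  by move: (dotp g g) (s ^+ 2) => u v u0 v0; nra.
rewrite Rintegral_std_gaussianS//.
case: (unliftP ord0 i) ic => [j ->|->] ic.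
- rewrite (Rintegral_prod1 ic); last first.
    move=> s; under eq_fun do rewrite rV_consS.
    exact: integrable_gaussian_coord_sqr.
  under eq_Rintegral do under eq_Rintegral do rewrite rV_consS.
  by rewrite (@Rintegral_cst _ _ _ gamma)//= (@probability_setT _ _ _ gamma) mulr1.
- rewrite (Rintegral_prod2 ic); last first.
    move=> g; under eq_fun do rewrite rV_cons0.
    exact: integrable_normal_sqr.
  under eq_Rintegral do under eq_Rintegral do rewrite rV_cons0.
  rewrite (@Rintegral_cst _ _ _ (std_gaussian k))//=.
  rewrite (@probability_setT _ _ _ (std_gaussian k)) mulr1.
  exact: Rintegral_normal_sqr.
Qed.

(** From |u| <= (1 + u^2) / 2. This is cruder than the exact mean sqrt(2 / pi), but 1 suffices for
    the constant of the theorem. *)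
Lemma gaussian_coord_norm k i :
  (@std_gaussian R k).-integrable setT (EFin \o (fun g : 'rV[R]_k => `|g ord0 i|)) /\
  \int[@std_gaussian R k]_g `|g ord0 i| <= 1.
Proof.
have i2 := integrable_gaussian_coord_sqr i.
have ib : (@std_gaussian R k).-integrable setT
    (EFin \o (fun g => 2^-1 * (1 + g ord0 i ^+ 2))).
  apply: integrableZr; apply: (@integrableDr _ _ _ _ (cst 1)) => //.
  exact: finite_measure_integrable_cst.
have bd (g : 'rV[R]_k) : `|g ord0 i| <= 2^-1 * (1 + g ord0 i ^+ 2).
  rewrite -(real_normK (num_real (g ord0 i))).
  by move: `|g ord0 i| => u; have := sqr_ge0 (u - 1); lra.
have i1 : (@std_gaussian R k).-integrable setT (EFin \o (fun g => `|g ord0 i|)).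
  apply: (integrable_dominated _ ib) => [|g]; last by rewrite normr_id.
  by apply: measurableT_comp => //; exact: measurable_coord.
split => //.
apply: le_trans (le_Rintegral _ i1 ib _) _ => //.
rewrite RintegralZl//; last first.
  apply: (@integrableDr _ _ _ _ (cst 1)) => //.
  exact: finite_measure_integrable_cst.
rewrite RintegralD//; last exact: finite_measure_integrable_cst.
rewrite (@Rintegral_cst _ _ _ (std_gaussian k))//=.
rewrite (@probability_setT _ _ _ (std_gaussian k)) mulr1.
by have := gaussian_coord_sqr i; lra.
Qed.

Lemma partial_rV_cons k (u : 'rV[R]_k.+1 -> R) s (g : 'rV[R]_k) j :
  partial j (fun g => u (rV_cons (s, g))) g = partial (lift ord0 j) u (rV_cons (s, g)).
Proof.
rewrite /partial /derive.
rewrite [X in lim (X @ _) = _](_ : _ = fun h => h^-1 *: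
  ((u \o shift (rV_cons (s, g))) (h *: delta_mx ord0 (lift ord0 j)) -
   u (rV_cons (s, g))))//.
apply/funext => h /=; congr (_ *: (u _ - _)); apply/rowP => i; rewrite [RHS]mxE [X in _ = X + _]mxE.
rewrite [X in _ = _ * X + _]mxE; case: (unliftP ord0 i) => [l ->|->].
  by rewrite !rV_consS !mxE /= (inj_eq lift_inj).
by rewrite !rV_cons0 eqxx /= mulr0 add0r.
Qed.

Lemma is_derive_rV_cons k (s : R) (g : 'rV[R]_k) :
  is_derive s 1 (fun t : R => rV_cons (t, g)) (delta_mx ord0 ord0).
Proof.
rewrite (_ : (fun t => _) =
  (fun t : R => t *: delta_mx ord0 ord0) + cst (rV_cons (0, g))).
  have H := is_deriveD
    (@is_deriveZv _ _ id (delta_mx ord0 ord0 : 'rV[R]_k.+1) s 1 (is_derive_id s 1))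
    (is_derive_cst (rV_cons (0, g)) s 1).
  by apply: is_derive_eq H _; rewrite scale1r addr0.
by apply/funext => t; rewrite rV_consE.
Qed.

(** Induction on [k], peeling off the first coordinate. Fubini is taken in the order that puts the
    differentiated coordinate innermost: [normal_IBP] applies if it is the first one, the induction
    hypothesis on sections otherwise. *)
Lemma gaussian_IBP k (u : 'rV[R]_k -> R) (L : R) i : smooth_expr u ->
  elipschitz L u ->
  \int[std_gaussian k]_g partial i u g = \int[std_gaussian k]_g (g ord0 i * u g).
Proof.
elim: k u i => [u []//|k IH] u i su uL.
(* The Lipschitz bound between 0 and a basis vector, available in dimension [k.+1], forces the sign
   of [L]. *)
have L0 : 0 <= L.
  have := uL (delta_mx ord0 ord0) 0; rewrite subr0 => /(le_trans (normr_ge0 _)).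
  rewrite pmulr_lge0// lt_def enorm_ge0 andbT; apply/eqP => e0.
  have := coord_le_enorm (delta_mx ord0 ord0 : 'rV[R]_k.+1) ord0.
  by rewrite e0 mxE !eqxx normr1 ler10.
have spu : smooth_expr (partial i u) by exact: smooth_expr_partial.
have sgu : smooth_expr (fun g => g ord0 i * u g).
  by apply: smooth_mul => //; exact: smooth_coord.
have mk := @integrable_std_gaussian_sqr k.
have grow (x : 'rV[R]_k.+1) : `|x ord0 i * u x| <= (`|u 0| + L) * (1 + dotp x x).
  rewrite normrM; apply: le_trans (ler_pM _ _ (coord_le_enorm x i)
    (elipschitz_growth x uL)) _ => //.
  rewrite -enorm_sqr; have := enorm_ge0 x; have := normr_ge0 (u 0).
  move: (enorm x) `|u 0| => a b b0 a0.
  have : b * a <= b * (1 + a ^+ 2) by rewrite ler_wpM2l//; nra.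
  have : 0 <= L * 1 by rewrite mulr1.
  nra.
have consbd s (g : 'rV[R]_k) : 1 + dotp (rV_cons (s, g)) (rV_cons (s, g)) <=
    (1 + s ^+ 2) * (1 + dotp g g).
  rewrite dotp_rV_cons -expr2; have := dotpp_ge0 g; have := sqr_ge0 s.
  by move: (dotp g g) (s ^+ 2) => a b a0 b0; nra.
have uL0 : 0 <= `|u 0| + L by rewrite addr_ge0.
have growp (x : 'rV[R]_k.+1) : `|partial i u x| <= L * (1 + dotp x x).
  apply: le_trans (partial_le _ _ uL su) _.
  by rewrite ler_peMr// lerDl dotpp_ge0.
have ip : (gamma \x std_gaussian k)%E.-integrable setT
    (EFin \o (fun z => partial i u (rV_cons z))).
  apply: (@integrable_cons _ _ L) => //.
    apply: (measurableT_comp (smooth_expr_measurable spu)).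
    exact: measurable_rV_cons.
  by move=> s g; apply: le_trans (growp _) _; rewrite ler_wpM2l.
have ig : (gamma \x std_gaussian k)%E.-integrable setT
    (EFin \o (fun z => rV_cons z ord0 i * u (rV_cons z))).
  apply: (@integrable_cons _ _ (`|u 0| + L)) => //.
    apply: (measurableT_comp (smooth_expr_measurable sgu)).
    exact: measurable_rV_cons.
  by move=> s g; apply: le_trans (grow _) _; rewrite ler_wpM2l.
rewrite !Rintegral_std_gaussianS//; last 2 first.
- exact: (smooth_expr_measurable sgu).
- exact: (smooth_expr_measurable spu).
have scons s : smooth_expr (fun g : 'rV[R]_k => u (rV_cons (s, g))).
  apply: (smooth_comp su) => j; case: (unliftP ord0 j) => [l ->|->].
    by under eq_fun do rewrite rV_consS; exact: smooth_coord.
  by under eq_fun do rewrite rV_cons0; exact: smooth_cst.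
have lcons s : elipschitz L (fun g : 'rV[R]_k => u (rV_cons (s, g))).
  by move=> g h; apply: le_trans (uL _ _) _; rewrite rV_consBr.
have i1 s (f : 'rV[R]_k.+1 -> R) C : 0 <= C -> measurable_fun setT f ->
    (forall x, `|f x| <= C * (1 + dotp x x)) ->
    (std_gaussian k).-integrable setT (EFin \o (fun g => f (rV_cons (s, g)))).
  move=> C0 mf fC; apply: (@integrable_std_gaussian _ _ (C * (1 + s ^+ 2))).
    apply: (measurableT_comp mf); apply: measurableT_comp.
      exact: measurable_rV_cons.
    exact: measurable_pair1.
  by move=> g; apply: le_trans (fC _) _; rewrite -mulrA ler_wpM2l.
have i2 (g : 'rV[R]_k) (f : 'rV[R]_k.+1 -> R) C : 0 <= C -> measurable_fun setT f ->
    (forall x, `|f x| <= C * (1 + dotp x x)) ->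
    gamma.-integrable setT (EFin \o (fun s => f (rV_cons (s, g)))).
  move=> C0 mf fC; apply: (integrable_dominated _
    (integrableZr (C * (1 + dotp g g)) integrable_gamma1)).
    apply: (measurableT_comp mf); apply: measurableT_comp.
      exact: measurable_rV_cons.
    exact: measurable_pair2.
  move=> s; apply: le_trans (fC _) _.
  by rewrite -mulrA ler_wpM2l// [leRHS]mulrC.
have mpu := smooth_expr_measurable spu.
have mgu := smooth_expr_measurable sgu.
case: (unliftP ord0 i) => [j ij|i0].
- rewrite (Rintegral_prod1 ip); last by move=> s; exact: (i1 s _ L).
  rewrite (Rintegral_prod1 ig); last first.
    by move=> s; exact: (i1 s _ (`|u 0| + L) uL0 mgu grow).
  apply: eq_Rintegral => s _.
  transitivity (\int[std_gaussian k]_g partial j (fun g => u (rV_cons (s, g))) g).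
    by apply: eq_Rintegral => g _; rewrite partial_rV_cons ij.
  rewrite IH//; apply: eq_Rintegral => g _.
  by rewrite ij rV_consS.
- rewrite (Rintegral_prod2 ip); last by move=> g; exact: (i2 g _ L).
  rewrite (Rintegral_prod2 ig); last first.
    by move=> g; exact: (i2 g _ (`|u 0| + L) uL0 mgu grow).
  apply: eq_Rintegral => g _; rewrite i0.
  under [RHS]eq_Rintegral do rewrite rV_cons0.
  apply: (@normal_IBP _ _ _ L).
  + move=> s; rewrite /partial.
    exact: (derivable_along (smooth_expr_differentiable _ su) (is_derive_rV_cons s g)).
  + move=> s; apply: continuous_comp.
      by apply/differentiable_continuous/derivable1_diffP; case: (is_derive_rV_cons s g).
    by apply: smooth_expr_continuous; rewrite -i0.
  + by move=> s; exact: partial_le.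
  + move=> s; have := uL (rV_cons (s, g)) (rV_cons (0, g)).
    rewrite rV_consBl subr0 => H; rewrite -[u (rV_cons (s, g))](subrK (u (rV_cons (0, g)))).
    by apply: le_trans (ler_normD _ _) _; rewrite addrC lerD2l.
Qed.

End gaussian_integration_by_parts.

(** * The Poincare inequality for Lipschitz functions *)

Section partial_rules.
Context {R : realType} {n : nat}.
Implicit Types (f g : 'rV[R]_n -> R) (x : 'rV[R]_n).

Lemma partialM f g i x : differentiable f x -> differentiable g x ->
  partial i (fun y => f y * g y) x = f x * partial i g x + g x * partial i f x.
Proof. by move=> df dg; apply: deriveM; exact: diff_derivable. Qed.

Lemma partialD f g i x : differentiable f x -> differentiable g x ->
  partial i (fun y => f y + g y) x = partial i f x + partial i g x.
Proof. by move=> df dg; apply: deriveD; exact: diff_derivable. Qed.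

Lemma derive_coord i v x : 'D_v (fun y : 'rV[R]_n => y ord0 i) x = v ord0 i.
Proof.
have := derive_id x v; rewrite derive_mx; last exact: derivable_id.
by move=> /rowP/(_ i); rewrite !mxE.
Qed.

Lemma partial_dotpp i x : partial i (fun y => dotp y y) x = 2 * x ord0 i.
Proof.
have dc j : derivable (fun y : 'rV[R]_n => y ord0 j) x (delta_mx ord0 i).
  by apply: diff_derivable; exact: differentiable_coord.
rewrite /partial (_ : (fun y => dotp y y) =
  \sum_(j < n) (fun y : 'rV[R]_n => y ord0 j * y ord0 j)); last first.
  by apply/funext => y; rewrite fct_sumE.
rewrite derive_sum => [|j]; last by apply: derivableM; exact: dc.
rewrite (bigD1 i)//= big1 => [|j ji].
  rewrite [X in X + _](deriveM (dc i) (dc i)) derive_coord mxE !eqxx/=.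
  by rewrite /GRing.scale/= !mulr1 addr0 mulrDl mul1r.
rewrite [LHS](deriveM (dc j) (dc j)) derive_coord mxE (negbTE ji) andbF.
by rewrite scaler0 addr0.
Qed.

End partial_rules.

Section cutoff.
Context {R : realType} {n : nat}.
Implicit Types (rho : R) (x : 'rV[R]_n).

(** The standard bump exp(-1 / (1 - |x|^2 / rho^2)) of the ball of radius rho; the factor e makes it
    equal to 1 at the origin, hence convergent to 1 everywhere as rho grows. *)
Definition cutoff rho x : R := expR 1 * flat 1 (1 - rho ^- 2 * dotp x x).

Lemma flat1E (y : R) : flat 1 y = if 0 < y then expR (- y^-1) else 0.
Proof. by rewrite /flat -polyC1 hornerC mul1r. Qed.

Lemma smooth_cutoff rho : smooth_expr (cutoff rho).
Proof.
apply: smooth_scale; apply: smooth_flat; apply: smooth_sub.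
  exact: smooth_cst.
by apply: smooth_scale; exact: smooth_dotpp.
Qed.

Lemma cutoff_ge0 rho x : 0 <= cutoff rho x.
Proof.
by rewrite mulr_ge0 ?expR_ge0// flat1E; case: ifP => // _; exact: expR_ge0.
Qed.

Lemma cutoff_le1 rho x : cutoff rho x <= 1.
Proof.
rewrite /cutoff flat1E; case: ifPn => [y0|_]; last by rewrite mulr0.
rewrite -expRD -[leRHS]expR0 ler_expR subr_le0.
rewrite invf_ge1// lerBlDr lerDl mulr_ge0 ?dotpp_ge0//.
by rewrite invr_ge0 sqr_ge0.
Qed.

Lemma cutoff_outside rho x : 0 < rho -> rho <= enorm x -> cutoff rho x = 0.
Proof.
move=> r0 rx; rewrite /cutoff /flat ifF ?mulr0//; apply/negbTE; rewrite -leNgt subr_le0.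
rewrite -enorm_sqr mulrC ler_pdivlMr ?exprn_gt0// mul1r.
by rewrite ler_sqr// nnegrE ?enorm_ge0// ltW.
Qed.

(** The chain rule gives 2 x_i / rho^2 times a bounded derivative, with [C] independent of rho.
    Inside the ball this is of order 1/rho, which exactly balances the linear growth of a Lipschitz
    function. *)
Lemma cutoff_partial_le : exists2 C, 0 <= C & forall rho x i, 0 < rho ->
  `|partial i (cutoff rho) x| <= C * `|x ord0 i| / rho ^+ 2 /\
  (rho <= enorm x -> partial i (cutoff rho) x = 0).
Proof.
have [M M0 fM] := flat_bounded (flat_deriv (1 : {poly R})).
exists (expR 1 * (M * 2)); first by rewrite mulr_ge0 ?expR_ge0// mulr_ge0.
move=> rho x i r0.
pose phi (y : R) : R := expR 1 * flat 1 (1 - rho ^- 2 * y).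
have dphi (y : R) : is_derive y 1 phi
    (expR 1 * (flat (flat_deriv 1) (1 - rho ^- 2 * y) * - rho ^- 2)).
  have d1 : is_derive y 1 (fun z : R => 1 - rho ^- 2 * z) (- rho ^- 2).
    have H := is_deriveB (is_derive_cst (1 : R) y (1 : R))
      (is_deriveZ (rho ^- 2 : R) (is_derive_id y (1 : R))).
    by apply: is_derive_eq H _; rewrite sub0r /GRing.scale/= mulr1.
  have d2 := @is_derive1_comp R (flat 1) (fun z : R => 1 - rho ^- 2 * z) y _ _
    (is_derive_flat 1 (1 - rho ^- 2 * y)) d1.
  exact: (is_deriveZ (expR 1 : R) d2).
have dd : differentiable (fun y : 'rV[R]_n => dotp y y) x.
  by apply: smooth_expr_differentiable; exact: smooth_dotpp.
have [_ H] := differentiable_comp1 dd (dphi (dotp x x)).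
have {H}E : partial i (cutoff rho) x = expR 1 *
    (flat (flat_deriv 1) (1 - rho ^- 2 * dotp x x) * - rho ^- 2) * (2 * x ord0 i).
  by rewrite -partial_dotpp -H.
rewrite E; split.
  rewrite !normrM normrN (gtr0_norm (expR_gt0 _)) normfV.
  rewrite [`|rho ^+ 2|]ger0_norm ?sqr_ge0// (ger0_norm (ler0n _ 2)).
  rewrite (_ : _ * _ * `|x ord0 i| / _ =
    expR 1 * (M / rho ^+ 2) * (2 * `|x ord0 i|)); last by ring.
  rewrite ler_wpM2r ?mulr_ge0// ler_wpM2l ?expR_ge0// ler_wpM2r//.
  by rewrite invr_ge0 sqr_ge0.
move=> rx; rewrite /flat ifF ?mul0r ?mulr0 ?mul0r//.
apply/negbTE; rewrite -leNgt subr_le0.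
rewrite -enorm_sqr mulrC ler_pdivlMr ?exprn_gt0// mul1r.
by rewrite ler_sqr// nnegrE ?enorm_ge0// ltW.
Qed.

Lemma cvg_cutoff x : cutoff m.+1%:R x @[m --> \oo] --> (1 : R).
Proof.
have E : (1 : R) = expR 1 * flat 1 (1 - 0 * dotp x x).
  by rewrite mul0r subr0 flat1E ltr01 invr1 expRN divff// gt_eqF ?expR_gt0.
rewrite [X in _ --> X]E /cutoff; apply: cvgMr.
have cf : continuous (@flat R 1).
  by move=> y; apply/differentiable_continuous/derivable1_diffP; case: (is_derive_flat 1 y).
apply: (@continuous_cvg _ _ _ _ _ _ (flat 1)); first exact: cf.
apply: cvgB; first exact: cvg_cst.
apply: cvgMl.
rewrite (_ : (fun m => _) = (fun m => harmonic m * harmonic m)); last first.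
  by apply/funext => m; rewrite /harmonic/= expr2 invfM.
by rewrite -[X in _ --> X](mulr0 (0 : R)); apply: cvgM; exact: cvg_harmonic.
Qed.

End cutoff.

Section poincare_test_functions.
Context {R : realType} {n : nat}.
Variable mu : probability 'rV[R]_n R.

Lemma varianceEint (f : 'rV[R]_n -> R) :
  ('V_mu[f] = \int[mu]_x ((f x - \int[mu]_y f y) ^+ 2)%:E)%E.
Proof. by rewrite /variance unlock unlock. Qed.

Lemma variance_integral (f : 'rV[R]_n -> R) :
  mu.-integrable setT (EFin \o f) -> mu.-integrable setT (EFin \o (fun x => f x ^+ 2)) ->
  'V_mu[f]%E = (\int[mu]_x (f x ^+ 2) - (\int[mu]_x f x) ^+ 2)%:E.
Proof.
move=> i1 i2; rewrite varianceEint; set m := \int[mu]_x f x.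
have iV : mu.-integrable setT (EFin \o (fun x => (f x - m) ^+ 2)).
  rewrite (_ : (fun x => _) = (fun x => f x ^+ 2 + ((- (2 * m)) * f x + m ^+ 2))).
    apply: integrableDr => //; apply: integrableDr; first exact: integrableZr.
    exact: finite_measure_integrable_cst.
  by apply/funext => x; ring.
rewrite -[LHS]fineK; last exact: integrable_fin_num iV.
congr EFin; transitivity (\int[mu]_x (f x ^+ 2 + ((- (2 * m)) * f x + m ^+ 2))).
  by apply: eq_Rintegral => x _; ring.
rewrite RintegralD//; last first.
  by apply: integrableDr; [exact: integrableZr|exact: finite_measure_integrable_cst].
rewrite RintegralD//; [|exact: integrableZr|exact: finite_measure_integrable_cst].
rewrite RintegralZl// (@Rintegral_cst _ _ _ mu)//= (@probability_setT _ _ _ mu) mulr1 -/m.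
by ring.
Qed.

Lemma bounded_integrable (f : 'rV[R]_n -> R) (M : R) : measurable_fun setT f ->
  (forall x, `|f x| <= M) -> mu.-integrable setT (EFin \o f).
Proof.
move=> mf fM; apply: (integrable_dominated mf _ fM).
exact: finite_measure_integrable_cst.
Qed.

Lemma enorm_grad_sqr (f : 'rV[R]_n -> R) x :
  enorm (grad f x) ^+ 2 = \sum_i partial i f x ^+ 2.
Proof.
by rewrite enorm_sqr; apply: eq_bigr => i _; rewrite mxE expr2.
Qed.

Lemma measurable_grad_sqr (f : 'rV[R]_n -> R) : smooth_expr f ->
  measurable_fun setT (fun x => enorm (grad f x) ^+ 2).
Proof.
move=> sf; under eq_fun do rewrite enorm_grad_sqr; apply: measurable_sum => i.
apply: measurable_funX; apply: smooth_expr_measurable.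
exact: smooth_expr_partial.
Qed.

Lemma grad_sqr_le (f : 'rV[R]_n -> R) M x : (forall i, `|partial i f x| <= M) ->
  enorm (grad f x) ^+ 2 <= n%:R * M ^+ 2.
Proof.
move=> pM; rewrite enorm_grad_sqr mulr_natl -[X in _ *+ X]card_ord -sumr_const.
apply: ler_sum => i _; rewrite -(real_normK (num_real (partial i f x))).
by rewrite ler_sqr ?nnegrE// (le_trans _ (pM i)).
Qed.

Lemma compact_support_cutoff (f : 'rV[R]_n -> R) rho : 0 < rho ->
  (forall x, rho <= enorm x -> f x = 0) -> compact (closure [set x | f x != 0]).
Proof.
move=> r0 f0.
pose box : set 'rV[R]_n := [set x | forall i, `[- rho, rho]%classic (x ord0 i)].
have cbox : compact box.
  by apply: (@rV_compact R n (fun=> `[- rho, rho]%classic)) => _; exact: segment_compact.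
apply: (subclosed_compact _ cbox); first exact: closed_closure.
rewrite ((closure_id box).1 (compact_closed _ cbox)); last exact: norm_hausdorff.
apply: closure_subset => x fx i; rewrite /= in_itv/= -ler_norml.
move: fx => /= fx.
apply: le_trans (coord_le_enorm x i) _; rewrite leNgt; apply: contra fx => rx.
by rewrite f0// ltW.
Qed.

Hypothesis muP : (poincare_constant mu <= 1)%E.

Lemma poincare_bounded (f : 'rV[R]_n -> R) (M rho : R) : smooth_expr f -> 0 < rho ->
  (forall x, rho <= enorm x -> f x = 0) -> (forall x, `|f x| <= M) ->
  (forall x i, `|partial i f x| <= M) ->
  \int[mu]_x (f x ^+ 2) - (\int[mu]_x f x) ^+ 2 <= \int[mu]_x (enorm (grad f x) ^+ 2).
Proof.
move=> sf r0 f0 fM pM.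
have tf : test_function f.
  by split; [exact: smooth_expr_smooth|exact: compact_support_cutoff f0].
have mf := smooth_expr_measurable sf.
have i1 : mu.-integrable setT (EFin \o f) by exact: bounded_integrable fM.
have i2 : mu.-integrable setT (EFin \o (fun x => f x ^+ 2)).
  apply: (@bounded_integrable _ (M ^+ 2)); first exact: measurable_funX.
  by move=> x; rewrite normrX ler_sqr ?nnegrE// (le_trans _ (fM x)).
have ig : mu.-integrable setT (EFin \o (fun x => enorm (grad f x) ^+ 2)).
  apply: (@bounded_integrable _ (n%:R * M ^+ 2)); first exact: measurable_grad_sqr.
  by move=> x; rewrite ger0_norm ?sqr_ge0//; exact: grad_sqr_le.
set I := \int[mu]_x (enorm (grad f x) ^+ 2).
have I0 : 0 <= I by apply: Rintegral_ge0 => x _; exact: sqr_ge0.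
apply/ler_addgt0Pr => e e0.
(* The infimum is not assumed to be attained: some admissible C lies below 1 + e / (I + 1), and then
   C * I <= I + e. *)
have : (poincare_constant mu < (1 + e / (I + 1))%:E)%E.
  apply: le_lt_trans muP _; rewrite lte_fin ltrDl divr_gt0//.
  by rewrite ltr_wpDl.
move=> /ereal_inf_lt[_ [C [C0 CP] <-]]; rewrite lte_fin => Ce.
have := CP f tf; rewrite variance_integral//.
rewrite -[X in (_ <= _ * X)%E]fineK; last exact: integrable_fin_num ig.
rewrite -EFinM lee_fin -/I => /le_trans; apply.
apply: le_trans (ler_wpM2r I0 (ltW Ce)) _.
rewrite mulrDl mul1r lerD2l mulrAC ler_pdivrMr ?ltr_wpDl// ler_pM2l//.
by rewrite lerDl.
Qed.

End poincare_test_functions.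

Section poincare_lipschitz.
Context {R : realType} {n : nat}.
Variable mu : probability 'rV[R]_n R.
Hypothesis muP : (poincare_constant mu <= 1)%E.

Section truncation.
Variables (f : 'rV[R]_n -> R) (L : R).
Hypotheses (sf : smooth_expr f) (L0 : 0 <= L) (fL : elipschitz L f).

Let cut m x := cutoff m.+1%:R x * f x.

Lemma smooth_truncation m : smooth_expr (cut m).
Proof. by apply: smooth_mul => //; exact: smooth_cutoff. Qed.

Lemma truncation_le m x : `|cut m x| <= `|f x|.
Proof.
rewrite normrM (ger0_norm (cutoff_ge0 _ _)) ler_piMl//.
exact: cutoff_le1.
Qed.

Lemma truncation_outside m x : m.+1%:R <= enorm x -> cut m x = 0.
Proof. by move=> mx; rewrite /cut cutoff_outside ?mul0r. Qed.

Lemma truncation_bounded m x : `|cut m x| <= `|f 0| + L * m.+1%:R.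
Proof.
have [mx|xm] := leP m.+1%:R (enorm x).
  by rewrite truncation_outside// normr0 addr_ge0// mulr_ge0.
apply: le_trans (truncation_le m x) _; apply: le_trans (elipschitz_growth x fL) _.
by rewrite lerD2l ler_wpM2l// ltW.
Qed.

Lemma partial_truncation m x i : partial i (cut m) x =
  cutoff m.+1%:R x * partial i f x + f x * partial i (cutoff m.+1%:R) x.
Proof.
apply: partialM; apply: smooth_expr_differentiable => //; exact: smooth_cutoff.
Qed.

(** Product rule: the cutoff times the derivative of f is at most L, and f times the derivative of
    the cutoff is at most (|f 0| + L) rho times C / rho inside the ball of radius rho and 0 outside.
    The bound is therefore uniform in [m]. *)
Lemma partial_truncation_bounded :
  exists2 M, 0 <= M & forall m x i, `|partial i (cut m) x| <= M.
Proof.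
have [C C0 HC] := @cutoff_partial_le R n.
exists (L + (`|f 0| + L) * C); first by rewrite addr_ge0// mulr_ge0// addr_ge0.
move=> m x i; rewrite partial_truncation.
apply: le_trans (ler_normD _ _) _; apply: lerD.
  rewrite normrM (ger0_norm (cutoff_ge0 _ _)).
  apply: le_trans (partial_le x i fL sf); rewrite ler_piMl//; exact: cutoff_le1.
have [H1 H2] := HC m.+1%:R x i (ltr0Sn _ _).
have [mx|xm] := leP m.+1%:R (enorm x).
  by rewrite H2// mulr0 normr0 mulr_ge0// addr_ge0.
have N1 : 1 <= m.+1%:R :> R by rewrite ler1n.
have N0 : 0 < m.+1%:R :> R by [].
rewrite normrM; apply: (@le_trans _ _ (((`|f 0| + L) * m.+1%:R) * (C / m.+1%:R))).
  apply: ler_pM => //.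
    apply: le_trans (elipschitz_growth x fL) _; rewrite mulrDl; apply: lerD.
      by rewrite ler_peMr.
    by rewrite ler_wpM2l// ltW.
  apply: le_trans H1 _; rewrite -!mulrA ler_wpM2l//.
  rewrite ler_pdivrMr ?exprn_gt0// expr2 mulKf ?gt_eqF//.
  by rewrite (le_trans (coord_le_enorm x i))// ltW.
by rewrite mulrACA mulfV ?mulr1 ?gt_eqF.
Qed.

Lemma cvg_truncation x : cut m x @[m --> \oo] --> f x.
Proof.
rewrite -[X in _ --> X]mul1r; apply: cvgM; first exact: cvg_cutoff.
exact: cvg_cst.
Qed.

Lemma cvg_partial_truncation x i :
  partial i (cut m) x @[m --> \oo] --> partial i f x.
Proof.
have H : cutoff m.+1%:R x * partial i f x + f x * partial i (cutoff m.+1%:R) x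
    @[m --> \oo] --> 1 * partial i f x + f x * 0; last first.
  rewrite mul1r mulr0 addr0 in H.
  by under eq_fun do rewrite partial_truncation; exact: H.
apply: cvgD.
  by apply: cvgM; [exact: cvg_cutoff|exact: cvg_cst].
apply: cvgMr.
have [C C0 HC] := @cutoff_partial_le R n.
apply: norm_cvg0.
apply: (@squeeze_cvgr _ _ _ _ (cst 0) (fun m => C * `|x ord0 i| * harmonic m)).
- apply: nearW => m; rewrite normr_ge0/=.
  have [H _] := HC m.+1%:R x i (ltr0Sn _ _).
  apply: le_trans H _; rewrite ler_wpM2l ?mulr_ge0//.
  rewrite lef_pV2 ?posrE ?exprn_gt0// expr2 ler_peMr//.
  by rewrite ler1n.
- exact: cvg_cst.
- by rewrite -[X in _ --> X](mulr0 (C * `|x ord0 i|)); apply: cvgMr; exact: cvg_harmonic.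
Qed.

Lemma truncation_poincare m :
  \int[mu]_x (cut m x ^+ 2) - (\int[mu]_x cut m x) ^+ 2 <=
  \int[mu]_x (enorm (grad (cut m) x) ^+ 2).
Proof.
have [M M0 HM] := partial_truncation_bounded.
apply: (@poincare_bounded _ _ _ muP _ (M + (`|f 0| + L * m.+1%:R)) m.+1%:R) => //.
- exact: smooth_truncation.
- by move=> x; exact: truncation_outside.
- by move=> x; apply: le_trans (truncation_bounded m x) _; rewrite lerDr.
- move=> x i; apply: le_trans (HM m x i) _; rewrite lerDl.
  by rewrite addr_ge0// mulr_ge0.
Qed.

(* On a set of mass at least 1/2 where |f| <= r the mean m of the truncation
   satisfies m^2 <= 2 r^2 + 2 (cut - m)^2, which bounds m by the variance. *)
Lemma truncation_second_moment :
  exists B, forall m, \int[mu]_x (cut m x ^+ 2) <= B.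
Proof.
have [M M0 HM] := partial_truncation_bounded.
have [r r0 Hr] : exists2 r, 0 <= r & 1 / 2 <= fine (mu [set x | enorm x <= r]).
  have mA (j : nat) : measurable [set x : 'rV[R]_n | enorm x <= j%:R].
    rewrite (_ : [set x | _] = (@enorm R n) @^-1` `]-oo, j%:R]%classic).
      rewrite -[X in measurable X]setTI; apply: measurable_enorm => //.
    by apply/seteqP; split=> x /=; rewrite in_itv.
  pose F (j : nat) := [set x : 'rV[R]_n | enorm x <= j%:R].
  have FT : \bigcup_j F j = setT.
    apply/seteqP; split=> // x _; exists (Num.truncn (enorm x)).+1 => //=.
    by rewrite /F/= ltW// truncnS_gt.
  have : mu (F j) @[j --> \oo] --> 1%E.
    rewrite -(@probability_setT _ _ _ mu) -FT; apply: nondecreasing_cvg_mu => //.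
      by rewrite FT.
    move=> j1 j2 j12; apply/subsetPset => x /= /le_trans; apply.
    by rewrite ler_nat.
  move=> /fine_cvgP[_] /cvgr_ge /(_ (1/2)) => H.
  have /H[j _ /(_ j (leqnn j)) Hj] : (1 / 2 : R) < 1 by lra.
  by exists j%:R.
set A := [set x | enorm x <= r] in Hr.
have mA : measurable A.
  rewrite (_ : A = (@enorm R n) @^-1` `]-oo, r]%classic).
    by rewrite -[X in measurable X]setTI; apply: measurable_enorm.
  by apply/seteqP; split=> x /=; rewrite in_itv.
pose K := `|f 0| + L * r; pose V := n%:R * M ^+ 2.
(* With mass at least 1/2, [key] gives c^2 <= 4 K^2 + 4 Var, and the second moment is Var + c^2 with
   Var <= V. *)
exists (4 * K ^+ 2 + 5 * V) => m.
set g := cut m; have sg : smooth_expr g by exact: smooth_truncation.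
have mg := smooth_expr_measurable sg.
have gb x := truncation_bounded m x.
have ig : mu.-integrable setT (EFin \o g) by exact: bounded_integrable gb.
have ig2 : mu.-integrable setT (EFin \o (fun x => g x ^+ 2)).
  apply: (@bounded_integrable _ _ _ _ ((`|f 0| + L * m.+1%:R) ^+ 2)).
    exact: measurable_funX.
  by move=> x; rewrite normrX ler_sqr ?nnegrE// (le_trans _ (gb x)).
have iV : mu.-integrable setT (EFin \o (fun x => enorm (grad g x) ^+ 2)).
  apply: (@bounded_integrable _ _ _ _ V); first exact: measurable_grad_sqr.
  by move=> x; rewrite ger0_norm ?sqr_ge0//; apply: grad_sqr_le => i; exact: HM.
have ic c : mu.-integrable setT (EFin \o cst c) by exact: finite_measure_integrable_cst.
have VV : \int[mu]_x (g x ^+ 2) - (\int[mu]_x g x) ^+ 2 <= V.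
  apply: le_trans (truncation_poincare m) _.
  rewrite -[leRHS]mulr1 -[X in _ <= _ * X]/(fine 1%E) -(@probability_setT _ _ _ mu).
  rewrite -(@Rintegral_cst _ _ _ mu)//; apply: le_Rintegral => //; first exact: ic.
  by move=> x _; apply: grad_sqr_le => i; exact: HM.
set c := \int[mu]_x g x in VV *.
have key : c ^+ 2 * fine (mu A) <= 2 * K ^+ 2 +
    2 * (\int[mu]_x (g x ^+ 2) - c ^+ 2).
  have VE : \int[mu]_x ((g x - c) ^+ 2) = \int[mu]_x (g x ^+ 2) - c ^+ 2.
    by have := variance_integral ig ig2; rewrite varianceEint => /(congr1 fine).
  have igc : mu.-integrable setT (EFin \o (fun x => (g x - c) ^+ 2)).
    apply: (@bounded_integrable _ _ _ _ ((`|f 0| + L * m.+1%:R + `|c|) ^+ 2)).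
      by apply: measurable_funX; exact: measurable_funB.
    move=> x; rewrite normrX ler_sqr ?nnegrE ?addr_ge0 ?mulr_ge0//.
    by apply: le_trans (ler_normB _ _) _; rewrite lerD2r.
  have iA : mu.-integrable setT (EFin \o \1_A) by exact: integrable_indic.
  have -> : c ^+ 2 * fine (mu A) = \int[mu]_x (c ^+ 2 * \1_A x).
    by rewrite RintegralZl//; congr (_ * _); rewrite /Rintegral integral_indic// setIT.
  rewrite -VE.
  have -> : 2 * K ^+ 2 + 2 * \int[mu]_x ((g x - c) ^+ 2) =
      \int[mu]_x (2 * K ^+ 2 + 2 * (g x - c) ^+ 2).
    rewrite RintegralD//; [|exact: ic|exact: integrableZr].
    by rewrite RintegralZl// (@Rintegral_cst _ _ _ mu)//= (@probability_setT _ _ _ mu) mulr1.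
  apply: le_Rintegral => //; first exact: integrableZr.
    by apply: integrableDr; [exact: ic|exact: integrableZr].
  move=> x _; rewrite indicE; case: (boolP (x \in A)) => [/set_mem xA|_].
    have gK : g x ^+ 2 <= K ^+ 2.
      rewrite -(real_normK (num_real (g x))) ler_sqr ?nnegrE ?addr_ge0 ?mulr_ge0//.
      apply: le_trans (truncation_le m x) _.
      by apply: le_trans (elipschitz_growth x fL) _; rewrite lerD2l ler_wpM2l.
    (* The inequality c^2 <= 2 g^2 + 2 (g - c)^2 is (2 g - c)^2 >= 0. *)
    by rewrite mulr1; have := sqr_ge0 (2 * g x - c); lra.
  by rewrite mulr0 addr_ge0// mulr_ge0// sqr_ge0.
have c2 := sqr_ge0 c.
have : c ^+ 2 * (1 / 2) <= c ^+ 2 * fine (mu A) by rewrite ler_wpM2l.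
move: key VV; move: (c ^+ 2) (K ^+ 2) (Rintegral _ _ _) (c ^+ 2 * fine (mu A)).
move=> u1 u2 u3 u4; lra.
Qed.

End truncation.

(** Fatou along the truncations of the coordinate, whose second moments are uniformly bounded by
    [truncation_second_moment]. *)
Lemma integrable_coord_sqr i : mu.-integrable setT (EFin \o (fun x => x ord0 i ^+ 2)).
Proof.
pose f (x : 'rV[R]_n) : R := x ord0 i.
have sf : smooth_expr f by exact: smooth_coord.
have fL : elipschitz 1 f.
  move=> x y; rewrite mul1r (_ : f x - f y = (x - y) ord0 i) ?coord_le_enorm//.
  by rewrite !mxE.
have [B HB] := truncation_second_moment sf ler01 fL.
have mf2 : measurable_fun setT (fun x => f x ^+ 2).
  by apply: measurable_funX; exact: smooth_expr_measurable.
apply/integrableP; split; first exact/measurable_EFinP.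
apply: (@le_lt_trans _ _ B%:E); last exact: ltry.
pose g m x : \bar R := ((cutoff m.+1%:R x * f x) ^+ 2)%:E.
have mg m : measurable_fun setT (g m).
  apply/measurable_EFinP; apply: measurable_funX; apply: smooth_expr_measurable.
  exact: smooth_truncation.
have g0 m x : (0 <= g m x)%E by rewrite lee_fin sqr_ge0.
have Hg x : g m x @[m --> \oo] --> (f x ^+ 2)%:E.
  have H2 : (cutoff m.+1%:R x * f x) ^+ 2 @[m --> \oo] --> f x ^+ 2.
    have H1 := @cvg_truncation f x.
    exact: (cvgM H1 H1).
  by apply/cvg_EFin; [exact: nearW|exact: H2].
have := fatou mu measurableT mg (fun m x _ => g0 m x).
rewrite (eq_integral (fun x => `|(f x ^+ 2)%:E|)%E); last first.
  move=> x _; rewrite is_cvg_limn_einfE; last by apply/cvg_ex; eexists; exact: Hg.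
  by rewrite (cvg_lim _ (Hg x))// gee0_abs// lee_fin sqr_ge0.
move=> /le_trans; apply.
rewrite limn_einf_lim; apply: lime_le; first exact: is_cvg_einfs.
apply: nearW => m; apply: (@le_trans _ _ (\int[mu]_x g m x)%E).
  by apply: ereal_inf_lbound; exists m => /=.
rewrite -[leLHS]fineK ?lee_fin; first exact: HB.
apply: (@integrable_fin_num _ _ _ mu) => //.
apply: (@bounded_integrable _ _ mu (fun x => (cutoff m.+1%:R x * f x) ^+ 2)
  ((`|f 0| + 1 * m.+1%:R) ^+ 2)).
  apply: measurable_funX; apply: smooth_expr_measurable.
  exact: smooth_truncation.
move=> x; rewrite normrX ler_sqr ?nnegrE ?addr_ge0 ?mulr_ge0//.
exact: truncation_bounded.
Qed.

End poincare_lipschitz.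

(** * From almost maximal variance to an approximate Stein identity *)

Section stein_inequality.
Context {R : realType} {n : nat}.
Variable mu : probability 'rV[R]_n R.
Hypothesis muP : (poincare_constant mu <= 1)%E.

Lemma integrable_quadratic (f : 'rV[R]_n -> R) C : measurable_fun setT f ->
  (forall x, `|f x| <= C * (1 + dotp x x)) -> mu.-integrable setT (EFin \o f).
Proof.
move=> mf fC; apply: (integrable_dominated mf (integrableZr C _) fC).
apply: (@integrableDr _ _ _ _ (cst 1)).
  exact: finite_measure_integrable_cst.
apply: integrable_sumr => i; exact: integrable_coord_sqr.
Qed.

Lemma lip_sqr_le L (f : 'rV[R]_n -> R) x : 0 <= L -> elipschitz L f ->
  f x ^+ 2 <= 2 * (`|f 0| + L) ^+ 2 * (1 + dotp x x).
Proof.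
move=> L0 fL; have := elipschitz_growth x fL; rewrite -enorm_sqr.
rewrite -(real_normK (num_real (f x))).
have := normr_ge0 (f x); have := normr_ge0 (f 0); have := enorm_ge0 x.
move: (enorm x) `|f 0| `|f x| => a b c a0 b0 c0 h.
have h1 : c <= (b + L) * (1 + a) by nra.
have h2 : c * c <= ((b + L) * (1 + a)) * ((b + L) * (1 + a)) by exact: ler_pM.
have h3 : (1 + a) * (1 + a) <= 2 * (1 + a ^+ 2) by have := sqr_ge0 (1 - a); lra.
have h4 := ler_wpM2l (sqr_ge0 (b + L)) h3.
by rewrite expr2; lra.
Qed.

Lemma lip_mul_le L L' (f g : 'rV[R]_n -> R) x : 0 <= L -> 0 <= L' ->
  elipschitz L f -> elipschitz L' g ->
  `|f x * g x| <= ((`|f 0| + L) ^+ 2 + (`|g 0| + L') ^+ 2) * (1 + dotp x x).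
Proof.
move=> L0 L'0 fL gL; have hf := lip_sqr_le x L0 fL; have hg := lip_sqr_le x L'0 gL.
rewrite normrM; move: hf hg.
rewrite -(real_normK (num_real (f x))) -(real_normK (num_real (g x))).
by have := sqr_ge0 (`|f x| - `|g x|); lra.
Qed.

Lemma lip_integrable L (f : 'rV[R]_n -> R) : 0 <= L -> smooth_expr f ->
  elipschitz L f -> mu.-integrable setT (EFin \o f).
Proof.
move=> L0 sf fL; have c1 : elipschitz 0 (fun _ : 'rV[R]_n => 1 : R).
  by move=> x y; rewrite subrr normr0 mulr_ge0 ?enorm_ge0.
apply: (integrable_quadratic (smooth_expr_measurable sf)) => x.
by rewrite -[f x]mulr1; exact: lip_mul_le fL c1.
Qed.

Lemma lip_mul_integrable L L' (f g : 'rV[R]_n -> R) : 0 <= L -> 0 <= L' ->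
  smooth_expr f -> smooth_expr g -> elipschitz L f -> elipschitz L' g ->
  mu.-integrable setT (EFin \o (fun x => f x * g x)).
Proof.
move=> L0 L'0 sf sg fL gL.
apply: (integrable_quadratic (smooth_expr_measurable (smooth_mul sf sg))) => x.
exact: lip_mul_le fL gL.
Qed.

Lemma grad_sqr_integrable L (f : 'rV[R]_n -> R) : 0 <= L -> smooth_expr f ->
  elipschitz L f -> mu.-integrable setT (EFin \o (fun x => enorm (grad f x) ^+ 2)).
Proof.
move=> L0 sf fL; apply: (@bounded_integrable _ _ _ _ (L ^+ 2)).
  exact: measurable_grad_sqr.
move=> x; rewrite ger0_norm ?sqr_ge0// ler_sqr ?nnegrE ?enorm_ge0//.
by apply: enorm_grad_le => //; exact: smooth_expr_differentiable.
Qed.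

(** Limit of [truncation_poincare]: |f| and f^2 dominate the terms of the variance, and
    [partial_truncation_bounded] dominates the gradient term. *)
Lemma poincare_lipschitz (f : 'rV[R]_n -> R) L : smooth_expr f -> 0 <= L ->
  elipschitz L f ->
  \int[mu]_x (f x ^+ 2) - (\int[mu]_x f x) ^+ 2 <= \int[mu]_x (enorm (grad f x) ^+ 2).
Proof.
move=> sf L0 fL.
pose cut m x := cutoff m.+1%:R x * f x.
have scut m : smooth_expr (cut m) by exact: smooth_truncation.
have mcut m := smooth_expr_measurable (scut m).
have [M M0 HM] := partial_truncation_bounded sf L0 fL.
have c1 : \int[mu]_x cut m x @[m --> \oo] --> \int[mu]_x f x.
  apply: (@Rdominated_cvg _ _ _ _ _ _ (fun x => `|f x|)) => //.
  - by move=> x; exact: cvg_truncation.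
  - by apply: integrable_norm => //; exact: lip_integrable fL.
  - by move=> m x; exact: truncation_le.
have c2 : \int[mu]_x (cut m x ^+ 2) @[m --> \oo] --> \int[mu]_x (f x ^+ 2).
  apply: (@Rdominated_cvg _ _ _ _ _ _ (fun x => f x ^+ 2)) => //.
  - by move=> m; exact: measurable_funX.
  - move=> x; have H1 := @cvg_truncation _ _ f x; exact: (cvgM H1 H1).
  - exact: (lip_mul_integrable L0 L0 sf sf fL fL).
  - move=> m x; rewrite normrX -(real_normK (num_real (f x))) ler_sqr ?nnegrE//.
    exact: truncation_le.
have c3 : \int[mu]_x (enorm (grad (cut m) x) ^+ 2) @[m --> \oo] -->
    \int[mu]_x (enorm (grad f x) ^+ 2).
  apply: (@Rdominated_cvg _ _ _ _ _ _ (cst (n%:R * M ^+ 2))).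
  - by move=> m; exact: measurable_grad_sqr.
  - move=> x; rewrite enorm_grad_sqr; under eq_fun do rewrite enorm_grad_sqr.
    apply: cvg_big => [|i _]; first exact: add_continuous.
    have H := @cvg_partial_truncation _ _ f sf x i; exact: (cvgM H H).
  - exact: finite_measure_integrable_cst.
  - move=> m x; rewrite ger0_norm ?sqr_ge0//; apply: grad_sqr_le => i; exact: HM.
have c4 : \int[mu]_x (cut m x ^+ 2) - (\int[mu]_x cut m x) ^+ 2 @[m --> \oo] -->
    \int[mu]_x (f x ^+ 2) - (\int[mu]_x f x) ^+ 2.
  by apply: cvgB => //; exact: (cvgM c1 c1).
apply: ler_cvg_to c4 c3 _; apply: nearW => m.
exact: truncation_poincare fL m.
Qed.

Lemma derive_dotp v w (x : 'rV[R]_n) : 'D_v (fun y : 'rV[R]_n => dotp y w) x = dotp v w.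
Proof.
have dc j : derivable (fun y : 'rV[R]_n => y ord0 j) x v.
  by apply: diff_derivable; exact: differentiable_coord.
rewrite (_ : (fun y => dotp y w) =
  \sum_(j < n) (fun y : 'rV[R]_n => y ord0 j * w ord0 j)); last first.
  by apply/funext => y; rewrite fct_sumE.
rewrite derive_sum => [|j]; last by apply: derivableM; [exact: dc|exact: derivable_cst].
apply: eq_bigr => j _.
rewrite [LHS](deriveM (dc j) (derivable_cst (w ord0 j) x v)) derive_cst derive_coord.
by rewrite scaler0 add0r mulrC.
Qed.

Lemma elipschitz_dotp v : enorm v = 1 -> elipschitz 1 (fun x : 'rV[R]_n => dotp x v).
Proof.
move=> v1 x y; rewrite mul1r -dotpBl; apply: le_trans (norm_dotp_le _ _) _.
by rewrite v1 mulr1.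
Qed.

(** Write X = x.v and let A be the quantity inside the absolute value. The Poincare inequality for X
    + A f reads Var X + 2 A Cov(X, f) + A^2 Var f <= 1 + 2 A E[D_v f] + A^2 E|grad f|^2. Since
    Cov(X, f) - E[D_v f] = A, Var f >= 0 and |grad f| <= 1, it follows that A^2 <= 1 - Var X <= 1 -
    1 / (1 + eps) <= eps. *)
Lemma stein_ineq (v : 'rV[R]_n) (eps : R) (f : 'rV[R]_n -> R) :
  0 <= eps -> enorm v = 1 ->
  ((1 + eps)^-1%:E <= 'V_mu[fun x => dotp x v])%E ->
  smooth_expr f -> elipschitz 1 f ->
  `|\int[mu]_x ((dotp x v - \int[mu]_y dotp y v) * f x) - \int[mu]_x 'D_v f x|
    <= Num.sqrt eps.
Proof.
move=> eps0 v1 varv sf fL.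
set m := \int[mu]_y dotp y v.
have sX := @smooth_dotp R n v; have XL := elipschitz_dotp v1.
have iX := lip_integrable ler01 sX XL.
have iX2 := lip_mul_integrable ler01 ler01 sX sX XL XL.
have if1 := lip_integrable ler01 sf fL.
have iXf := lip_mul_integrable ler01 ler01 sX sf XL fL.
have if2 := lip_mul_integrable ler01 ler01 sf sf fL fL.
have ig := grad_sqr_integrable ler01 sf fL.
have df x := smooth_expr_differentiable x sf.
have ic c : mu.-integrable setT (EFin \o cst c) by exact: finite_measure_integrable_cst.
have DE x : 'D_v f x = dotp (grad f x) v by exact: derive_dotp_grad.
have iD : mu.-integrable setT (EFin \o (fun x => 'D_v f x)).
  apply: (@bounded_integrable _ _ _ _ 1).
    rewrite (_ : (fun x => 'D_v f x) = fun x => \sum_i partial i f x * v ord0 i).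
      apply: measurable_sum => i; apply: measurable_funM => //.
      by apply: smooth_expr_measurable; exact: smooth_expr_partial.
    by apply/funext => x; rewrite DE; apply: eq_bigr => i _; rewrite mxE.
  by move=> x; have := elipschitz_derive v fL (df x); rewrite v1 mulr1.
have -> : \int[mu]_x ((dotp x v - m) * f x) =
    \int[mu]_x (dotp x v * f x) - m * \int[mu]_x f x.
  rewrite -RintegralZl// -RintegralB//; last exact: integrableZr.
  by apply: eq_Rintegral => x _; rewrite mulrBl.
set A := _ - _ - _.
suff A2 : A ^+ 2 <= eps.
  by rewrite -sqrtr_sqr ler_sqrt.
pose F x := dotp x v + A * f x.
have sF : smooth_expr F by apply: smooth_add => //; exact: smooth_scale.
have FL : elipschitz (1 + `|A|) F.
  move=> x y; rewrite (_ : F x - F y = (dotp x v - dotp y v) + A * (f x - f y)).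
    apply: le_trans (ler_normD _ _) _; rewrite [leRHS]mulrDl; apply: lerD.
      exact: XL.
    by rewrite normrM ler_wpM2l//; have := fL x y; rewrite mul1r.
  by rewrite /F; ring.
have gF x : enorm (grad F x) ^+ 2 = 1 + (2 * A * 'D_v f x + A ^+ 2 * enorm (grad f x) ^+ 2).
  have -> : grad F x = v + A *: grad f x.
    apply/rowP => i; rewrite !mxE {1}/F partialD.
    - rewrite {1}/partial derive_dotp {1}/partial; congr (_ + _).
        rewrite /dotp (bigD1 i)//= big1 => [|j ji].
          by rewrite mxE !eqxx mul1r addr0.
        by rewrite mxE (negbTE ji) andbF mul0r.
      have dv : derivable f x (delta_mx ord0 i) by exact: diff_derivable.
      exact: (deriveZ A dv).
    - exact: smooth_expr_differentiable.
    - by apply: smooth_expr_differentiable; exact: smooth_scale.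
  rewrite enorm_sqr !(dotpDl, dotpDr, dotpZl, dotpZr) -enorm_sqr v1 DE.
  by rewrite (dotpC v) enorm_sqr; ring.
have := poincare_lipschitz sF (addr_ge0 ler01 (normr_ge0 A)) FL.
have iAf := integrableZr A if1.
have j1 := integrableZr (2 * A) iXf; have j2 := integrableZr (A ^+ 2) if2.
have k1 := integrableZr (2 * A) iD; have k2 := integrableZr (A ^+ 2) ig.
have j12 := integrableDr j1 j2; have k12 := integrableDr k1 k2.
have -> : \int[mu]_x F x = m + A * \int[mu]_x f x.
  by rewrite -RintegralZl// -RintegralD.
have -> : \int[mu]_x (F x ^+ 2) = \int[mu]_x (dotp x v * dotp x v) +
    (2 * A * \int[mu]_x (dotp x v * f x) + A ^+ 2 * \int[mu]_x (f x * f x)).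
  rewrite -(RintegralZl (2 * A) measurableT iXf).
  rewrite -(RintegralZl (A ^+ 2) measurableT if2).
  rewrite -(RintegralD measurableT j1 j2) -(RintegralD measurableT iX2 j12).
  by apply: eq_Rintegral => x _; rewrite /F; ring.
have -> : \int[mu]_x (enorm (grad F x) ^+ 2) = 1 + (2 * A * \int[mu]_x 'D_v f x +
    A ^+ 2 * \int[mu]_x (enorm (grad f x) ^+ 2)).
  rewrite -(RintegralZl (2 * A) measurableT iD).
  rewrite -(RintegralZl (A ^+ 2) measurableT ig) -(RintegralD measurableT k1 k2).
  transitivity (\int[mu]_x (1 + (2 * A * 'D_v f x + A ^+ 2 * enorm (grad f x) ^+ 2))).
    by apply: eq_Rintegral => x _; exact: gF.
  rewrite (RintegralD measurableT (ic 1) k12).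
  by rewrite (@Rintegral_cst _ _ _ mu)//= (@probability_setT _ _ _ mu) mulr1.
have g1 : \int[mu]_x (enorm (grad f x) ^+ 2) <= 1.
  rewrite -[leRHS]mulr1 -[X in _ <= _ * X]/(fine 1%E) -(@probability_setT _ _ _ mu).
  rewrite -(@Rintegral_cst _ _ _ mu)//; apply: le_Rintegral => //; first exact: ic.
  move=> x _; rewrite -(expr1n _ 2) ler_sqr ?nnegrE ?enorm_ge0//.
  exact: enorm_grad_le.
have varf : 0 <= \int[mu]_x (f x * f x) - (\int[mu]_x f x) ^+ 2.
  rewrite -lee_fin -(variance_integral if1 if2) varianceEint.
  by apply: integral_ge0 => x _; rewrite lee_fin sqr_ge0.
have varX : (1 + eps)^-1 <= \int[mu]_x (dotp x v * dotp x v) - m ^+ 2.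
  by rewrite -lee_fin -(variance_integral iX iX2).
have e1 : 1 - (1 + eps)^-1 <= eps.
  have e1 : 0 < 1 + eps by rewrite ltr_wpDr.
  rewrite lerBlDr -(ler_pM2r e1) mulrDl mulVf ?gt_eqF//; nra.
have := ler_wpM2l (sqr_ge0 A) g1; have := mulr_ge0 (sqr_ge0 A) varf.
(* The definition of [A] multiplied by [A] turns the cross terms into A^2. *)
have AE : A * A = A * (\int[mu]_x (dotp x v * f x) - m * \int[mu]_x f x -
  \int[mu]_x 'D_v f x) by [].
move: varX e1 AE.
move: (\int[mu]_x (dotp x v * dotp x v)) (\int[mu]_x (dotp x v * f x))
  (\int[mu]_x f x) (\int[mu]_x (f x * f x)) (\int[mu]_x 'D_v f x)
  (\int[mu]_x (enorm (grad f x) ^+ 2)) => a b c d e g.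
lra.
Qed.

End stein_inequality.

(** * Interpolation between the measure and its Gaussian counterpart *)

Section product_distribution.
Context (d1 d2 d1' d2' : measure_display) {T1 : measurableType d1}
  {T2 : measurableType d2}.
Context {T1' : measurableType d1'} {T2' : measurableType d2'} {R : realType}.
Variables (P1 : probability T1 R) (P2 : probability T2 R).
Variables (X : {mfun T1 >-> T1'}) (Y : {mfun T2 >-> T2'}).

Definition prod_map (z : T1 * T2) : T1' * T2' := (X z.1, Y z.2).

Lemma measurable_prod_map : measurable_fun setT prod_map.
Proof.
apply/measurable_fun_pairP; split.
  exact: (measurableT_comp (measurable_funPT X)).
exact: (measurableT_comp (measurable_funPT Y)).
Qed.

HB.instance Definition _ :=
  isMeasurableFun.Build _ _ _ _ prod_map measurable_prod_map.

(** Both sides agree on measurable rectangles, which determine a product measure. *)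
Lemma prod_distribution A : measurable A ->
  ((distribution P1 X \x distribution P2 Y) A =
   distribution (P1 \x P2) prod_map A)%E.
Proof.
apply: product_measure_unique => B C mB mC; rewrite /distribution /pushforward.
have mX : measurable (X @^-1` B) by rewrite -[_ @^-1` _]setTI; exact: measurable_funPT.
have mY : measurable (Y @^-1` C) by rewrite -[_ @^-1` _]setTI; exact: measurable_funPT.
exact: (product_measure1E P1 P2 mX mY).
Qed.

End product_distribution.

Section interpolation.
Context {R : realType} {n k : nat}.
Variables (mu : probability 'rV[R]_n R) (eps : R) (e : 'I_k -> 'rV[R]_n).
Hypotheses (muP : (poincare_constant mu <= 1)%E) (eps0 : 0 <= eps).
Hypothesis oe : orthonormal_family e.
Hypothesis vare : forall i : 'I_k,
  ((1 + eps)^-1%:E <= 'V_mu[fun x => dotp x (e i)])%E.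

Definition mean_coord i := \int[mu]_x dotp x (e i).
(** The barycenter [p] of the theorem: the projection of the mean of [mu] on the span. *)
Definition mean_proj : 'rV[R]_n := \sum_i mean_coord i *: e i.
Local Notation m := mean_coord.
Local Notation p := mean_proj.

Definition comb (c : 'I_k -> R) : 'rV[R]_n := \sum_i c i *: e i.

Lemma dotp_combr c w : dotp w (comb c) = \sum_i c i * dotp w (e i).
Proof. by rewrite dotp_sumr; apply: eq_bigr => i _; rewrite dotpZr. Qed.

Lemma dotp_comb_basis c i : dotp (comb c) (e i) = c i.
Proof.
rewrite dotp_suml (bigD1 i)//= big1 => [|j ji]; rewrite dotpZl oe.
  by rewrite eqxx mulr1 addr0.
by rewrite (negbTE ji) mulr0.
Qed.

Lemma dotp_comb c d : dotp (comb c) (comb d) = \sum_i c i * d i.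
Proof.
by rewrite dotp_combr; apply: eq_bigr => i _; rewrite dotp_comb_basis mulrC.
Qed.

Lemma combB c d : comb c - comb d = comb (fun i => c i - d i).
Proof. by rewrite -sumrB; apply: eq_bigr => i _; rewrite scalerBl. Qed.

Lemma enorm_basis i : enorm (e i) = 1.
Proof. by rewrite /enorm oe eqxx sqrtr1. Qed.

Definition dev (x : 'rV[R]_n) i := dotp x (e i) - m i.

Definition interp (t : R) (z : 'rV[R]_k * 'rV[R]_n) : 'rV[R]_n :=
  (orth_proj e z.2 + p) + (cos t *: comb (dev z.2) + sin t *: comb (fun i => z.1 ord0 i)).

Lemma interp0 g x : interp 0 (g, x) = x.
Proof.
rewrite /interp cos0 sin0 scale1r scale0r addr0 /orth_proj /mean_proj -addrA.
rewrite (_ : _ + comb _ = \sum_i dotp x (e i) *: e i) ?subrK//.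
by rewrite -big_split; apply: eq_bigr => i _ /=; rewrite -scalerDl addrC subrK.
Qed.

Lemma interp_pi2 g x : interp (pi / 2) (g, x) = affine_map e p g + orth_proj e x.
Proof.
by rewrite /interp cos_pihalf sin_pihalf scale0r add0r scale1r -addrA addrC.
Qed.

(** The difference is w + (cos t - 1) P w, with P the projection on the span; its squared norm is
    |w|^2 - (1 - cos^2 t) |P w|^2. Hence x |-> h (interp t (g, x)) is again 1-Lipschitz and
    [stein_ineq] applies to it. *)
Lemma interp_lip_x t g x y : enorm (interp t (g, x) - interp t (g, y)) <= enorm (x - y).
Proof.
pose d i := dotp (x - y) (e i).
have -> : interp t (g, x) - interp t (g, y) = (x - y) + (cos t - 1) *: comb d.
  rewrite /interp /orth_proj /= -/(comb (fun i => dotp x (e i)))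
    -/(comb (fun i => dotp y (e i))).
  have -> : comb d = comb (fun i => dotp x (e i)) - comb (fun i => dotp y (e i)).
    by rewrite combB; congr comb; apply/funext => i; rewrite -dotpBl.
  have devE z : comb (dev z) = comb (fun i => dotp z (e i)) - comb m by rewrite combB.
  rewrite !devE; apply/rowP => j; rewrite !mxE.
  by ring.
rewrite ler_sqrt ?dotpp_ge0//.
move: (x - y) @d => w d; rewrite !(dotpDl, dotpDr, dotpZl, dotpZr).
rewrite (dotpC (comb d)) dotp_combr dotp_comb -/(d _).
have d0 : 0 <= \sum_i d i * d i by apply: sumr_ge0 => i _; rewrite -expr2 sqr_ge0.
have := cos_le1 t; have := cos_geN1 t.
move: (\sum_i d i * d i) d0 (cos t) (dotp w w) => S S0 c q h1 h2.
have : 0 <= (1 - c) * (1 + c) * S by rewrite !mulr_ge0//; lra.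
lra.
Qed.

Lemma interp_lip_g t g h x : enorm (interp t (g, x) - interp t (h, x)) <= enorm (g - h).
Proof.
have -> : interp t (g, x) - interp t (h, x) = sin t *: comb (fun i => (g - h) ord0 i).
  rewrite (_ : comb _ = comb (fun i => g ord0 i) - comb (fun i => h ord0 i)).
    by rewrite /interp /=; apply/rowP => j; rewrite !mxE; ring.
  by rewrite combB; congr comb; apply/funext => i; rewrite !mxE.
rewrite enormZ -[leRHS]mul1r; apply: ler_pM; rewrite ?enorm_ge0 ?normr_ge0//.
  by rewrite ler_norml sin_geN1 sin_le1.
by rewrite /enorm dotp_comb.
Qed.

(** Differentiated in [s], this produces the factor [cos t] between derivatives in x and derivatives
    of the test function; [interp_shift_g] produces [sin t] in the same way. *)
Lemma interp_shift_x t g x i s :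
  interp t (g, s *: e i + x) = s *: (cos t *: e i) + interp t (g, x).
Proof.
rewrite /interp /orth_proj /= -/(comb (fun i => dotp x (e i)))
  -/(comb (fun j => dotp (s *: e i + x) (e j))).
have devE z : comb (dev z) = comb (fun i => dotp z (e i)) - comb m by rewrite combB.
rewrite !devE.
have -> : comb (fun j => dotp (s *: e i + x) (e j)) =
    s *: e i + comb (fun j => dotp x (e j)).
  rewrite /comb; under eq_bigr do rewrite dotpDl dotpZl oe scalerDl.
  rewrite big_split/=; congr (_ + _); rewrite (bigD1 i)//= big1 => [|j ji].
    by rewrite eqxx mulr1 addr0.
  by rewrite eq_sym (negbTE ji) mulr0 scale0r.
by apply/rowP => j; rewrite !mxE; ring.
Qed.

Lemma interp_shift_g t g x i s :
  interp t (s *: delta_mx ord0 i + g, x) = s *: (sin t *: e i) + interp t (g, x).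
Proof.
rewrite /interp /=.
have -> : comb (fun j => (s *: delta_mx ord0 i + g) ord0 j) =
    s *: e i + comb (fun j => g ord0 j).
  rewrite /comb; under eq_bigr do rewrite !mxE scalerDl.
  rewrite big_split/=; congr (_ + _); rewrite (bigD1 i)//= big1 => [|j ji].
    by rewrite eqxx mulr1 addr0.
  by rewrite (negbTE ji) mulr0 scale0r.
by apply/rowP => j; rewrite !mxE; ring.
Qed.

Lemma is_derive_interp (t : R) z : is_derive t 1 (interp^~ z)
  (comb (fun i => - sin t * dev z.2 i + cos t * z.1 ord0 i)).
Proof.
have H := is_deriveD (is_derive_cst (orth_proj e z.2 + p) t (1 : R))
  (is_deriveD (is_deriveZv (comb (dev z.2)) (is_derive_cos t))
     (is_deriveZv (comb (fun i => z.1 ord0 i)) (is_derive_sin t))).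
apply: is_derive_eq H _; rewrite add0r /comb !scaler_sumr -big_split.
by apply: eq_bigr => i _ /=; rewrite !scalerA -scalerDl.
Qed.

Local Notation gam := (std_gaussian k).

(** A factored dominating function, integrable jointly and along every section; the squares rely on
    the second moments of both factors. *)
Let weight (z : 'rV[R]_k * 'rV[R]_n) : R := (1 + enorm z.1) ^+ 2 * (1 + enorm z.2) ^+ 2.

Let weight_le q (x : 'rV[R]_q) : (1 + enorm x) ^+ 2 <= 2 * (1 + dotp x x).
Proof. by rewrite -enorm_sqr; have := sqr_ge0 (1 - enorm x); lra. Qed.

Let measurable_weight q : measurable_fun setT (fun x : 'rV[R]_q => (1 + enorm x) ^+ 2).
Proof.
by apply: measurable_funX; apply: measurable_funD => //; exact: measurable_enorm.
Qed.

Let iw_mu : mu.-integrable setT (EFin \o (fun x => (1 + enorm x) ^+ 2)).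
Proof.
apply: (@integrable_quadratic _ _ mu muP _ 2); first exact: measurable_weight.
by move=> x; rewrite ger0_norm ?weight_le ?sqr_ge0.
Qed.

Let iw_gam : gam.-integrable setT (EFin \o (fun g : 'rV[R]_k => (1 + enorm g) ^+ 2)).
Proof.
apply: (@integrable_std_gaussian _ _ _ 2); first exact: measurable_weight.
by move=> g; rewrite ger0_norm ?weight_le ?sqr_ge0.
Qed.

(** One bound yields joint integrability and that of all sections, hence Fubini in both orders. *)
Let dominated (F : 'rV[R]_k * 'rV[R]_n -> R) := measurable_fun setT F /\
  exists2 C, 0 <= C & forall z, `|F z| <= C * weight z.

Let dom_int F : dominated F -> (gam \x mu)%E.-integrable setT (EFin \o F).
Proof.
move=> [mF [C _ FC]]; apply: (integrable_dominated mF _ FC).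
by apply: integrableZr; exact: integrable_prodM iw_gam iw_mu.
Qed.

Let dom_int_x F g : dominated F -> mu.-integrable setT (EFin \o (fun x => F (g, x))).
Proof.
move=> [mF [C _ FC]].
apply: (integrable_dominated _ (integrableZr (C * (1 + enorm g) ^+ 2) iw_mu)).
  by apply: (measurableT_comp mF); exact: measurable_pair1.
by move=> x; apply: le_trans (FC _) _; rewrite /weight/= mulrA.
Qed.

Let dom_int_g F x : dominated F -> gam.-integrable setT (EFin \o (fun g => F (g, x))).
Proof.
move=> [mF [C _ FC]].
apply: (integrable_dominated _ (integrableZr (C * (1 + enorm x) ^+ 2) iw_gam)).
  by apply: (measurableT_comp mF); exact: measurable_pair2.
by move=> g; apply: le_trans (FC _) _; rewrite /weight/= (mulrC (_ ^+ 2)) mulrA.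
Qed.

(** The extreme case is g_i times a centered coordinate of x times h, where h is bounded by a
    multiple of (1 + |g|)(1 + |x|): it consumes both squares of [weight]. *)
Let dominatedM (f : 'rV[R]_k -> R) (g : 'rV[R]_n -> R)
    (F : 'rV[R]_k * 'rV[R]_n -> R) (a b c : R) :
  0 <= a -> 0 <= b -> 0 <= c ->
  measurable_fun setT f -> measurable_fun setT g -> measurable_fun setT F ->
  (forall x, `|f x| <= a * (1 + enorm x)) -> (forall x, `|g x| <= b * (1 + enorm x)) ->
  (forall z, `|F z| <= c * ((1 + enorm z.1) * (1 + enorm z.2))) ->
  dominated (fun z => f z.1 * g z.2 * F z).
Proof.
move=> a0 b0 c0 mf mg mF fa gb Fc; split.
  apply: measurable_funM => //; apply: measurable_funM.
    exact: (measurableT_comp mf).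
  exact: (measurableT_comp mg).
exists (a * b * c); first by rewrite !mulr_ge0.
move=> z; rewrite !normrM /weight.
apply: (@le_trans _ _ (a * (1 + enorm z.1) * (b * (1 + enorm z.2)) *
    (c * ((1 + enorm z.1) * (1 + enorm z.2))))).
  by apply: ler_pM => //; exact: ler_pM.
by rewrite le_eqVlt; apply/orP; left; apply/eqP; ring.
Qed.

Lemma interp_split t g x :
  interp t (g, x) = interp t (0, x) + sin t *: comb (fun i => g ord0 i).
Proof.
rewrite /interp/= (_ : comb (fun i => (0 : 'rV[R]_k) ord0 i) = 0).
  by rewrite scaler0 addr0 [LHS]addrA.
by rewrite /comb big1// => i _; rewrite mxE scale0r.
Qed.

Lemma smooth_comb q (c : 'I_k -> 'rV[R]_q -> R) j :
  (forall i, smooth_expr (c i)) -> smooth_expr (fun x => comb (c^~ x) ord0 j).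
Proof.
move=> sc; under eq_fun do rewrite summxE; apply: smooth_sum => i.
by under eq_fun do rewrite mxE; apply: smooth_mul => //; exact: smooth_cst.
Qed.

Lemma smooth_dev i : smooth_expr (dev^~ i).
Proof. by apply: smooth_sub; [exact: smooth_dotp|exact: smooth_cst]. Qed.

Lemma smooth_interp_x t g j : smooth_expr (fun x => interp t (g, x) ord0 j).
Proof.
rewrite /interp/= /orth_proj; under eq_fun do rewrite !mxE.
apply: smooth_add.
  apply: smooth_add; last exact: smooth_cst.
  apply: smooth_sub; first exact: smooth_coord.
  by apply: (@smooth_comb _ (fun i x => dotp x (e i))) => i; exact: smooth_dotp.
apply: smooth_add; last exact: smooth_cst.
apply: smooth_scale; apply: (@smooth_comb _ (fun i x => dev x i)) => i.
exact: smooth_dev.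
Qed.

Lemma smooth_interp_g t x j : smooth_expr (fun g => interp t (g, x) ord0 j).
Proof.
under eq_fun do rewrite interp_split !mxE.
apply: smooth_add; first exact: smooth_cst.
apply: smooth_scale; apply: (@smooth_comb _ (fun i g => g ord0 i)) => i.
exact: smooth_coord.
Qed.

Lemma measurable_interp t : measurable_fun setT (interp t).
Proof.
apply: measurable_fun_rVP => j.
(* Up to a constant, [interp] is a function of x plus a function of g, so joint measurability
   follows from smoothness in each variable separately. *)
rewrite (_ : (fun z => _) = (fun z : 'rV[R]_k * 'rV[R]_n =>
  interp t (0, z.2) ord0 j + (interp t (z.1, 0) ord0 j - interp t (0, 0) ord0 j))).
  apply: measurable_funD.
    by apply: (measurableT_comp (smooth_expr_measurable (smooth_interp_x t 0 j))).
  apply: measurable_funB => //.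
  by apply: (measurableT_comp (smooth_expr_measurable (smooth_interp_g t 0 j))).
apply/funext => -[g x] /=; rewrite (interp_split t g x) (interp_split t g 0).
by rewrite !mxE; ring.
Qed.

HB.instance Definition _ t :=
  isMeasurableFun.Build _ _ _ _ (interp t) (measurable_interp t).

Local Notation target := (direct_sum_product (gaussian_on e p) (orth_marginal e mu)).

(** The product of the images of [gam] and [mu] is the image of their product, and adding the two
    components gives [interp_pi2]: the interpolation ends at the required law. *)
Lemma direct_sum_gaussianE A : measurable A ->
  target A = distribution (gam \x mu)%E (interp (pi / 2)) A.
Proof.
move=> mA; have mA' : measurable (rV_add @^-1` A).
  by rewrite -[_ @^-1` _]setTI; exact: measurable_rV_add.
apply: etrans (prod_distribution gam mu (affine_map e p) (orth_proj e) mA') _.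
congr ((gam \x mu)%E _); apply/funext => -[g x].
by rewrite /preimage/= /rV_add /prod_map/= interp_pi2.
Qed.

Let integrable_target f : measurable_fun setT f ->
  (gam \x mu)%E.-integrable setT (EFin \o (fun z => f (interp (pi / 2) z))) ->
  target.-integrable setT (EFin \o f).
Proof.
move=> mf /(integrable_distribution mf)/integrableP[_ h].
apply/integrableP; split; first exact/measurable_EFinP.
rewrite (eq_measure_integral (distribution (gam \x mu)%E (interp (pi / 2))))//.
by move=> A mA _; exact: direct_sum_gaussianE.
Qed.

Let Rintegral_target f : measurable_fun setT f ->
  (gam \x mu)%E.-integrable setT (EFin \o (fun z => f (interp (pi / 2) z))) ->
  \int[target]_x f x = \int[(gam \x mu)%E]_z f (interp (pi / 2) z).
Proof.
move=> mf fi; rewrite -(Rintegral_distribution mf fi) /Rintegral; congr fine.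
by apply: eq_measure_integral => A mA _; exact: direct_sum_gaussianE.
Qed.

Lemma integrable_enorm_target : target.-integrable setT (EFin \o enorm).
Proof.
apply: (integrable_target (@measurable_enorm _ _)); apply: dom_int; split.
  exact: measurableT_comp (@measurable_enorm _ _) (measurable_interp _).
exists (enorm (interp (pi / 2) (0, 0)) + 1); first by rewrite addr_ge0 ?enorm_ge0.
move=> [g x]; rewrite ger0_norm ?enorm_ge0// /weight /=.
set t := pi / 2.
have := enormD (interp t (g, x) - interp t (g, 0)) (interp t (g, 0)).
have := enormD (interp t (g, 0) - interp t (0, 0)) (interp t (0, 0)).
rewrite !subrK; have := interp_lip_x t g x 0; have := interp_lip_g t g 0 0.
rewrite !subr0; have := enorm_ge0 g; have := enorm_ge0 x.
have := enorm_ge0 (interp t (0, 0)).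
move: (enorm (interp t (g, x))) (enorm (interp t (g, 0))) (enorm (interp t (0, 0)))
  (enorm g) (enorm x) (enorm (_ - interp t (g, 0))) (enorm (_ - _)).
move=> a b c u v q r c0 v0 u0 h1 h2 h3 h4.
have w : 1 + u + v <= (1 + u) ^+ 2 * (1 + v) ^+ 2.
  have uv : 0 <= u * v by exact: mulr_ge0.
  have : 0 <= ((1 + u) * (1 + v) - 1) * ((1 + u) * (1 + v)).
    by rewrite mulr_ge0//; lra.
  by rewrite -exprMn expr2; lra.
apply: (@le_trans _ _ ((c + 1) * (1 + u + v))); last by rewrite ler_wpM2l// addr_ge0.
have := mulr_ge0 c0 u0; have := mulr_ge0 c0 v0; lra.
Qed.

(** * The derivative of the interpolated expectation *)

Section test_function.
Variable h : 'rV[R]_n -> R.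
Hypotheses (sh : smooth_expr h) (hL : elipschitz 1 h).

Let hT (t : R) z : R := h (interp t z).
Let DT t i z : R := 'D_(e i) h (interp t z).

Let dh x : differentiable h x := smooth_expr_differentiable x sh.

Let smooth_hT_x t g : smooth_expr (fun x => hT t (g, x)).
Proof. by apply: (smooth_comp sh) => j; exact: smooth_interp_x. Qed.

Let smooth_hT_g t x : smooth_expr (fun g => hT t (g, x)).
Proof. by apply: (smooth_comp sh) => j; exact: smooth_interp_g. Qed.

Let lip_hT_x t g : elipschitz 1 (fun x => hT t (g, x)).
Proof.
by move=> x y; apply: le_trans (hL _ _) _; rewrite !mul1r; exact: interp_lip_x.
Qed.

Let lip_hT_g t x : elipschitz 1 (fun g => hT t (g, x)).
Proof.
by move=> g g'; apply: le_trans (hL _ _) _; rewrite !mul1r; exact: interp_lip_g.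
Qed.

Let measurable_hT t : measurable_fun setT (hT t).
Proof. exact: (measurableT_comp (smooth_expr_measurable sh) (measurable_interp t)). Qed.

Let measurable_D v : measurable_fun setT (fun x => 'D_v h x).
Proof.
rewrite (_ : (fun x => 'D_v h x) = fun x => \sum_i partial i h x * v ord0 i).
  apply: measurable_sum => i; apply: measurable_funM => //.
  by apply: smooth_expr_measurable; exact: smooth_expr_partial.
apply/funext => x; rewrite derive_dotp_grad//.
by apply: eq_bigr => i _; rewrite mxE.
Qed.

Let measurable_DT t i : measurable_fun setT (DT t i).
Proof. exact: (measurableT_comp (measurable_D (e i)) (measurable_interp t)). Qed.

Let DT_le1 t i z : `|DT t i z| <= 1.
Proof.
have := elipschitz_derive (e i) hL (dh (interp t z)).
by rewrite enorm_basis mulr1.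
Qed.

Let hT_growth t z :
  `|hT t z| <= (`|hT t (0, 0)| + 1) * ((1 + enorm z.1) * (1 + enorm z.2)).
Proof.
case: z => g x /=.
have h1 := elipschitz_growth x (lip_hT_x t g).
have h2 := elipschitz_growth g (lip_hT_g t 0).
have := enorm_ge0 g; have := enorm_ge0 x; have := normr_ge0 (hT t (0, 0)).
move: h1 h2 => /=; move: `|hT t (g, x)| `|hT t (g, 0)| `|hT t (0, 0)| (enorm g) (enorm x).
move=> a b c u v h1 h2 c0 v0 u0.
have : 0 <= c * u by exact: mulr_ge0.
have : 0 <= c * v by exact: mulr_ge0.
have : 0 <= u * v by exact: mulr_ge0.
have : 0 <= c * (u * v) by rewrite !mulr_ge0.
lra.
Qed.

Let derive_hT_x t g x i : 'D_(e i) (fun x => hT t (g, x)) x = cos t * DT t i (g, x).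
Proof.
have -> : 'D_(e i) (fun x => hT t (g, x)) x = 'D_(cos t *: e i) h (interp t (g, x)).
  rewrite /derive; rewrite [X in lim (X @ _) = _](_ : _ = fun s => s^-1 *:
    ((h \o shift (interp t (g, x))) (s *: (cos t *: e i)) - h (interp t (g, x))))//.
  by apply/funext => s /=; rewrite /hT interp_shift_x.
by rewrite /DT !derive_dotp_grad// dotpZr.
Qed.

Let partial_hT_g t g x i : partial i (fun g => hT t (g, x)) g = sin t * DT t i (g, x).
Proof.
have -> : partial i (fun g => hT t (g, x)) g = 'D_(sin t *: e i) h (interp t (g, x)).
  rewrite /partial /derive; rewrite [X in lim (X @ _) = _](_ : _ = fun s => s^-1 *:
    ((h \o shift (interp t (g, x))) (s *: (sin t *: e i)) - h (interp t (g, x))))//.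
  by apply/funext => s /=; rewrite /hT interp_shift_g.
by rewrite /DT !derive_dotp_grad// dotpZr.
Qed.

Let speed (t : R) (z : 'rV[R]_k * 'rV[R]_n) : R :=
  \sum_i (- sin t * dev z.2 i + cos t * z.1 ord0 i) * DT t i z.

Let is_derive_hT (t : R) z : is_derive t 1 (hT^~ z) (speed t z).
Proof.
apply: is_derive_eq (derivable_along (dh _) (is_derive_interp t z)) _.
rewrite derive_dotp_grad// dotp_combr; apply: eq_bigr => i _.
by rewrite /DT derive_dotp_grad.
Qed.

Let dominatedD (F G : 'rV[R]_k * 'rV[R]_n -> R) :
  dominated F -> dominated G -> dominated (fun z => F z + G z).
Proof.
move=> [mF [C C0 FC]] [mG [C' C'0 GC]]; split; first exact: measurable_funD.
exists (C + C'); first exact: addr_ge0.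
by move=> z; apply: le_trans (ler_normD _ _) _; rewrite mulrDl lerD.
Qed.

Let dominatedZ (c : R) (F : 'rV[R]_k * 'rV[R]_n -> R) : dominated F -> dominated (fun z => c * F z).
Proof.
move=> [mF [C C0 FC]]; split; first exact: measurable_funM.
exists (`|c| * C); first exact: mulr_ge0.
by move=> z; rewrite normrM -mulrA ler_wpM2l.
Qed.

Let DT_growth t i z : `|DT t i z| <= 1 * ((1 + enorm z.1) * (1 + enorm z.2)).
Proof.
apply: le_trans (DT_le1 t i z) _; rewrite mul1r -[leLHS]mulr1.
by apply: ler_pM => //; rewrite lerDl enorm_ge0.
Qed.

Let dev_growth x i : `|dev x i| <= (1 + `|m i|) * (1 + enorm x).
Proof.
apply: le_trans (ler_normB _ _) _.
have := norm_dotp_le x (e i); rewrite enorm_basis mulr1 => h1.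
have := enorm_ge0 x; have := normr_ge0 (m i).
move: `|m i| (enorm x) h1 => a b h1 a0 b0.
have := mulr_ge0 a0 b0; lra.
Qed.

Let coord_growth (g : 'rV[R]_k) i : `|g ord0 i| <= 1 * (1 + enorm g).
Proof. by rewrite mul1r (le_trans (coord_le_enorm g i))// lerDr. Qed.

Let one_fun q (_ : 'rV[R]_q) : R := 1.

Let one_fun2 (_ : 'rV[R]_k * 'rV[R]_n) : R := 1.

Let mone q : measurable_fun setT (@one_fun q).
Proof. exact: measurable_cst. Qed.

Let mone2 : measurable_fun setT one_fun2.
Proof. exact: measurable_cst. Qed.

Let cst_growth q (x : 'rV[R]_q) : `|one_fun x| <= 1 * (1 + enorm x).
Proof. by rewrite /one_fun normr1 mul1r lerDl enorm_ge0. Qed.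

Let cst_growth2 z :
  `|one_fun2 z| <= 1 * ((1 + enorm z.1) * (1 + enorm z.2)).
Proof.
by rewrite /one_fun2 normr1 mul1r -[leLHS]mulr1; apply: ler_pM => //; rewrite lerDl enorm_ge0.
Qed.

Let m_ge0 i : 0 <= 1 + `|m i|. Proof. by rewrite addr_ge0. Qed.

Let hT0_ge0 t : 0 <= `|hT t (0, 0)| + 1. Proof. by rewrite addr_ge0. Qed.

Let measurable_dev i : measurable_fun setT (dev^~ i).
Proof. exact: smooth_expr_measurable (smooth_dev i). Qed.

Let dom_hT t : dominated (hT t).
Proof.
have := dominatedM ler01 ler01 (hT0_ge0 t) (@mone k) (@mone n)
  (measurable_hT t) (@cst_growth k) (@cst_growth n) (hT_growth t).
by under [X in dominated X -> _]eq_fun do rewrite !mul1r.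
Qed.

Let dom_gDT t i : dominated (fun z => z.1 ord0 i * DT t i z).
Proof.
have := dominatedM ler01 ler01 ler01 (measurable_coord i) (@mone n)
  (measurable_DT t i) (coord_growth^~ i) (@cst_growth n) (DT_growth t i).
by under [X in dominated X -> _]eq_fun do rewrite mulr1.
Qed.

Let dom_devDT t i : dominated (fun z => dev z.2 i * DT t i z).
Proof.
have := dominatedM ler01 (m_ge0 i) ler01 (@mone k) (measurable_dev i)
  (measurable_DT t i) (@cst_growth k) (dev_growth^~ i) (DT_growth t i).
by under [X in dominated X -> _]eq_fun do rewrite mul1r.
Qed.

Let dom_gdevh t i : dominated (fun z => z.1 ord0 i * dev z.2 i * hT t z).
Proof.
exact: dominatedM ler01 (m_ge0 i) (hT0_ge0 t) (measurable_coord i) (measurable_dev i)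
  (measurable_hT t) (coord_growth^~ i) (dev_growth^~ i) (hT_growth t).
Qed.

Let dom_gh t i : dominated (fun z => z.1 ord0 i * hT t z).
Proof.
have := dominatedM ler01 ler01 (hT0_ge0 t) (measurable_coord i) (@mone n)
  (measurable_hT t) (coord_growth^~ i) (@cst_growth n) (hT_growth t).
by under [X in dominated X -> _]eq_fun do rewrite mulr1.
Qed.

Let dom_devh t i : dominated (fun z => dev z.2 i * hT t z).
Proof.
have := dominatedM ler01 (m_ge0 i) (hT0_ge0 t) (@mone k) (measurable_dev i)
  (measurable_hT t) (@cst_growth k) (dev_growth^~ i) (hT_growth t).
by under [X in dominated X -> _]eq_fun do rewrite mul1r.
Qed.

Let dom_DT t i : dominated (DT t i).
Proof.
have := dominatedM ler01 ler01 ler01 (@mone k) (@mone n)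
  (measurable_DT t i) (@cst_growth k) (@cst_growth n) (DT_growth t i).
by under [X in dominated X -> _]eq_fun do rewrite !mul1r.
Qed.

Let Phi (t : R) := \int[(gam \x mu)%E]_z hT t z.

Let is_derive_Phi (t : R) : is_derive t 1 Phi (\int[(gam \x mu)%E]_z speed t z).
Proof.
(* A bound on [speed] independent of t: sin, cos and the derivatives of h along unit vectors are at
   most 1 in absolute value. *)
pose G (z : 'rV[R]_k * 'rV[R]_n) := \sum_i (`|dev z.2 i| + `|z.1 ord0 i|).
have G0 z : 0 <= G z by apply: sumr_ge0 => i _; rewrite addr_ge0.
have iG : (gam \x mu)%E.-integrable setT (EFin \o G).
  apply: integrable_sumr => i; apply: integrableDr; apply: dom_int.
    have dg x : `| `|dev x i| | <= (1 + `|m i|) * (1 + enorm x).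
      by rewrite normr_id; exact: dev_growth.
    have := dominatedM ler01 (m_ge0 i) ler01 (@mone k)
      (measurableT_comp (@normr_measurable _ setT) (measurable_dev i)) mone2
      (@cst_growth k) dg cst_growth2.
    by under [X in dominated X -> _]eq_fun do rewrite mul1r mulr1.
  have dg (g : 'rV[R]_k) : `| `|g ord0 i| | <= 1 * (1 + enorm g).
    by rewrite normr_id; exact: coord_growth.
  have := dominatedM ler01 ler01 ler01
    (measurableT_comp (@normr_measurable _ setT) (measurable_coord i)) (@mone n)
    mone2 dg (@cst_growth n) cst_growth2.
  by under [X in dominated X -> _]eq_fun do rewrite !mulr1.
have sG s z : `|speed s z| <= G z.
  apply: le_trans (ler_norm_sum _ _ _) _; apply: ler_sum => i _.
  rewrite normrM -[leRHS]mulr1; apply: ler_pM => //.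
  apply: le_trans (ler_normD _ _) _; rewrite !normrM normrN.
  apply: lerD; rewrite -[leRHS]mul1r ler_wpM2r// ler_norml.
    by rewrite sin_geN1 sin_le1.
  by rewrite cos_geN1 cos_le1.
have It : `]t - 1, t + 1[%classic t by rewrite /= in_itv/=; lra.
have d1E s z : partial1of2 hT s z = speed s z.
  by rewrite partial1of2E; case: (is_derive_hT s z).
have H1 : forall s, `]t - 1, t + 1[%classic s ->
    (gam \x mu)%E.-integrable setT (EFin \o hT s).
  by move=> s _; exact: dom_int (dom_hT s).
have H2 : forall s z, `]t - 1, t + 1[%classic s -> setT z -> derivable (hT^~ z) s 1.
  by move=> s z _ _; case: (is_derive_hT s z).
have H3 : forall s z, `]t - 1, t + 1[%classic s -> setT z ->
    `|partial1of2 hT s z| <= G z.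
  by move=> s z _ _; rewrite d1E.
apply: DeriveDef.
  exact: (derivable_under_integral measurableT It H1 H2 G0 iG H3).
rewrite -derive1E (differentiation_under_integral measurableT It H1 H2 G0 iG H3).
by apply: eq_Rintegral => z _; exact: d1E.
Qed.

(** For fixed x the factor [dev x i] is constant, and [gaussian_IBP] applies to g |-> hT t (g, x),
    whose i-th partial derivative is [sin t * DT t i]. The factor [sin t] is thus obtained without
    any division. *)
Let ibp_dev t i : sin t * \int[(gam \x mu)%E]_z (dev z.2 i * DT t i z) =
  \int[(gam \x mu)%E]_z (z.1 ord0 i * dev z.2 i * hT t z).
Proof.
have d1 := dominatedZ (sin t) (dom_devDT t i); have d2 := dom_gdevh t i.
rewrite -(RintegralZl _ measurableT (dom_int (dom_devDT t i))).
rewrite (Rintegral_prod2 (dom_int d1)); last by move=> x; exact: (dom_int_g x d1).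
rewrite (Rintegral_prod2 (dom_int d2)); last by move=> x; exact: (dom_int_g x d2).
apply: eq_Rintegral => x _ /=.
have i1 : gam.-integrable setT (EFin \o (partial i (fun g => hT t (g, x)))).
  apply: (@bounded_integrable _ _ gam _ 1); last first.
    by move=> g; exact: partial_le (lip_hT_g t x) (smooth_hT_g t x).
  exact: smooth_expr_measurable (smooth_expr_partial i (smooth_hT_g t x)).
have i2 : gam.-integrable setT (EFin \o (fun g : 'rV[R]_k => g ord0 i * hT t (g, x))).
  exact: dom_int_g x (dom_gh t i).
transitivity (dev x i * \int[gam]_g partial i (fun g => hT t (g, x)) g).
  rewrite -(RintegralZl _ measurableT i1); apply: eq_Rintegral => g _.
  by rewrite partial_hT_g; ring.
rewrite (gaussian_IBP i (smooth_hT_g t x) (lip_hT_g t x)).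
rewrite -(RintegralZl _ measurableT i2); apply: eq_Rintegral => g _.
by ring.
Qed.

(** For fixed g the integral over x is - g_i times the Stein defect of x |-> hT t (g, x), hence at
    most |g_i| sqrt eps; integrating over g uses E|g_i| <= 1. *)
Let drift_term t i :
  `|\int[(gam \x mu)%E]_z (z.1 ord0 i * (cos t * DT t i z - dev z.2 i * hT t z))|
    <= Num.sqrt eps.
Proof.
have dF : dominated (fun z => z.1 ord0 i * (cos t * DT t i z - dev z.2 i * hT t z)).
  have := dominatedD (dominatedZ (cos t) (dom_gDT t i)) (dominatedZ (-1) (dom_gdevh t i)).
  by congr dominated; apply/funext => z; ring.
have dx g := dom_int_x g dF.
rewrite (Rintegral_prod1 (dom_int dF))//.
have iJ := integrable_Rintegral_prod1 (dom_int dF) dx.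
have [ig g1] := @gaussian_coord_norm R k i.
have J_le (g : 'rV[R]_k) :
    `|\int[mu]_x (g ord0 i * (cos t * DT t i (g, x) - dev x i * hT t (g, x)))|
      <= Num.sqrt eps * `|g ord0 i|.
  have i1 : mu.-integrable setT (EFin \o (fun x => dev x i * hT t (g, x))).
    exact: dom_int_x g (dom_devh t i).
  have i2 : mu.-integrable setT (EFin \o ('D_(e i) (fun x => hT t (g, x)))).
    rewrite (_ : 'D_(e i) _ = fun x => cos t * DT t i (g, x)).
      by apply: integrableZr; exact: dom_int_x g (dom_DT t i).
    by apply/funext => x; rewrite derive_hT_x.
  rewrite (_ : Rintegral _ _ _ = - g ord0 i * (\int[mu]_x (dev x i * hT t (g, x)) -
      \int[mu]_x 'D_(e i) (fun x => hT t (g, x)) x)).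
    rewrite normrM normrN mulrC ler_wpM2r//.
    exact: (stein_ineq muP eps0 (enorm_basis i) (vare i) (smooth_hT_x t g) (lip_hT_x t g)).
  rewrite -(RintegralB measurableT i1 i2) -(RintegralZl _ measurableT (integrableBr i1 i2)).
  by apply: eq_Rintegral => x _; rewrite derive_hT_x; ring.
apply: le_trans (le_normr_Rintegral _ iJ) _ => //.
have iN := integrableZr (Num.sqrt eps) ig.
apply: le_trans (le_Rintegral measurableT (integrable_norm iJ) iN _) _ => //.
  by move=> g _; exact: J_le.
by rewrite (RintegralZl _ measurableT ig) -[leRHS]mulr1 ler_wpM2l// sqrtr_ge0.
Qed.

(** By [ibp_dev], the [- sin t] part of the speed becomes - E[g_i dev_i h]; joined with the [cos t]
    part it forms one drift term for each of the k directions. *)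
Let Phi'_le t : `|\int[(gam \x mu)%E]_z speed t z| <= k%:R * Num.sqrt eps.
Proof.
have E : \int[(gam \x mu)%E]_z speed t z = \sum_i
    \int[(gam \x mu)%E]_z (z.1 ord0 i * (cos t * DT t i z - dev z.2 i * hT t z)).
  rewrite /speed Rintegral_sum; last first.
    move=> i; apply: dom_int.
    have := dominatedD (dominatedZ (- sin t) (dom_devDT t i))
      (dominatedZ (cos t) (dom_gDT t i)).
    by under [X in dominated X -> _]eq_fun do rewrite !mulrA -mulrDl.
  apply: eq_bigr => i _.
  have i1 := dom_int (dom_devDT t i); have i2 := dom_int (dom_gDT t i).
  have i3 := dom_int (dom_gdevh t i).
  transitivity (- sin t * \int[(gam \x mu)%E]_z (dev z.2 i * DT t i z) +
      cos t * \int[(gam \x mu)%E]_z (z.1 ord0 i * DT t i z)).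
    rewrite -!RintegralZl// -RintegralD//; [|exact: integrableZr..].
    by apply: eq_Rintegral => z _; ring.
  rewrite mulNr ibp_dev addrC -RintegralZl// -RintegralB//; last exact: integrableZr.
  by apply: eq_Rintegral => z _; ring.
rewrite E; apply: le_trans (ler_norm_sum _ _ _) _.
rewrite mulr_natl -[X in _ *+ X]card_ord -sumr_const.
by apply: ler_sum => i _; exact: drift_term.
Qed.

Let Phi_diff : `|Phi (pi / 2) - Phi 0| <= k%:R * Num.sqrt (pi * eps).
Proof.
have pi2 : 0 < pi / 2 :> R by rewrite divr_gt0 ?pi_gt0.
have [c _ ->] := @MVT _ Phi (fun t => \int[(gam \x mu)%E]_z speed t z) 0 (pi / 2) pi2
  (fun t _ => is_derive_Phi t)
  (continuous_subspaceT (fun t => differentiable_continuous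
    ((derivable1_diffP _ _).1 (@ex_derive _ _ _ _ _ _ _ (is_derive_Phi t))))).
rewrite subr0 normrM (gtr0_norm pi2) sqrtrM ?pi_ge0//.
apply: le_trans (ler_wpM2r (ltW pi2) (Phi'_le c)) _.
rewrite -mulrA ler_wpM2l// mulrC ler_wpM2r ?sqrtr_ge0//.
rewrite -[leLHS]gtr0_norm// -sqrtr_sqr ler_sqrt ?pi_ge0//.
(* The inequality pi / 2 <= sqrt pi amounts to pi <= 4. *)
have := pihalf_lt2 R; nra.
Qed.

Let Phi0 : Phi 0 = \int[mu]_x h x.
Proof.
rewrite /Phi (Rintegral_prod1 (dom_int (dom_hT 0)) (fun g => dom_int_x g (dom_hT 0))).
transitivity (\int[gam]_g (\int[mu]_x h x)).
  by apply: eq_Rintegral => g _; apply: eq_Rintegral => x _; rewrite /hT interp0.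
by rewrite (@Rintegral_cst _ _ _ gam)//= (@probability_setT _ _ _ gam) mulr1.
Qed.

Lemma lipschitz_gap :
  \int[mu]_x h x - \int[target]_x h x <= k%:R * Num.sqrt (pi * eps).
Proof.
rewrite (Rintegral_target (smooth_expr_measurable sh) (dom_int (dom_hT (pi / 2)))) -Phi0.
by apply: le_trans Phi_diff; rewrite distrC ler_norm.
Qed.

End test_function.

Lemma wasserstein1_direct_sum_gaussian :
  (wasserstein1 mu target <= (k%:R * Num.sqrt (pi * eps))%:E)%E.
Proof.
apply: wasserstein1_le_dual integrable_enorm_target lipschitz_gap.
apply: (integrable_quadratic muP (C := 1) (@measurable_enorm _ _)) => x.
rewrite ger0_norm ?enorm_ge0// mul1r -enorm_sqr.
by have := sqr_ge0 (1 - enorm x); have := enorm_ge0 x; lra.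
Qed.

Lemma mean_proj_span : p \in family_span e.
Proof. by apply: memv_suml => i _; apply/memvZ/memv_span/map_f; rewrite mem_enum. Qed.

End interpolation.

Theorem theorem1p5 (R : realType) (n k : nat)
    (mu : probability 'rV[R]_n R) (eps : R) (e : 'I_k -> 'rV[R]_n) :
  (poincare_constant mu <= 1)%E ->
  0 <= eps ->
  orthonormal_family e ->
  (forall i : 'I_k, ((1 + eps)^-1%:E <= 'V_mu[fun x => dotp x (e i)])%E) ->
  exists p : 'rV[R]_n,
    p \in family_span e /\
    (wasserstein1 mu (direct_sum_product (gaussian_on e p) (orth_marginal e mu))
       <= (k%:R * Num.sqrt (pi * eps))%:E)%E.
Proof.
move=> muP eps0 oe vare; exists (mean_proj mu e); split; first exact: mean_proj_span.
exact: wasserstein1_direct_sum_gaussian.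
Qed.
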